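(* Let $n\ge1$ and $0\le k\le n$ be integers, $\Pi=\{(x,t):0<x<1,\ t>0\}$, and consider the problem $$(\partial_t+\Lambda(x,t)\partial_x+A(x,t))u=g(x,t),\quad(x,t)\in\Pi,\qquad u(x,0)=\varphi(x),\quad x\in(0,1),$$ $$u_i(0,t)=h_i(t),\ k+1\le i\le n;\qquad u_i(1,t)=h_i(t),\ 1\le i\le k;\qquad t\in(0,\infty),$$ where $\Lambda=\mathrm{diag}(\lambda_1,\dots,\lambda_n)$, $A=\{a_{ij}\}_{i,j=1}^n$, and $u,g,\varphi$ are real $n$-vectors. Assume that $\lambda_i,a_{ij},g_i,h_i$ are smooth in all their arguments, that $\lambda_1<\dots<\lambda_k<0<\lambda_{k+1}<\dots<\lambda_n$ on $\overline\Pi$, and that all characteristics of the system are bounded. Then the continuous solution of the problem is smoothing for any $\varphi\in C[0,1]^n$ satisfying $\varphi_i(0)=h_i(0)$ for $k+1\le i\le n$ and $\varphi_i(1)=h_i(0)$ for $1\le i\le k$.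
   Context: For $(x,t)\in\overline\Pi$, $\xi=\omega_i(\tau;x,t)$ denotes the characteristic of the $i$-th equation through $(x,t)$, i.e. the solution of $d\xi/d\tau=\lambda_i(\xi,\tau)$, $\xi(t)=x$, viewed as a maximal curve in $\overline\Pi$; ''bounded'' means that this curve is a bounded set (this holds e.g. if $\inf|\lambda_i|>0$ for all $i$). $t_i(x,t)\ge0$ is the smallest $\tau\ge0$ at which the characteristic reaches $\partial\Pi$; $E_i(\tau;x,t)=\exp\int_t^\tau a_{ii}(\omega_i(\tau_1;x,t),\tau_1)\,d\tau_1$. Continuous solution: a continuous $u:\overline\Pi\to\mathbb{R}^n$ satisfying, for all $i\le n$, $$u_i(x,t)=E_i(t_i(x,t);x,t)\,B_i(x,t)+\int_{t_i(x,t)}^tE_i(\tau;x,t)\Big[-\sum_{j\ne i}a_{ij}(\xi,\tau)u_j(\xi,\tau)+g_i(\xi,\tau)\Big]\Big|_{\xi=\omega_i(\tau;x,t)}d\tau,$$ where $B_i(x,t)=\varphi_i(\omega_i(0;x,t))$ if $t_i(x,t)=0$ and $B_i(x,t)=h_i(t_i(x,t))$ otherwise. It is known to exist and be unique under the stated compatibility conditions. Smoothing: $u$ is smoothing if for every $m\in\mathbb{N}$ there is $T>0$ with $u\in C^m(\overline\Pi\cap\{t\ge T\})^n$. *)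

(* Defs.v *)
(* Stdlib reals with Coquelicot. *)
From Stdlib Require Export Reals.
From Coquelicot Require Export Coquelicot.
Open Scope R_scope.

(** Components of n-vectors are indexed by [nat], with range [1 <= i <= n]; the
    values at other indices are never used.  Functions on a subset of the line
    or of the plane are total functions whose values outside the subset are
    never used. *)

Definition Pi (p : R * R) : Prop := 0 < fst p < 1 /\ 0 < snd p.

Definition Pibar (p : R * R) : Prop := 0 <= fst p <= 1 /\ 0 <= snd p.

(** [Pi] is open with closure [Pibar]. *)
Definition boundary_Pi (p : R * R) : Prop := Pibar p /\ ~ Pi p.

(** [C^m] on a closed set [D]: the partial derivatives up to order [m] exist in
    the interior of [D] ([locally p D] says that [p] is an interior point) and
    extend continuously to [D].  The functions [fx] and [ft] below are these
    extensions. *)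
Fixpoint Cm2 (m : nat) (D : R * R -> Prop) (f : R -> R -> R) : Prop :=
  continuous_on D (fun p : R * R => f (fst p) (snd p)) /\
  match m with
  | O => True
  | S m' =>
      exists fx ft : R -> R -> R,
        Cm2 m' D fx /\ Cm2 m' D ft /\
        forall x t : R, locally (x, t) D ->
          is_derive (fun y : R => f y t) x (fx x t) /\
          is_derive (fun s : R => f x s) t (ft x t)
  end.

Fixpoint Cm1 (m : nat) (D : R -> Prop) (f : R -> R) : Prop :=
  continuous_on D f /\
  match m with
  | O => True
  | S m' =>
      exists f' : R -> R,
        Cm1 m' D f' /\
        forall t : R, locally t D -> is_derive f t (f' t)
  end.

Definition smooth2 (D : R * R -> Prop) (f : R -> R -> R) : Prop :=
  forall m : nat, Cm2 m D f.

Definition smooth1 (D : R -> Prop) (f : R -> R) : Prop :=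
  forall m : nat, Cm1 m D f.

(** [xi] solves [xi' = lam (xi, .)] on [[a, b]] and its graph stays in [Pibar].
    At the end points continuity yields the one-sided equation; [a = b] is
    allowed. *)
Definition solves_on (lam : R -> R -> R) (a b : R) (xi : R -> R) : Prop :=
  (forall s : R, a <= s <= b -> Pibar (xi s, s)) /\
  continuous_on (fun s : R => a <= s <= b) xi /\
  (forall s : R, a < s < b -> is_derive xi s (lam (xi s) s)).

(** [(y, tau)] lies on the maximal characteristic curve in [Pibar] through
    [(x, t)]: that curve is the union of the graphs of all solutions in [Pibar]
    through [(x, t)] over segments with end point [t]. *)
Definition on_char (lam : R -> R -> R) (x t y tau : R) : Prop :=
  exists xi : R -> R,
    solves_on lam (Rmin t tau) (Rmax t tau) xi /\ xi t = x /\ xi tau = y.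

Definition bounded_char (lam : R -> R -> R) (x t : R) : Prop :=
  exists M : R, forall y tau : R,
    on_char lam x t y tau -> Rabs y <= M /\ Rabs tau <= M.

(** [omega lam tau x t] is the position at time [tau] of the characteristic
    through [(x, t)]; [iota P] is the unique element satisfying [P]. *)
Definition omega (lam : R -> R -> R) (tau x t : R) : R :=
  iota (fun y : R => on_char lam x t y tau).

Definition meets_boundary (lam : R -> R -> R) (x t tau : R) : Prop :=
  0 <= tau /\
  exists y : R, on_char lam x t y tau /\ boundary_Pi (y, tau).

Definition t_hit (lam : R -> R -> R) (x t : R) : R :=
  iota (fun tau : R =>
    meets_boundary lam x t tau /\
    forall s : R, meets_boundary lam x t s -> tau <= s).

Definition E (lam : nat -> R -> R -> R) (a : nat -> nat -> R -> R -> R)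
    (i : nat) (tau x t : R) : R :=
  exp (RInt (fun s : R => a i i (omega (lam i) s x t) s) t tau).

Definition B (lam : nat -> R -> R -> R) (h phi : nat -> R -> R)
    (i : nat) (x t : R) : R :=
  if Req_EM_T (t_hit (lam i) x t) 0
  then phi i (omega (lam i) 0 x t)
  else h i (t_hit (lam i) x t).

Definition continuous_solution (n : nat) (lam : nat -> R -> R -> R)
    (a : nat -> nat -> R -> R -> R) (g : nat -> R -> R -> R)
    (h phi : nat -> R -> R) (u : nat -> R -> R -> R) : Prop :=
  (forall i : nat, (1 <= i <= n)%nat ->
     continuous_on Pibar (fun p : R * R => u i (fst p) (snd p))) /\
  (forall i : nat, (1 <= i <= n)%nat ->
   forall x t : R, Pibar (x, t) ->
     u i x t =
       E lam a i (t_hit (lam i) x t) x t * B lam h phi i x t +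
       RInt (fun tau : R =>
         let xi := omega (lam i) tau x t in
         E lam a i tau x t *
         (- sum_n_m (fun j : nat =>
              if Nat.eqb j i then 0 else a i j xi tau * u j xi tau) 1 n
          + g i xi tau)) (t_hit (lam i) x t) t).

Definition smoothing (n : nat) (u : nat -> R -> R -> R) : Prop :=
  forall m : nat, exists T : R, 0 < T /\
    forall i : nat, (1 <= i <= n)%nat ->
      Cm2 m (fun p : R * R => Pibar p /\ T <= snd p) (u i).

(* Main.v *)
Require Import Defs.
From Stdlib Require Import Lra Lia Classical ClassicalEpsilon.

(** Along the i-th characteristics, [D_i u_i = F_i := g_i - sum_j a_ij u_j] with
    [D_i = d/dt + lam_i d/dx].  Since [lam_i <> lam_j], the coupling terms gain one
    derivative: with [v = a_ij u_j / (lam_i - lam_j)], Green's formula for the transport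
    equation [D_j v = f] shows that the x-antiderivative [U] of [v] is C^1 with
    [U_t = - lam_j v + H], where [H] has a continuous x-derivative.  Hence
    [D_i U = a_ij u_j + H], so adding such potentials to [u_i] gives a function [z] with
    [D_i z = - a_ii z + k], [k] having a continuous x-derivative.  Once all
    characteristics start on the inflow boundary, where the data are smooth, this forces
    [z], and so [u_i], to be C^1.  Then [w = u_t] solves a system of the same shape, with
    [A] replaced by [A - diag(lam_t / lam)], a right-hand side containing [u], and
    boundary data [h'], while [u_x = (F - w) / lam]; induction on the order gives C^m. *)

(** * Continuity and integrals depending on parameters *)

(** The solution is only continuous, so [u_j] and its products can be differentiated only along
    characteristics; hence the integrated derivative [Broad]. Speeds, coefficients and solution are
    extended to the plane through the retraction onto the closed strip ([ext]). This keeps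
    continuity and Lipschitz bounds in x and makes the flow global, so every curve crosses its
    inflow side, possibly at a negative time. It destroys differentiability across the sides, so
    derivatives are asserted in the open strip only and carried to the sides by continuity.
    Boundedness of the characteristics ensures that at large times every curve has entered through a
    side after any prescribed time. Each new derivative costs another such crossing, so T grows with
    m. The time derivative is propagated because it is tangential to the sides, where the data can
    be differentiated. A C^1 solution of a transport equation is not found by differentiating an
    integral over a characteristic in its end points: its x-derivative is solved for first and then
    integrated. *)

Definition cont2 (f : R -> R -> R) : Prop :=
  forall p : R * R, continuous (fun q : R * R => f (fst q) (snd q)) p.

Lemma cont2_comp {U : UniformSpace} (f : R -> R -> R) (a b : U -> R) (p : U) :
  cont2 f -> continuous a p -> continuous b p ->
  continuous (fun q => f (a q) (b q)) p.
Proof.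
  intros Hf Ha Hb.
  apply (continuous_comp_2 a b f p Ha Hb), (Hf (a p, b p)).
Qed.

Lemma continuous_Rplus {U : UniformSpace} (f g : U -> R) (p : U) :
  continuous f p -> continuous g p -> continuous (fun q => f q + g q) p.
Proof. exact (continuous_plus (V := R_NormedModule) f g p). Qed.

Lemma continuous_Rminus {U : UniformSpace} (f g : U -> R) (p : U) :
  continuous f p -> continuous g p -> continuous (fun q => f q - g q) p.
Proof. exact (continuous_minus (V := R_NormedModule) f g p). Qed.

Lemma continuous_Ropp {U : UniformSpace} (f : U -> R) (p : U) :
  continuous f p -> continuous (fun q => - f q) p.
Proof. exact (continuous_opp (V := R_NormedModule) f p). Qed.

Lemma continuous_Rmult {U : UniformSpace} (f g : U -> R) (p : U) :
  continuous f p -> continuous g p -> continuous (fun q => f q * g q) p.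
Proof. exact (continuous_mult (K := R_AbsRing) f g p). Qed.

Lemma continuous_Rinv' {U : UniformSpace} (f : U -> R) (p : U) :
  continuous f p -> f p <> 0 -> continuous (fun q => / f q) p.
Proof.
  intros H H0. apply (continuous_comp f Rinv p H), continuous_Rinv, H0.
Qed.

Lemma continuous_Rdiv {U : UniformSpace} (f g : U -> R) (p : U) :
  continuous f p -> continuous g p -> g p <> 0 ->
  continuous (fun q => f q / g q) p.
Proof.
  intros H H0 H1. apply continuous_Rmult; [assumption|].
  now apply continuous_Rinv'.
Qed.

Lemma continuous_Rexp {U : UniformSpace} (f : U -> R) (p : U) :
  continuous f p -> continuous (fun q => exp (f q)) p.
Proof. intros H. apply (continuous_comp f exp p H), continuous_exp. Qed.

Lemma continuous_Rabs' {U : UniformSpace} (f : U -> R) (p : U) :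
  continuous f p -> continuous (fun q => Rabs (f q)) p.
Proof. intros H. apply (continuous_comp f Rabs p H), continuous_Rabs. Qed.

Lemma continuous_Rmax {U : UniformSpace} (f g : U -> R) (p : U) :
  continuous f p -> continuous g p -> continuous (fun q => Rmax (f q) (g q)) p.
Proof.
  intros Hf Hg.
  apply (continuous_ext (fun q => (f q + g q + Rabs (f q - g q)) / 2)).
  - intros q. unfold Rmax, Rabs.
    destruct (Rle_dec (f q) (g q)), (Rcase_abs (f q - g q)); lra.
  - apply continuous_Rmult; [|apply continuous_const].
    apply continuous_Rplus; [now apply continuous_Rplus|].
    now apply continuous_Rabs', continuous_Rminus.
Qed.

Lemma continuous_Rmin {U : UniformSpace} (f g : U -> R) (p : U) :
  continuous f p -> continuous g p -> continuous (fun q => Rmin (f q) (g q)) p.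
Proof.
  intros Hf Hg.
  apply (continuous_ext (fun q => (f q + g q - Rabs (f q - g q)) / 2)).
  - intros q. unfold Rmin, Rabs.
    destruct (Rle_dec (f q) (g q)), (Rcase_abs (f q - g q)); lra.
  - apply continuous_Rmult; [|apply continuous_const].
    apply continuous_Rminus; [now apply continuous_Rplus|].
    now apply continuous_Rabs', continuous_Rminus.
Qed.

Lemma continuous_fst' {U V W : UniformSpace} (f : U -> V * W) (p : U) :
  continuous f p -> continuous (fun q => fst (f q)) p.
Proof.
  intros H. apply (continuous_comp f fst p H).
  destruct (f p). apply continuous_fst.
Qed.

Lemma continuous_snd' {U V W : UniformSpace} (f : U -> V * W) (p : U) :
  continuous f p -> continuous (fun q => snd (f q)) p.
Proof.
  intros H. apply (continuous_comp f snd p H).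
  destruct (f p). apply continuous_snd.
Qed.

Lemma continuous_id' {U : UniformSpace} (p : U) : continuous (fun q => q) p.
Proof. apply continuous_id. Qed.

(** Tube lemma: around each point (p, s) the values of [F] vary by less than [eps], and compactness
    of the segment yields one neighbourhood of p for all s at once. *)
Lemma uniform_on_segment {U : UniformSpace} (F : U -> R -> R) (p : U) (a b eps : R) :
  (forall s, continuous (fun q : U * R => F (fst q) (snd q)) (p, s)) ->
  0 < eps ->
  locally p (fun q => forall s, a <= s <= b -> Rabs (F q s - F p s) < eps).
Proof.
  intros HF Heps.
  assert (H : forall s, exists d : posreal, forall q s',
             ball p d q -> Rabs (s' - s) < d -> Rabs (F q s' - F p s') < eps).
  { intros s.
    assert (He2 : 0 < eps / 2) by lra.
    pose proof (proj1 (filterlim_locally _ _) (HF s) (mkposreal _ He2)) as [d Hd].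
    exists d. intros q s' Hq Hs'.
    pose proof (Hd (q, s') (conj Hq Hs')) as H1.
    pose proof (Hd (p, s') (conj (ball_center _ _) Hs')) as H2.
    change (Rabs (F q s' - F p s) < eps / 2) in H1.
    change (Rabs (F p s' - F p s) < eps / 2) in H2.
    replace (F q s' - F p s') with ((F q s' - F p s) + - (F p s' - F p s)) by ring.
    eapply Rle_lt_trans; [apply Rabs_triang|]. rewrite Rabs_Ropp. lra. }
  pose (delta s := proj1_sig (constructive_indefinite_description _ (H s))).
  pose proof (fun s => proj2_sig (constructive_indefinite_description _ (H s))) as Hd.
  fold delta in Hd. cbv beta in Hd.
  destruct (compactness_value_1d a b delta) as [d Hc].
  exists d. intros q Hq s Hs.
  apply NNPP. intros Hn. apply (Hc s Hs). intros [t (_ & Ht & Hdt)].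
  apply Hn, (Hd t); [|assumption].
  eapply ball_le; [exact Hdt|exact Hq].
Qed.

Lemma ex_RInt_cont (f : R -> R) (a b : R) :
  (forall s, continuous f s) -> ex_RInt f a b.
Proof. intros H. apply (ex_RInt_continuous (V := R_CompleteNormedModule)). auto. Qed.

Lemma continuous_section {U : UniformSpace} (F : U -> R -> R) (p : U) (s : R) :
  continuous (fun q : U * R => F (fst q) (snd q)) (p, s) -> continuous (F p) s.
Proof.
  intros H.
  apply (continuous_comp_2 (fun _ => p) (fun s => s) F s);
    [apply continuous_const|apply continuous_id'|exact H].
Qed.

Lemma RInt_bound (f : R -> R) (a b M : R) :
  (forall s, continuous f s) ->
  (forall s, Rmin a b <= s <= Rmax a b -> Rabs (f s) <= M) ->
  Rabs (RInt f a b) <= M * Rabs (b - a).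
Proof.
  intros Hc HM.
  destruct (Rle_dec a b) as [Hab|Hab].
  - rewrite Rmin_left, Rmax_right in HM by lra.
    rewrite (Rabs_right (b - a)), Rmult_comm by lra.
    apply abs_RInt_le_const; auto. now apply ex_RInt_cont.
  - rewrite Rmin_right, Rmax_left in HM by lra.
    rewrite <- (opp_RInt_swap (V := R_CompleteNormedModule)) by now apply ex_RInt_cont.
    change (opp (RInt f b a)) with (- RInt f b a).
    rewrite Rabs_Ropp, (Rabs_left1 (b - a)) by lra.
    rewrite Rmult_comm. replace (- (b - a)) with (a - b) by ring.
    apply abs_RInt_le_const; auto; [lra|]. now apply ex_RInt_cont.
Qed.

Lemma continuous_Reps {U : UniformSpace} (f : U -> R) (p : U) :
  (forall eps : R, 0 < eps -> locally p (fun q => Rabs (f q - f p) < eps)) ->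
  continuous f p.
Proof.
  intros H. apply filterlim_locally. intros eps. exact (H eps (cond_pos eps)).
Qed.

Lemma continuous_Reps' {U : UniformSpace} (f : U -> R) (p : U) :
  continuous f p ->
  (forall eps : R, 0 < eps -> locally p (fun q => Rabs (f q - f p) < eps)).
Proof.
  intros H eps He. exact (proj1 (filterlim_locally _ _) H (mkposreal _ He)).
Qed.

(** The difference of the two integrals splits into a change of integrand over the moving segment,
    small by the tube lemma, and a change of end points for the fixed integrand [F p]. *)
Lemma continuous_RInt_param {U : UniformSpace} (F : U -> R -> R) (a b : U -> R) (p : U) :
  (forall q s, continuous (fun q : U * R => F (fst q) (snd q)) (q, s)) ->
  continuous a p -> continuous b p ->
  continuous (fun q => RInt (F q) (a q) (b q)) p.
Proof.
  intros HF Ha Hb.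
  assert (HFq : forall q s, continuous (F q) s).
  { intros q s. apply continuous_section, HF. }
  assert (H0 : continuous (fun q => RInt (F p) (a q) (b q)) p).
  { apply (continuous_comp_2 a b (fun x y => RInt (F p) x y) p Ha Hb).
    apply (continuous_RInt (V := R_NormedModule) (F p) (a p) (b p) (fun x y => RInt (F p) x y)).
    apply filter_forall. intros [x y]. cbn.
    apply (RInt_correct (V := R_CompleteNormedModule)), ex_RInt_cont, HFq. }
  apply continuous_Reps. intros eps He.
  (* The margins come from letting each end point move by less than 1: the moving segment then has
     length at most [L] and lies between [lo] and [hi]. *)
  set (L := Rabs (b p - a p) + 2).
  assert (HL : 0 < L) by (unfold L; pose proof (Rabs_pos (b p - a p)); lra).
  set (lo := Rmin (a p) (b p) - 1). set (hi := Rmax (a p) (b p) + 1).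
  assert (Hd : 0 < eps / 2 / L) by (apply Rdiv_lt_0_compat; lra).
  pose proof (uniform_on_segment F p lo hi _ (HF p) Hd) as H1.
  assert (He2 : 0 < eps / 2) by lra.
  pose proof (continuous_Reps' _ _ H0 _ He2) as H2.
  pose proof (continuous_Reps' _ _ Ha 1 Rlt_0_1) as H3.
  pose proof (continuous_Reps' _ _ Hb 1 Rlt_0_1) as H4.
  generalize (filter_and _ _ (filter_and _ _ H1 H2) (filter_and _ _ H3 H4)).
  apply filter_imp. clear H1 H2 H3 H4. intros q [[H1 H2] [H3 H4]].
  replace (RInt (F q) (a q) (b q) - RInt (F p) (a p) (b p)) with
    (RInt (fun s => F q s - F p s) (a q) (b q)
     + (RInt (F p) (a q) (b q) - RInt (F p) (a p) (b p))).
  2:{ rewrite (RInt_minus (V := R_CompleteNormedModule) (F q) (F p)) by now apply ex_RInt_cont.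
      unfold minus, plus, opp; cbn. ring. }
  eapply Rle_lt_trans; [apply Rabs_triang|].
  assert (Rabs (RInt (fun s => F q s - F p s) (a q) (b q)) <= eps / 2 / L * Rabs (b q - a q)).
  { apply RInt_bound.
    - intros s. now apply continuous_Rminus.
    - intros s Hs. apply Rlt_le, H1. unfold lo, hi.
      apply Rabs_def2 in H3. apply Rabs_def2 in H4.
      revert Hs. unfold Rmin, Rmax.
      destruct (Rle_dec (a q) (b q)), (Rle_dec (a p) (b p)); lra. }
  assert (Rabs (b q - a q) <= L).
  { unfold L. apply Rabs_def2 in H3. apply Rabs_def2 in H4.
    unfold Rabs. destruct (Rcase_abs (b q - a q)), (Rcase_abs (b p - a p)); lra. }
  assert (eps / 2 / L * Rabs (b q - a q) <= eps / 2).
  { apply Rle_trans with (eps / 2 / L * L).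
    - apply Rmult_le_compat_l; lra.
    - right. field. lra. }
  lra.
Qed.

Lemma cont2_RInt (F : R -> R -> R -> R) (a b : R -> R -> R) :
  (forall p : (R * R) * R, continuous (fun q : (R * R) * R => F (fst (fst q)) (snd (fst q)) (snd q)) p) ->
  cont2 a -> cont2 b ->
  cont2 (fun x t => RInt (F x t) (a x t) (b x t)).
Proof.
  intros HF Ha Hb p.
  apply (continuous_RInt_param (fun q : R * R => F (fst q) (snd q))
           (fun q => a (fst q) (snd q)) (fun q => b (fst q) (snd q)) p); auto.
Qed.

Ltac cts_step :=
  lazymatch goal with
  | |- continuous (fun _ => ?c) ?p => exact (continuous_const c p)
  | |- continuous (fun q => @?f q + @?g q) ?p => refine (continuous_Rplus f g p _ _)
  | |- continuous (fun q => @?f q - @?g q) ?p => refine (continuous_Rminus f g p _ _)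
  | |- continuous (fun q => - @?f q) ?p => refine (continuous_Ropp f p _)
  | |- continuous (fun q => @?f q * @?g q) ?p => refine (continuous_Rmult f g p _ _)
  | |- continuous (fun q => @?f q / @?g q) ?p => refine (continuous_Rdiv f g p _ _ _)
  | |- continuous (fun q => exp (@?f q)) ?p => refine (continuous_Rexp f p _)
  | |- continuous (fun q => Rabs (@?f q)) ?p => refine (continuous_Rabs' f p _)
  | |- continuous (fun q => Rmax (@?f q) (@?g q)) ?p => refine (continuous_Rmax f g p _ _)
  | |- continuous (fun q => Rmin (@?f q) (@?g q)) ?p => refine (continuous_Rmin f g p _ _)
  | |- continuous (fun q => fst (@?f q)) ?p => refine (continuous_fst' f p _)
  | |- continuous (fun q => snd (@?f q)) ?p => refine (continuous_snd' f p _)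
  | |- continuous (fun q => q) ?p => exact (continuous_id' p)
  | |- continuous fst ?p => exact (continuous_fst' (fun q => q) p (continuous_id' p))
  | |- continuous snd ?p => exact (continuous_snd' (fun q => q) p (continuous_id' p))
  | H : cont2 ?f |- continuous (fun q => ?f (@?a q) (@?b q)) ?p =>
      refine (cont2_comp f a b p H _ _)
  end; cbv beta.

Ltac cts := repeat first [ assumption | cts_step ].

Lemma cont2_x (f : R -> R -> R) (t x : R) : cont2 f -> continuous (fun y => f y t) x.
Proof. intros. cts. Qed.

Lemma cont2_t (f : R -> R -> R) (x t : R) : cont2 f -> continuous (fun s => f x s) t.
Proof. intros. cts. Qed.

Lemma is_derive_RInt_upper (f : R -> R) (a t : R) :
  (forall s, continuous f s) -> is_derive (fun t => RInt f a t) t (f t).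
Proof.
  intros H. apply (is_derive_RInt f _ a); [|apply H].
  apply filter_forall. intros b.
  apply (RInt_correct (V := R_CompleteNormedModule)). now apply ex_RInt_cont.
Qed.

Lemma continuous_is_derive (f : R -> R) (x l : R) : is_derive f x l -> continuous f x.
Proof. intros H. apply (ex_derive_continuous f). now exists l. Qed.

Lemma continuous_RInt_upper (f : R -> R) (a t : R) :
  (forall s, continuous f s) -> continuous (fun t => RInt f a t) t.
Proof. intros H. eapply continuous_is_derive, is_derive_RInt_upper, H. Qed.

Lemma constant_of_derive_0 (f : R -> R) (a b : R) :
  a <= b -> (forall s, a <= s <= b -> continuous f s) ->
  (forall s, a < s < b -> is_derive f s 0) -> f b = f a.
Proof.
  intros Hab Hc Hd.
  destruct (MVT_gen f a b (fun _ => 0)) as [c [_ Hc']].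
  - rewrite Rmin_left, Rmax_right by lra. auto.
  - rewrite Rmin_left, Rmax_right by lra. intros x Hx.
    apply continuity_pt_filterlim, Hc, Hx.
  - lra.
Qed.

(** The derivative is required only in the open interval because a characteristic may start or end
    on a side of the strip. Subtracting the integral of [df] leaves a function with zero derivative
    inside, hence a constant. *)
Lemma FTC_open (f df : R -> R) (a b : R) :
  a <= b -> (forall s, a <= s <= b -> continuous f s) -> (forall s, continuous df s) ->
  (forall s, a < s < b -> is_derive f s (df s)) ->
  f b - f a = RInt df a b.
Proof.
  intros Hab Hc Hdc Hd.
  assert (H : f b - RInt df a b = f a - RInt df a a).
  { apply (constant_of_derive_0 (fun t => f t - RInt df a t)); [assumption| |].
    - intros s Hs. apply continuous_Rminus; [auto|].
      now apply continuous_RInt_upper.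
    - intros s Hs. replace 0 with (df s - df s) by ring.
      apply (is_derive_minus (V := R_NormedModule) f); [now apply Hd|].
      now apply is_derive_RInt_upper. }
  rewrite (RInt_point (V := R_CompleteNormedModule)) in H.
  change (zero : R) with 0 in H. lra.
Qed.

Lemma RInt_Rplus (f g : R -> R) (a b : R) :
  (forall s, continuous f s) -> (forall s, continuous g s) ->
  RInt (fun s => f s + g s) a b = RInt f a b + RInt g a b.
Proof.
  intros. apply (RInt_plus (V := R_CompleteNormedModule)); now apply ex_RInt_cont.
Qed.

Lemma RInt_Rminus (f g : R -> R) (a b : R) :
  (forall s, continuous f s) -> (forall s, continuous g s) ->
  RInt (fun s => f s - g s) a b = RInt f a b - RInt g a b.
Proof.
  intros. apply (RInt_minus (V := R_CompleteNormedModule)); now apply ex_RInt_cont.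
Qed.

Lemma RInt_Rscal (c : R) (f : R -> R) (a b : R) :
  (forall s, continuous f s) -> RInt (fun s => c * f s) a b = c * RInt f a b.
Proof.
  intros. apply (RInt_scal (V := R_CompleteNormedModule) f a b c). now apply ex_RInt_cont.
Qed.

Lemma RInt_Rconst (c a b : R) : RInt (fun _ => c) a b = (b - a) * c.
Proof. exact (RInt_const (V := R_CompleteNormedModule) a b c). Qed.

Lemma RInt_Rchasles (f : R -> R) (a b c : R) :
  (forall s, continuous f s) -> RInt f a b + RInt f b c = RInt f a c.
Proof.
  intros. apply (RInt_Chasles (V := R_CompleteNormedModule)); now apply ex_RInt_cont.
Qed.

Lemma RInt_Rpoint (f : R -> R) (a : R) : RInt f a a = 0.
Proof. exact (RInt_point (V := R_CompleteNormedModule) a f). Qed.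

Lemma RInt_Rext (f g : R -> R) (a b : R) :
  a <= b -> (forall s, a < s < b -> f s = g s) -> RInt f a b = RInt g a b.
Proof.
  intros Hab H. apply RInt_ext. rewrite Rmin_left, Rmax_right by lra. exact H.
Qed.

(** * Rules of differentiation on the line *)

Lemma is_derive_eq (f : R -> R) (x l l' : R) : is_derive f x l -> l = l' -> is_derive f x l'.
Proof. now intros H <-. Qed.

Lemma is_derive_Rplus (f g : R -> R) (x l l' : R) :
  is_derive f x l -> is_derive g x l' -> is_derive (fun y => f y + g y) x (l + l').
Proof. exact (is_derive_plus (V := R_NormedModule) f g x l l'). Qed.

Lemma is_derive_Rminus (f g : R -> R) (x l l' : R) :
  is_derive f x l -> is_derive g x l' -> is_derive (fun y => f y - g y) x (l - l').
Proof. exact (is_derive_minus (V := R_NormedModule) f g x l l'). Qed.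

Lemma is_derive_Ropp (f : R -> R) (x l : R) :
  is_derive f x l -> is_derive (fun y => - f y) x (- l).
Proof. exact (is_derive_opp (V := R_NormedModule) f x l). Qed.

Lemma is_derive_Rmult (f g : R -> R) (x l l' : R) :
  is_derive f x l -> is_derive g x l' ->
  is_derive (fun y => f y * g y) x (l * g x + f x * l').
Proof. intros H H'. apply (is_derive_mult f g x l l' H H'). intros; apply Rmult_comm. Qed.

Lemma is_derive_Rdiv (f g : R -> R) (x l l' : R) :
  is_derive f x l -> is_derive g x l' -> g x <> 0 ->
  is_derive (fun y => f y / g y) x ((l * g x - f x * l') / (g x * g x)).
Proof.
  intros H H' H0. eapply is_derive_eq; [apply (is_derive_div f g x l l' H H' H0)|].
  unfold minus, plus, opp, scal, mult; cbn. field. assumption.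
Qed.

Lemma is_derive_Rexp (f : R -> R) (x l : R) :
  is_derive f x l -> is_derive (fun y => exp (f y)) x (l * exp (f x)).
Proof.
  intros H. apply (is_derive_comp exp f x (exp (f x)) l); [apply is_derive_exp|exact H].
Qed.

Lemma is_derive_Rcomp (f g : R -> R) (x l l' : R) :
  is_derive f (g x) l -> is_derive g x l' -> is_derive (fun y => f (g y)) x (l' * l).
Proof. intros H H'. apply (is_derive_comp f g x l l' H H'). Qed.

Lemma is_derive_Rid (x : R) : is_derive (fun y => y) x 1.
Proof. exact (is_derive_id x). Qed.

Lemma is_derive_Rconst (c x : R) : is_derive (fun _ => c) x 0.
Proof. exact (is_derive_const c x). Qed.

Ltac der_step :=
  lazymatch goal with
  | |- is_derive (fun _ => ?c) ?p _ => exact (is_derive_Rconst c p)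
  | |- is_derive (fun q => @?f q + @?g q) ?p _ => refine (is_derive_Rplus f g p _ _ _ _)
  | |- is_derive (fun q => @?f q - @?g q) ?p _ => refine (is_derive_Rminus f g p _ _ _ _)
  | |- is_derive (fun q => - @?f q) ?p _ => refine (is_derive_Ropp f p _ _)
  | |- is_derive (fun q => @?f q * @?g q) ?p _ => refine (is_derive_Rmult f g p _ _ _ _)
  | |- is_derive (fun q => @?f q / @?g q) ?p _ => refine (is_derive_Rdiv f g p _ _ _ _ _)
  | |- is_derive (fun q => exp (@?f q)) ?p _ => refine (is_derive_Rexp f p _ _)
  | |- is_derive (fun q => q) ?p _ => exact (is_derive_Rid p)
  end; cbv beta.

Ltac der := eapply is_derive_eq; [repeat first [ eassumption | der_step ]|]; cbv beta.

Lemma MVT_everywhere (f df : R -> R) (a b : R) :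
  (forall x, is_derive f x (df x)) ->
  exists c, Rmin a b <= c <= Rmax a b /\ f b - f a = df c * (b - a).
Proof.
  intros H. apply MVT_gen.
  - intros x _. apply H.
  - intros x _. apply continuity_pt_filterlim. exact (continuous_is_derive f x _ (H x)).
Qed.

Lemma IVT_zero (f : R -> R) (a b : R) :
  (forall x, continuous f x) -> a <= b -> Rmin (f a) (f b) <= 0 <= Rmax (f a) (f b) ->
  exists c, a <= c <= b /\ f c = 0.
Proof.
  intros H Hab H0. destruct (IVT_gen f a b 0) as [c [Hc1 Hc2]].
  - intros x. apply continuity_pt_filterlim, H.
  - assumption.
  - exists c. rewrite Rmin_left, Rmax_right in Hc1 by lra. auto.
Qed.

Lemma RInt_Req (f g : R -> R) (a b : R) : (forall s, f s = g s) -> RInt f a b = RInt g a b.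
Proof. intros H. apply RInt_ext. intros s _. apply H. Qed.

(** * The flow of a scalar field *)

Lemma nonincreasing_of_derive (f df : R -> R) (a b : R) :
  a <= b -> (forall s, a <= s <= b -> continuous f s) ->
  (forall s, a < s < b -> is_derive f s (df s)) ->
  (forall s, a < s < b -> df s <= 0) -> f b <= f a.
Proof.
  intros Hab Hc Hd Hs.
  destruct Hab as [Hab| ->]; [|lra].
  (* The mean value theorem places the intermediate point only in the closed interval, and the sign
     of [df] is unknown at the ends; truncating by 0 settles the sign wherever the point falls. *)
  destruct (MVT_gen f a b (fun s => Rmin (df s) 0)) as [c [_ Hc']].
  - rewrite Rmin_left, Rmax_right by lra. intros s H.
    rewrite Rmin_left by now apply Hs. auto.
  - rewrite Rmin_left, Rmax_right by lra. intros x Hx.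
    apply continuity_pt_filterlim, Hc, Hx.
  - pose proof (Rmin_r (df c) 0).
    assert (Rmin (df c) 0 * (b - a) <= 0 * (b - a)) by (apply Rmult_le_compat_r; lra).
    lra.
Qed.

Lemma sqr_le_exp (u v k : R) :
  0 <= k -> u * u <= v * v * exp (2 * k) -> Rabs u <= Rabs v * exp k.
Proof.
  intros Hk H.
  assert (He : exp (2 * k) = exp k * exp k).
  { rewrite <- exp_plus. f_equal. ring. }
  pose proof (exp_pos k) as Hp.
  rewrite <- (Rabs_pos_eq (exp k)) by lra. rewrite <- Rabs_mult.
  apply Rsqr_le_abs_0. unfold Rsqr. rewrite He in H. nra.
Qed.

(** The square of [d] is differentiable where the absolute value may not be: d^2 exp(-2L(s - a)) is
    nonincreasing and d^2 exp(2L(s - a)) is nondecreasing. The two directions let the comparison run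
    backward in time as well. *)
Lemma gronwall_pair (d dd : R -> R) (a b L : R) :
  0 <= L -> a <= b ->
  (forall s, a <= s <= b -> continuous d s) ->
  (forall s, a < s < b -> is_derive d s (dd s)) ->
  (forall s, a < s < b -> Rabs (dd s) <= L * Rabs (d s)) ->
  Rabs (d b) <= Rabs (d a) * exp (L * (b - a)) /\
  Rabs (d a) <= Rabs (d b) * exp (L * (b - a)).
Proof.
  intros HL Hab Hc Hd Hb.
  assert (Hsq : forall s, a < s < b -> Rabs (d s * dd s) <= L * (d s * d s)).
  { intros s Hs. rewrite Rabs_mult.
    pose proof (Hb s Hs). pose proof (Rabs_pos (d s)).
    replace (d s * d s) with (Rabs (d s) * Rabs (d s)).
    - nra.
    - rewrite <- Rabs_mult. apply Rabs_pos_eq. apply Rle_0_sqr. }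
  assert (Hp : 0 <= L * (b - a)) by (apply Rmult_le_pos; lra).
  split; apply sqr_le_exp; try assumption.
  - assert (H : d b * d b * exp (- (2 * L * (b - a))) <= d a * d a * exp (- (2 * L * (a - a)))).
    { apply (nonincreasing_of_derive (fun s => d s * d s * exp (- (2 * L * (s - a))))
               (fun s => (2 * (d s * dd s) - 2 * L * (d s * d s)) * exp (- (2 * L * (s - a))))).
      - assumption.
      - intros s Hs. specialize (Hc s Hs). cts.
      - intros s Hs. pose proof (Hd s Hs) as Hds.
        der. ring.
      - intros s Hs. pose proof (exp_pos (- (2 * L * (s - a)))).
        pose proof (Rle_abs (d s * dd s)). pose proof (Hsq s Hs). nra. }
    replace (- (2 * L * (a - a))) with 0 in H by ring. rewrite exp_0, exp_Ropp in H.
    pose proof (exp_pos (2 * L * (b - a))) as He.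
    replace (2 * (L * (b - a))) with (2 * L * (b - a)) by ring.
    apply (Rmult_le_compat_r (exp (2 * L * (b - a)))) in H; [|lra].
    rewrite Rmult_assoc, Rinv_l, Rmult_1_r in H by lra. lra.
  - assert (H : - (d b * d b * exp (2 * L * (b - a))) <= - (d a * d a * exp (2 * L * (a - a)))).
    { apply (nonincreasing_of_derive (fun s => - (d s * d s * exp (2 * L * (s - a))))
               (fun s => - (2 * (d s * dd s) + 2 * L * (d s * d s)) * exp (2 * L * (s - a)))).
      - assumption.
      - intros s Hs. specialize (Hc s Hs). cts.
      - intros s Hs. pose proof (Hd s Hs) as Hds.
        der. ring.
      - intros s Hs. pose proof (exp_pos (2 * L * (s - a))).
        pose proof (Rle_abs (- (d s * dd s))) as Ha. rewrite Rabs_Ropp in Ha.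
        pose proof (Hsq s Hs). nra. }
    replace (2 * L * (a - a)) with 0 in H by ring. rewrite exp_0 in H.
    replace (2 * (L * (b - a))) with (2 * L * (b - a)) by ring. lra.
Qed.

Lemma gronwall (d dd : R -> R) (a b L r s : R) :
  0 <= L ->
  (forall s, a <= s <= b -> continuous d s) ->
  (forall s, a < s < b -> is_derive d s (dd s)) ->
  (forall s, a < s < b -> Rabs (dd s) <= L * Rabs (d s)) ->
  a <= r <= b -> a <= s <= b ->
  Rabs (d r) <= Rabs (d s) * exp (L * Rabs (r - s)).
Proof.
  intros HL Hc Hd Hb Hr Hs.
  destruct (Rle_dec s r) as [H|H].
  - rewrite (Rabs_pos_eq (r - s)) by lra.
    apply (gronwall_pair d dd s r L); try assumption; intros u Hu;
      [apply Hc|apply Hd|apply Hb]; lra.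
  - rewrite (Rabs_left1 (r - s)) by lra. replace (- (r - s)) with (s - r) by ring.
    assert (Hrs : r <= s) by lra.
    apply (gronwall_pair d dd r s L); try assumption; intros u Hu;
      [apply Hc|apply Hd|apply Hb]; lra.
Qed.

(** The bounds are local in time but uniform over all real positions, which suffices for a flow
    defined at all times; a field extended by clamping its position can satisfy this. *)
Record regular_field (lam : R -> R -> R) : Prop := {
  rf_cont : cont2 lam;
  rf_lip : forall N, exists L, 0 < L /\ forall x y t, Rabs t <= N ->
             Rabs (lam x t - lam y t) <= L * Rabs (x - y);
  rf_bdd : forall N, exists M, 0 < M /\ forall x t, Rabs t <= N -> Rabs (lam x t) <= M
}.
Arguments rf_cont {lam} _.
Arguments rf_lip {lam} _.
Arguments rf_bdd {lam} _.

Fixpoint picard (lam : R -> R -> R) (x t : R) (m : nat) : R -> R :=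
  match m with
  | O => fun _ => x
  | S m' => fun tau => x + RInt (fun s => lam (picard lam x t m' s) s) t tau
  end.

(** Arguments are ordered as in [omega]: the time of evaluation, then the position and time through
    which the curve passes. *)
Definition flow (lam : R -> R -> R) (tau x t : R) : R :=
  real (Lim_seq (fun m => picard lam x t m tau)).

(** Integrating the weight exp(k |s - t|) from t costs only a factor 1/k; this is the gain behind
    Bielecki's weighted norm for the Picard iteration. *)
Lemma RInt_exp_bound (g : R -> R) (K k t tau : R) :
  (forall s, continuous g s) -> 0 <= K -> 0 < k ->
  (forall s, Rmin t tau <= s <= Rmax t tau -> Rabs (g s) <= K * exp (k * Rabs (s - t))) ->
  Rabs (RInt g t tau) <= K / k * exp (k * Rabs (tau - t)).
Proof.
  intros Hg HK Hk Hb.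
  assert (HKk : 0 <= K / k) by (apply Rmult_le_pos; [lra|apply Rlt_le, Rinv_0_lt_compat; lra]).
  destruct (Rle_dec t tau) as [H|H].
  - rewrite Rmin_left, Rmax_right in Hb by lra.
    assert (Hi : is_RInt (fun s => K * exp (k * (s - t))) t tau
                   (K / k * exp (k * (tau - t)) - K / k * exp (k * (t - t)))).
    { apply (is_RInt_derive (V := R_CompleteNormedModule) (fun s => K / k * exp (k * (s - t)))).
      - intros s _. der. field. lra.
      - intros s _. cts. }
    rewrite (Rabs_pos_eq (tau - t)) by lra.
    apply Rle_trans with (RInt (fun s => K * exp (k * (s - t))) t tau).
    + apply (norm_RInt_le g (fun s => K * exp (k * (s - t))) t tau); [assumption| | |].
      * intros s Hs. rewrite <- (Rabs_pos_eq (s - t)) by lra. now apply Hb.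
      * apply (RInt_correct (V := R_CompleteNormedModule)). now apply ex_RInt_cont.
      * apply (RInt_correct (V := R_CompleteNormedModule)), ex_RInt_cont. intros s. cts.
    + rewrite (is_RInt_unique _ _ _ _ Hi).
      pose proof (exp_pos (k * (t - t))). nra.
  - rewrite Rmin_right, Rmax_left in Hb by lra.
    assert (Hi : is_RInt (fun s => K * exp (k * (t - s))) tau t
                   (- (K / k) * exp (k * (t - t)) - - (K / k) * exp (k * (t - tau)))).
    { apply (is_RInt_derive (V := R_CompleteNormedModule) (fun s => - (K / k) * exp (k * (t - s)))).
      - intros s _. der. field. lra.
      - intros s _. cts. }
    rewrite (Rabs_left1 (tau - t)) by lra.
    rewrite <- (opp_RInt_swap (V := R_CompleteNormedModule)) by now apply ex_RInt_cont.
    change (opp (RInt g tau t)) with (- RInt g tau t). rewrite Rabs_Ropp.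
    apply Rle_trans with (RInt (fun s => K * exp (k * (t - s))) tau t).
    + apply (norm_RInt_le g (fun s => K * exp (k * (t - s))) tau t); [lra| | |].
      * intros s Hs. replace (t - s) with (Rabs (s - t)).
        -- now apply Hb.
        -- rewrite Rabs_left1; lra.
      * apply (RInt_correct (V := R_CompleteNormedModule)). now apply ex_RInt_cont.
      * apply (RInt_correct (V := R_CompleteNormedModule)), ex_RInt_cont. intros s. cts.
    + rewrite (is_RInt_unique _ _ _ _ Hi).
      replace (- (tau - t)) with (t - tau) by ring.
      pose proof (exp_pos (k * (t - t))). nra.
Qed.

Section Flow.

Context {lam : R -> R -> R} (Hl : regular_field lam).

Lemma picard_cont (x t : R) (m : nat) (tau : R) : continuous (picard lam x t m) tau.
Proof.
  pose proof (rf_cont Hl) as Hc.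
  revert tau. induction m as [|m IH]; intros tau; cbn; [apply continuous_const|].
  apply continuous_Rplus; [apply continuous_const|].
  apply (continuous_RInt_upper (fun s => lam (picard lam x t m s) s)).
  intros s. apply (cont2_comp lam); auto. apply continuous_id'.
Qed.

Lemma picard_field_cont (x t : R) (m : nat) (s : R) :
  continuous (fun s => lam (picard lam x t m s) s) s.
Proof.
  apply (cont2_comp lam); [apply Hl|apply picard_cont|apply continuous_id'].
Qed.

Lemma segment_abs (t tau s N : R) :
  Rabs t <= N -> Rabs tau <= N -> Rmin t tau <= s <= Rmax t tau -> Rabs s <= N.
Proof.
  unfold Rmin, Rmax, Rabs.
  destruct (Rle_dec t tau), (Rcase_abs t), (Rcase_abs tau), (Rcase_abs s); lra.
Qed.

(** In the norm weighted by exp(2L |tau - t|) the Picard map contracts by 1/2, whatever the length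
    of the time interval; removing the weight for times bounded by [N] costs a fixed factor. *)
Lemma picard_step (N : R) : exists C, 0 < C /\ forall x t tau m,
  Rabs t <= N -> Rabs tau <= N ->
  Rabs (picard lam x t (S m) tau - picard lam x t m tau) <= C * (/ 2) ^ m.
Proof.
  destruct (rf_lip Hl N) as (L & HL & Hlip).
  destruct (rf_bdd Hl N) as (M & HM & Hbdd).
  (* Bound of the first increment: [RInt_exp_bound] with constant [M] and rate 2L. *)
  set (K := M / (2 * L)).
  assert (HK : 0 < K) by (apply Rdiv_lt_0_compat; lra).
  exists (K * exp (2 * L * (2 * Rabs N))). split.
  { apply Rmult_lt_0_compat; [assumption|apply exp_pos]. }
  intros x t tau m Ht Htau.
  apply Rle_trans with (K * (/ 2) ^ m * exp (2 * L * Rabs (tau - t))).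
  2:{ replace (K * exp (2 * L * (2 * Rabs N)) * (/ 2) ^ m)
        with (K * (/ 2) ^ m * exp (2 * L * (2 * Rabs N))) by ring.
      apply Rmult_le_compat_l.
      - apply Rmult_le_pos; [lra|]. apply pow_le; lra.
      - assert (H : Rabs (tau - t) <= 2 * Rabs N).
        { pose proof (Rle_abs N). unfold Rminus.
          eapply Rle_trans; [apply Rabs_triang|]. rewrite Rabs_Ropp. lra. }
        destruct (Rle_lt_or_eq_dec (2 * L * Rabs (tau - t)) (2 * L * (2 * Rabs N))) as [H'|H'].
        + apply Rmult_le_compat_l; lra.
        + now apply Rlt_le, exp_increasing.
        + rewrite H'. lra. }
  revert tau Htau. induction m as [|m IH]; intros tau Htau.
  - cbn. rewrite Rplus_minus_l, Rmult_1_r. apply (RInt_exp_bound _ M); [intros; apply cont2_t, Hl|lra|lra|].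
    intros s Hs. apply Rle_trans with M.
    + apply Hbdd. now apply (segment_abs t tau).
    + assert (1 <= exp (2 * L * Rabs (s - t))).
      { pose proof (exp_ineq1_le (2 * L * Rabs (s - t))).
        pose proof (Rmult_le_pos (2 * L) (Rabs (s - t)) ltac:(lra) (Rabs_pos _)). lra. }
      nra.
  - change (picard lam x t (S (S m)) tau) with (x + RInt (fun s => lam (picard lam x t (S m) s) s) t tau).
    change (picard lam x t (S m) tau) with (x + RInt (fun s => lam (picard lam x t m s) s) t tau) at 1.
    replace (_ - _) with
      (RInt (fun s => lam (picard lam x t (S m) s) s) t tau - RInt (fun s => lam (picard lam x t m s) s) t tau) by ring.
    rewrite <- RInt_Rminus by apply picard_field_cont.
    replace (K * (/ 2) ^ S m) with (L * (K * (/ 2) ^ m) / (2 * L)).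
    2:{ cbn [pow]. field. lra. }
    apply RInt_exp_bound.
    + intros s. apply continuous_Rminus; apply picard_field_cont.
    + apply Rmult_le_pos; [lra|]. apply Rmult_le_pos; [lra|]. apply pow_le; lra.
    + lra.
    + intros s Hs. assert (HsN : Rabs s <= N) by (now apply (segment_abs t tau)).
      eapply Rle_trans; [apply Hlip, HsN|]. rewrite Rmult_assoc.
      apply Rmult_le_compat_l; [lra|]. apply IH, HsN.
Qed.

Lemma picard_gap (N : R) : exists C, 0 < C /\ forall x t tau m p,
  Rabs t <= N -> Rabs tau <= N ->
  Rabs (picard lam x t (m + p) tau - picard lam x t m tau) <= C * (/ 2) ^ m.
Proof.
  destruct (picard_step N) as (C & HC & H).
  exists (2 * C). split; [lra|]. intros x t tau m p Ht Htau.
  (* Each step of the induction on [p] adds at most C 2^-(m+p), which is exactly the growth of this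
     bound. *)
  apply Rle_trans with (2 * C * ((/ 2) ^ m - (/ 2) ^ (m + p))).
  - induction p as [|p IH].
    + rewrite Nat.add_0_r, Rminus_diag, Rabs_R0. lra.
    + rewrite Nat.add_succ_r.
      replace (_ - _) with ((picard lam x t (S (m + p)) tau - picard lam x t (m + p) tau)
         + (picard lam x t (m + p) tau - picard lam x t m tau)) by ring.
      eapply Rle_trans; [apply Rabs_triang|].
      pose proof (H x t tau (m + p)%nat Ht Htau). cbn [pow]. lra.
  - assert (0 < (/ 2) ^ (m + p)) by (apply pow_lt; lra). nra.
Qed.

Lemma pow_half_small (C eps : R) : 0 < C -> 0 < eps -> exists m0, forall m, (m0 <= m)%nat -> C * (/ 2) ^ m < eps.
Proof.
  intros HC He.
  destruct (pow_lt_1_zero (/ 2)) with (y := eps / C) as [m0 Hm0].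
  - rewrite Rabs_pos_eq; lra.
  - apply Rdiv_lt_0_compat; lra.
  - exists m0. intros m Hm. specialize (Hm0 m Hm).
    rewrite Rabs_pos_eq in Hm0 by (apply pow_le; lra).
    apply (Rmult_lt_compat_l C) in Hm0; [|assumption].
    replace (C * (eps / C)) with eps in Hm0 by (field; lra). assumption.
Qed.

Lemma picard_lim (x t tau : R) : is_lim_seq (fun m => picard lam x t m tau) (flow lam tau x t).
Proof.
  apply Lim_seq_correct', ex_lim_seq_cauchy_corr.
  intros eps.
  destruct (picard_gap (Rmax (Rabs t) (Rabs tau))) as (C & HC & H).
  destruct (pow_half_small C (eps / 2) HC) as [m0 Hm0]; [pose proof (cond_pos eps); lra|].
  assert (Hg : forall m, (m0 <= m)%nat -> Rabs (picard lam x t m tau - picard lam x t m0 tau) < eps / 2).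
  { intros m Hm. replace m with (m0 + (m - m0))%nat by lia.
    eapply Rle_lt_trans; [apply H; [apply Rmax_l|apply Rmax_r]|]. now apply Hm0. }
  exists m0. intros n m Hn Hm.
  pose proof (Hg n Hn). pose proof (Hg m Hm).
  replace (_ - _) with ((picard lam x t n tau - picard lam x t m0 tau)
    + - (picard lam x t m tau - picard lam x t m0 tau)) by ring.
  eapply Rle_lt_trans; [apply Rabs_triang|]. rewrite Rabs_Ropp. lra.
Qed.

Lemma picard_flow_gap (N : R) : exists C, 0 < C /\ forall x t tau m,
  Rabs t <= N -> Rabs tau <= N ->
  Rabs (flow lam tau x t - picard lam x t m tau) <= C * (/ 2) ^ m.
Proof.
  destruct (picard_gap N) as (C & HC & H). exists C. split; [assumption|].
  intros x t tau m Ht Htau.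
  apply (is_lim_seq_le (fun p => Rabs (picard lam x t (p + m) tau - picard lam x t m tau))
           (fun _ => C * (/ 2) ^ m) (Finite _) (Finite _)).
  - intros p. rewrite Nat.add_comm. now apply H.
  - apply (is_lim_seq_abs _ (Finite _)).
    apply (is_lim_seq_minus' _ _ (flow lam tau x t) (picard lam x t m tau)).
    + apply (is_lim_seq_incr_n (fun m => picard lam x t m tau)), picard_lim.
    + apply is_lim_seq_const.
  - apply is_lim_seq_const.
Qed.

Lemma flow_time_cont (x t tau : R) : continuous (fun s => flow lam s x t) tau.
Proof.
  set (N := Rmax (Rabs t) (Rabs tau + 1)).
  destruct (picard_flow_gap N) as (C & HC & H).
  apply continuous_Reps. intros eps He.
  destruct (pow_half_small C (eps / 3) HC) as [m Hm]; [lra|].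
  specialize (Hm m (Nat.le_refl m)).
  pose proof (continuous_Reps' _ _ (picard_cont x t m tau) (eps / 3) ltac:(lra)) as H1.
  pose proof (continuous_Reps' _ _ (continuous_id' tau) 1 Rlt_0_1) as H2.
  generalize (filter_and _ _ H1 H2). apply filter_imp. clear H1 H2. intros s [H1 H2].
  assert (Hs : Rabs s <= N).
  { apply Rle_trans with (Rabs tau + 1); [|apply Rmax_r].
    replace s with (tau + (s - tau)) by ring. eapply Rle_trans; [apply Rabs_triang|]. lra. }
  assert (Htau : Rabs tau <= N).
  { eapply Rle_trans; [|apply Rmax_r]. lra. }
  assert (Ht : Rabs t <= N) by apply Rmax_l.
  pose proof (H x t s m Ht Hs). pose proof (H x t tau m Ht Htau).
  replace (_ - _) with ((flow lam s x t - picard lam x t m s)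
    + (picard lam x t m s - picard lam x t m tau)
    + - (flow lam tau x t - picard lam x t m tau)) by ring.
  eapply Rle_lt_trans; [apply Rabs_triang|].
  rewrite Rabs_Ropp.
  pose proof (Rabs_triang (flow lam s x t - picard lam x t m s) (picard lam x t m s - picard lam x t m tau)).
  lra.
Qed.

Lemma flow_field_cont (x t s : R) : continuous (fun s => lam (flow lam s x t) s) s.
Proof. apply (cont2_comp lam); [apply Hl|apply flow_time_cont|apply continuous_id']. Qed.

Lemma flow_integral (x t tau : R) :
  flow lam tau x t = x + RInt (fun s => lam (flow lam s x t) s) t tau.
Proof.
  set (N := Rmax (Rabs t) (Rabs tau)).
  assert (Ht : Rabs t <= N) by apply Rmax_l.
  assert (Htau : Rabs tau <= N) by apply Rmax_r.
  destruct (picard_flow_gap N) as (C & HC & H).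
  destruct (rf_lip Hl N) as (L & HL & Hlip).
  apply cond_eq. intros eps He.
  (* Two errors are collected in [D]: the distance from the flow to the iterate m + 1, and the
     integrated Lipschitz image of its distance to the iterate m. *)
  set (D := C + L * C * (Rabs (tau - t))).
  assert (HD : 0 < D).
  { unfold D. pose proof (Rabs_pos (tau - t)).
    assert (0 <= L * C * Rabs (tau - t)) by (apply Rmult_le_pos; [apply Rmult_le_pos|]; lra). lra. }
  destruct (pow_half_small D eps HD He) as [m Hm]. specialize (Hm m (Nat.le_refl m)).
  pose proof (H x t tau (S m) Ht Htau) as H1.
  assert (H2 : Rabs (picard lam x t (S m) tau - (x + RInt (fun s => lam (flow lam s x t) s) t tau))
             <= L * (C * (/ 2) ^ m) * Rabs (tau - t)).
  { cbn [picard].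
    replace (_ - _) with (RInt (fun s => lam (picard lam x t m s) s) t tau - RInt (fun s => lam (flow lam s x t) s) t tau) by ring.
    rewrite <- RInt_Rminus by (intros; apply picard_field_cont || apply flow_field_cont).
    apply RInt_bound.
    - intros s. apply continuous_Rminus; [apply picard_field_cont|apply flow_field_cont].
    - intros s Hs. assert (HsN : Rabs s <= N) by (now apply (segment_abs t tau)).
      eapply Rle_trans; [apply Hlip, HsN|]. apply Rmult_le_compat_l; [lra|].
      rewrite Rabs_minus_sym. now apply H. }
  replace (_ - _) with ((flow lam tau x t - picard lam x t (S m) tau)
     + (picard lam x t (S m) tau - (x + RInt (fun s => lam (flow lam s x t) s) t tau))) by ring.
  eapply Rle_lt_trans; [apply Rabs_triang|].
  eapply Rle_lt_trans; [|apply Hm].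
  unfold D. cbn [pow] in H1. assert (0 < (/ 2) ^ m) by (apply pow_lt; lra). nra.
Qed.

Lemma flow_init (x t : R) : flow lam t x t = x.
Proof. rewrite flow_integral, RInt_Rpoint. ring. Qed.

Lemma flow_derive (x t tau : R) :
  is_derive (fun s => flow lam s x t) tau (lam (flow lam tau x t) tau).
Proof.
  apply (is_derive_ext (fun s => x + RInt (fun s => lam (flow lam s x t) s) t s)).
  - intros s. symmetry. apply flow_integral.
  - der.
    + apply (is_derive_RInt_upper (fun s => lam (flow lam s x t) s)). apply flow_field_cont.
    + ring.
Qed.

Lemma solution_dist (N L : R) (xi eta : R -> R) (a b r s : R) :
  0 < L ->
  (forall x y t, Rabs t <= N -> Rabs (lam x t - lam y t) <= L * Rabs (x - y)) ->
  - N <= a -> b <= N ->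
  (forall u, a <= u <= b -> continuous xi u) ->
  (forall u, a <= u <= b -> continuous eta u) ->
  (forall u, a < u < b -> is_derive xi u (lam (xi u) u)) ->
  (forall u, a < u < b -> is_derive eta u (lam (eta u) u)) ->
  a <= r <= b -> a <= s <= b ->
  Rabs (xi r - eta r) <= Rabs (xi s - eta s) * exp (L * Rabs (r - s)).
Proof.
  intros HL Hlip Ha Hb Hxc Hec Hxd Hed Hr Hs.
  apply (gronwall (fun u => xi u - eta u) (fun u => lam (xi u) u - lam (eta u) u) a b); auto.
  - lra.
  - intros u Hu. apply continuous_Rminus; auto.
  - intros u Hu. apply is_derive_Rminus; auto.
  - intros u Hu. apply Hlip, Rabs_le. lra.
Qed.

Lemma flow_unique (xi : R -> R) (a b r s : R) :
  (forall u, a <= u <= b -> continuous xi u) ->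
  (forall u, a < u < b -> is_derive xi u (lam (xi u) u)) ->
  a <= r <= b -> a <= s <= b -> xi r = flow lam r (xi s) s.
Proof.
  intros Hc Hd Hr Hs.
  set (N := Rmax (- a) b).
  destruct (rf_lip Hl N) as (L & HL & Hlip).
  apply Rminus_diag_uniq, Rabs_eq_0, Rle_antisym; [|apply Rabs_pos].
  eapply Rle_trans.
  - apply (solution_dist N L xi (fun u => flow lam u (xi s) s) a b r s); auto.
    + pose proof (Rmax_l (- a) b). unfold N. lra.
    + apply Rmax_r.
    + intros u _. apply flow_time_cont.
    + intros u _. apply flow_derive.
  - cbv beta. rewrite flow_init, Rminus_diag, Rabs_R0. lra.
Qed.

Lemma flow_flow (x t s r : R) : flow lam r (flow lam s x t) s = flow lam r x t.
Proof.
  symmetry.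
  apply (flow_unique (fun u => flow lam u x t) (Rmin r s) (Rmax r s)).
  - intros u _. apply flow_time_cont.
  - intros u _. apply flow_derive.
  - split; [apply Rmin_l|apply Rmax_l].
  - split; [apply Rmin_r|apply Rmax_r].
Qed.

Lemma flow_dist (N : R) : exists L, 0 < L /\ forall x y r s,
  Rabs r <= N -> Rabs s <= N ->
  Rabs (flow lam r x s - flow lam r y s) <= Rabs (x - y) * exp (L * Rabs (r - s)).
Proof.
  destruct (rf_lip Hl N) as (L & HL & Hlip).
  exists L. split; [assumption|]. intros x y r s Hr Hs.
  apply Rabs_le_between in Hr. apply Rabs_le_between in Hs.
  pose proof (solution_dist N L (fun u => flow lam u x s) (fun u => flow lam u y s) (- N) N r s) as H.
  cbv beta in H. rewrite !flow_init in H. apply H; auto; try lra;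
    intros; (apply flow_time_cont || apply flow_derive).
Qed.

Lemma flow_injective (x y r s : R) : flow lam r x s = flow lam r y s -> x = y.
Proof.
  intros H. rewrite <- (flow_init x s), <- (flow_init y s), <- (flow_flow x s r), <- (flow_flow y s r).
  now rewrite H.
Qed.

(** The moving curve and the base curve are compared at the common time [c q]: from there Gronwall's
    inequality controls their distance at time [a q], and only the continuity in time of the single
    base curve remains. *)
Lemma flow_cont {U : UniformSpace} (a b c : U -> R) (p : U) :
  continuous a p -> continuous b p -> continuous c p ->
  continuous (fun q => flow lam (a q) (b q) (c q)) p.
Proof.
  intros Ha Hb Hc.
  set (N := Rmax (Rabs (a p) + 1) (Rabs (c p) + 1)).
  destruct (flow_dist N) as (L & HL & Hd).
  assert (Hk : continuous (fun q => Rabs (b q - flow lam (c q) (b p) (c p)) * exp (L * Rabs (a q - c q))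
             + Rabs (flow lam (a q) (b p) (c p) - flow lam (a p) (b p) (c p))) p).
  { cts.
    - apply (continuous_comp c (fun s => flow lam s (b p) (c p))); [assumption|apply flow_time_cont].
    - apply (continuous_comp a (fun s => flow lam s (b p) (c p))); [assumption|apply flow_time_cont]. }
  apply continuous_Reps. intros eps He.
  pose proof (continuous_Reps' _ _ Hk eps He) as H1.
  pose proof (continuous_Reps' _ _ Ha 1 Rlt_0_1) as H2.
  pose proof (continuous_Reps' _ _ Hc 1 Rlt_0_1) as H3.
  generalize (filter_and _ _ H1 (filter_and _ _ H2 H3)). apply filter_imp.
  clear H1 H2 H3. intros q (H1 & H2 & H3).
  rewrite flow_init, !Rminus_diag, Rabs_R0, Rmult_0_l, Rplus_0_l, Rminus_0_r in H1.
  apply Rabs_def2 in H1.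
  assert (HaN : Rabs (a q) <= N).
  { eapply Rle_trans; [|apply Rmax_l].
    replace (a q) with (a p + (a q - a p)) by ring. eapply Rle_trans; [apply Rabs_triang|]. lra. }
  assert (HcN : Rabs (c q) <= N).
  { eapply Rle_trans; [|apply Rmax_r].
    replace (c q) with (c p + (c q - c p)) by ring. eapply Rle_trans; [apply Rabs_triang|]. lra. }
  pose proof (Hd (b q) (flow lam (c q) (b p) (c p)) (a q) (c q) HaN HcN) as H4.
  rewrite flow_flow in H4.
  replace (_ - _) with ((flow lam (a q) (b q) (c q) - flow lam (a q) (b p) (c p))
     + (flow lam (a q) (b p) (c p) - flow lam (a p) (b p) (c p))) by ring.
  eapply Rle_lt_trans; [apply Rabs_triang|]. lra.
Qed.

End Flow.

(** * Antiderivatives of solutions transported by a flow *)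

(** The three functions are continuous on the whole plane but related only in the open half strip:
    an extension by clamping is continuous, yet in general has no derivative across the sides. *)
Record C1s (T : R) (f fx ft : R -> R -> R) : Prop := {
  c1_f : cont2 f;
  c1_fx : cont2 fx;
  c1_ft : cont2 ft;
  c1_dx : forall x t, 0 < x < 1 -> T < t -> is_derive (fun y => f y t) x (fx x t);
  c1_dt : forall x t, 0 < x < 1 -> T < t -> is_derive (fun s => f x s) t (ft x t)
}.
Arguments c1_f {T f fx ft} _.
Arguments c1_fx {T f fx ft} _.
Arguments c1_ft {T f fx ft} _.
Arguments c1_dx {T f fx ft} _.
Arguments c1_dt {T f fx ft} _.

Record Cx (T : R) (f fx : R -> R -> R) : Prop := {
  cx_f : cont2 f;
  cx_fx : cont2 fx;
  cx_dx : forall x t, 0 < x < 1 -> T < t -> is_derive (fun y => f y t) x (fx x t)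
}.
Arguments cx_f {T f fx} _.

(* [f] is the derivative of [v] along the flow, in integrated form: [v] itself need
   not be differentiable in [x] or [t]. *)
Definition Broad (lam : R -> R -> R) (T : R) (v f : R -> R -> R) : Prop :=
  forall x t a b, T <= a -> a <= b ->
    (forall s, a <= s <= b -> 0 <= flow lam s x t <= 1) ->
    v (flow lam b x t) b - v (flow lam a x t) a
    = RInt (fun s => f (flow lam s x t) s) a b.

(** The mean over [0, 1] makes sense when the interval shrinks to a point, so a factor b - a can be
    split off without division. *)
Lemma RInt_mean (g : R -> R) (a b : R) :
  (forall s, continuous g s) ->
  RInt g a b = (b - a) * RInt (fun th => g (a + th * (b - a))) 0 1.
Proof.
  intros Hg.
  pose proof (RInt_comp_lin (V := R_CompleteNormedModule) g (b - a) a 0 1) as H.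
  replace ((b - a) * 0 + a) with a in H by ring.
  replace ((b - a) * 1 + a) with b in H by ring.
  rewrite <- H by now apply ex_RInt_cont. clear H.
  rewrite (RInt_scal (V := R_CompleteNormedModule) (fun y => g ((b - a) * y + a))).
  - change (scal ?u ?w) with (u * w). f_equal. apply RInt_ext. intros x _. f_equal. ring.
  - apply ex_RInt_cont. intros s.
    apply (continuous_comp (fun y => (b - a) * y + a) g); [cts|apply Hg].
Qed.

(** Caratheodory's form of the derivative: the difference quotient is [K] itself, which is
    continuous at [t0]. *)
Lemma is_derive_factor (I K : R -> R) (t0 : R) (r : R) :
  0 < r -> (forall t, Rabs (t - t0) < r -> I t = I t0 + (t - t0) * K t) ->
  continuous K t0 -> is_derive I t0 (K t0).
Proof.
  intros Hr HI HK. apply is_derive_Reals. intros eps He.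
  destruct (continuous_Reps' _ _ HK eps He) as [d Hd].
  assert (Hm : 0 < Rmin r d) by (apply Rmin_pos; [assumption|apply cond_pos]).
  exists (mkposreal _ Hm). intros h Hh Hlt. cbn in Hlt.
  rewrite HI.
  2:{ replace (t0 + h - t0) with h by ring. eapply Rlt_le_trans; [exact Hlt|apply Rmin_l]. }
  replace ((I t0 + (t0 + h - t0) * K (t0 + h) - I t0) / h) with (K (t0 + h)) by (field; assumption).
  apply Hd. unfold ball; cbn. unfold AbsRing_ball, abs, minus, plus, opp; cbn.
  replace (t0 + h + - t0) with h by ring. eapply Rlt_le_trans; [exact Hlt|apply Rmin_r].
Qed.

(** * Space derivative of the flow and Green's formula *)

Section FlowDerivative.

Context {lam mu : R -> R -> R} (Hl : regular_field lam) (Hmu : cont2 mu) (T : R).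
Hypothesis Hd : forall x t, 0 < x < 1 -> T < t -> is_derive (fun y => lam y t) x (mu x t).

Lemma flow_derive_x (y0 s0 r d : R) :
  0 < d -> T < s0 -> T < r ->
  (forall y u, Rabs (y - y0) < d -> Rmin s0 r <= u <= Rmax s0 r -> 0 < flow lam u y s0 < 1) ->
  is_derive (fun y => flow lam r y s0) y0
    (exp (RInt (fun u => mu (flow lam u y0 s0) u) s0 r)).
Proof.
  intros Hdp Hs0 Hr Hin.
  set (z u := flow lam u y0 s0).
  assert (Hz : forall u, continuous z u) by (intros u; now apply flow_time_cont).
  assert (Hmz : forall u, continuous (fun u => mu (z u) u) u).
  { intros u. apply (cont2_comp mu); auto. apply continuous_id'. }
  apply is_derive_Reals. intros eps He.
  destruct (continuous_Reps' exp (RInt (fun u => mu (z u) u) s0 r) (continuous_exp _) eps He) as [e1 He1].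
  (* [k] is the allowed error of m: integrated from s0 to r it stays below [e1], the added 1
     covering r = s0. [e2] is the displacement that keeps [mu] within [k], and division by the
     Gronwall factor [C] turns it into a bound on the initial displacement h. *)
  set (k := e1 / (Rabs (r - s0) + 1)).
  assert (Hk : 0 < k).
  { apply Rdiv_lt_0_compat; [apply cond_pos|]. pose proof (Rabs_pos (r - s0)). lra. }
  destruct (uniform_on_segment (fun w u => mu (z u + w) u) 0 (Rmin s0 r) (Rmax s0 r) k) as [e2 He2].
  { intros s. apply (cont2_comp mu (fun q : R * R => z (snd q) + fst q) snd); [assumption| |cts].
    cts. apply (continuous_comp snd z); [cts|apply Hz]. }
  { assumption. }
  destruct (flow_dist Hl (Rmax (Rabs r) (Rabs s0))) as (L & HL & Hdist).
  set (C := exp (L * (2 * Rmax (Rabs r) (Rabs s0)))).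
  assert (HC : 0 < C) by apply exp_pos.
  assert (He2C : 0 < e2 / C) by (apply Rdiv_lt_0_compat; [apply cond_pos|assumption]).
  exists (mkposreal _ (Rmin_pos _ _ Hdp He2C)). intros h Hh Hlt. cbn in Hlt.
  assert (Hlt1 : Rabs h < d) by (eapply Rlt_le_trans; [exact Hlt|apply Rmin_l]).
  assert (Hlt2 : Rabs h < e2 / C) by (eapply Rlt_le_trans; [exact Hlt|apply Rmin_r]).
  set (D u := flow lam u (y0 + h) s0 - z u).
  (* Distinct curves never meet, so the division in [m] below is legitimate at every time. *)
  assert (HD0 : forall u, D u <> 0).
  { intros u H. apply Hh. apply Rminus_diag_uniq in H.
    apply (flow_injective Hl) in H. lra. }
  assert (HDc : forall u, continuous D u).
  { intros u. apply continuous_Rminus; [now apply flow_time_cont|auto]. }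
  set (m u := (lam (flow lam u (y0 + h) s0) u - lam (z u) u) / D u).
  assert (Hm : forall u, continuous m u).
  { intros u. apply continuous_Rdiv; auto. apply continuous_Rminus; now apply flow_field_cont. }
  assert (HDs : D s0 = h).
  { unfold D, z. rewrite !flow_init by assumption. ring. }
  assert (Hratio : D r = h * exp (RInt m s0 r)).
  { assert (Hconst : D r * exp (- RInt m s0 r) = D s0 * exp (- RInt m s0 s0)).
    { assert (Hdc : forall u, is_derive (fun u => D u * exp (- RInt m s0 u)) u 0).
      { intros u.
        assert (is_derive D u (lam (flow lam u (y0 + h) s0) u - lam (z u) u)).
        { apply is_derive_Rminus; now apply flow_derive. }
        pose proof (is_derive_RInt_upper m s0 u Hm).
        der.
        replace (lam (flow lam u (y0 + h) s0) u - lam (z u) u) with (D u * m u)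
          by (unfold m; field; auto). ring. }
      destruct (Rle_dec s0 r).
      - apply (constant_of_derive_0 (fun u => D u * exp (- RInt m s0 u)) s0 r); auto.
        intros. eapply continuous_is_derive, Hdc.
      - symmetry. apply (constant_of_derive_0 (fun u => D u * exp (- RInt m s0 u)) r s0); auto; [lra|].
        intros. eapply continuous_is_derive, Hdc. }
    rewrite RInt_Rpoint, Ropp_0, exp_0, HDs, Rmult_1_r in Hconst.
    rewrite <- Hconst, Rmult_assoc, <- exp_plus, Rplus_opp_l, exp_0. ring. }
  replace ((flow lam r (y0 + h) s0 - flow lam r y0 s0) / h) with (exp (RInt m s0 r)).
  2:{ change (flow lam r (y0 + h) s0 - flow lam r y0 s0) with (D r). rewrite Hratio. field. assumption. }
  apply He1. unfold ball; cbn. unfold AbsRing_ball, abs, minus, plus, opp; cbn.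
  change (Rabs (RInt m s0 r - RInt (fun u => mu (z u) u) s0 r) < e1).
  rewrite <- RInt_Rminus by assumption.
  apply Rle_lt_trans with (k * Rabs (r - s0)).
  2:{ unfold k. apply Rlt_le_trans with (e1 / (Rabs (r - s0) + 1) * (Rabs (r - s0) + 1)).
      - apply Rmult_lt_compat_l; [exact Hk|]. lra.
      - right. field. pose proof (Rabs_pos (r - s0)). lra. }
  apply RInt_bound; [intros; now apply continuous_Rminus|].
  intros u Hu.
  assert (HuT : T < u).
  { destruct Hu as [Hu _]. eapply Rlt_le_trans; [|exact Hu]. now apply Rmin_glb_lt. }
  assert (Hin1 : 0 < flow lam u (y0 + h) s0 < 1).
  { apply Hin; [|assumption]. now replace (y0 + h - y0) with h by ring. }
  assert (Hin0 : 0 < z u < 1).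
  { apply Hin; [|assumption]. now rewrite Rminus_diag, Rabs_R0. }
  (* The mean value theorem identifies [m u] with the value of [mu] at a point between the two
     curves. *)
  destruct (MVT_gen (fun y => lam y u) (z u) (flow lam u (y0 + h) s0) (fun y => mu y u)) as [c [Hc1 Hc2]].
  { intros x Hx. apply Hd; [|assumption]. revert Hx. unfold Rmin, Rmax. destruct (Rle_dec _ _); lra. }
  { intros x Hx. apply continuity_pt_filterlim, cont2_x, Hl. }
  cbv beta in Hc2.
  replace (m u) with (mu c u).
  2:{ unfold m. rewrite Hc2. change (flow lam u (y0 + h) s0 - z u) with (D u). field. auto. }
  replace c with (z u + (c - z u)) by ring.
  replace (mu (z u) u) with (mu (z u + 0) u) by (now rewrite Rplus_0_r).
  apply Rlt_le, He2; [|assumption].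
  unfold ball; cbn. unfold AbsRing_ball, abs, minus, plus, opp; cbn.
  replace (c - z u + - 0) with (c - z u) by ring.
  apply Rle_lt_trans with (Rabs (D u)).
  { unfold D. revert Hc1. unfold Rmin, Rmax, Rabs.
    destruct (Rle_dec (z u) (flow lam u (y0 + h) s0)), (Rcase_abs (c - z u)),
      (Rcase_abs (flow lam u (y0 + h) s0 - z u)); lra. }
  apply Rle_lt_trans with (Rabs h * C).
  2:{ replace (pos e2) with (e2 / C * C) by (field; lra). now apply Rmult_lt_compat_r. }
  unfold D, z. eapply Rle_trans; [apply Hdist|].
  - apply (segment_abs s0 r); [apply Rmax_r|apply Rmax_l|assumption].
  - apply Rmax_r.
  - replace (y0 + h - y0) with h by ring. apply Rmult_le_compat_l; [apply Rabs_pos|].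
    unfold C.
    assert (Huu : Rabs (u - s0) <= 2 * Rmax (Rabs r) (Rabs s0)).
    { unfold Rminus. eapply Rle_trans; [apply Rabs_triang|]. rewrite Rabs_Ropp.
      pose proof (segment_abs s0 r u (Rmax (Rabs r) (Rabs s0)) (Rmax_r _ _) (Rmax_l _ _) Hu).
      pose proof (Rmax_r (Rabs r) (Rabs s0)). lra. }
    destruct (Rle_lt_or_eq_dec _ _ Huu) as [H'|H'].
    + apply Rlt_le, exp_increasing, Rmult_lt_compat_l; assumption.
    + rewrite H'. lra.
Qed.

Lemma flow_speed (N : R) : exists M, 0 < M /\ forall x r s,
  Rabs r <= N -> Rabs s <= N -> Rabs (flow lam r x s - x) <= M * Rabs (r - s).
Proof.
  destruct (rf_bdd Hl N) as (M & HM & H). exists M. split; [assumption|].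
  intros x r s Hr Hs. rewrite flow_integral, Rplus_minus_l by assumption.
  apply RInt_bound; [intros; now apply flow_field_cont|].
  intros u Hu. apply H. now apply (segment_abs s r).
Qed.

(** Green's formula without differentiating [v] in x or t: the integral at time t is pulled back to
    time t0 along the flow. There the integrand is [v] along a curve times the Jacobian, which is
    differentiable in t, and the motion of the end points produces the two boundary terms. *)
Lemma RInt_broad_derive (v f : R -> R -> R) (x0 x1 t0 : R) :
  cont2 v -> cont2 f -> Broad lam T v f ->
  T < t0 -> 0 < x0 < 1 -> 0 < x1 < 1 ->
  is_derive (fun t => RInt (fun y => v y t) x0 x1) t0
    (RInt (fun y => f y t0 + mu y t0 * v y t0) x0 x1
     - lam x1 t0 * v x1 t0 + lam x0 t0 * v x0 t0).
Proof.
  intros Hv Hf HB Ht0 Hx0 Hx1.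
  destruct (flow_speed (Rabs t0 + 1)) as (M & HM & Hsp).
  (* All base points at time t0 will lie between [lo] and [hi]. [d] is the room from these to the
     sides of the strip and to x0, x1; during a time less than [r] the flow moves by less than
     [d]. *)
  set (lo := Rmin x0 x1 / 2). set (hi := (1 + Rmax x0 x1) / 2).
  assert (Hlo : 0 < lo /\ lo < x0 /\ lo < x1).
  { unfold lo, Rmin. destruct (Rle_dec x0 x1); lra. }
  assert (Hhi : hi < 1 /\ x0 < hi /\ x1 < hi).
  { unfold hi, Rmax. destruct (Rle_dec x0 x1); lra. }
  set (d := Rmin (Rmin lo (1 - hi)) (Rmin (Rmin (x0 - lo) (x1 - lo)) (Rmin (hi - x0) (hi - x1)))).
  assert (Hd0 : 0 < d) by (unfold d; repeat apply Rmin_pos; lra).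
  assert (Hdd : d <= lo /\ d <= 1 - hi /\ d <= x0 - lo /\ d <= x1 - lo /\ d <= hi - x0 /\ d <= hi - x1).
  { unfold d, Rmin. repeat destruct (Rle_dec _ _); lra. }
  set (r := Rmin (Rmin 1 (t0 - T)) (d / M)).
  assert (Hr0 : 0 < r).
  { unfold r. repeat apply Rmin_pos; try lra. now apply Rdiv_lt_0_compat. }
  assert (Hr : r <= 1 /\ r <= t0 - T /\ M * r <= d).
  { assert (Hr3 : r <= 1 /\ r <= t0 - T /\ r <= d / M).
    { unfold r, Rmin. repeat destruct (Rle_dec _ _); lra. }
    repeat split; try lra. replace d with (M * (d / M)) by (field; lra).
    apply Rmult_le_compat_l; lra. }
  assert (Hnear : forall s, Rabs (s - t0) < r -> Rabs s <= Rabs t0 + 1).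
  { intros s Hs. replace s with (t0 + (s - t0)) by ring. eapply Rle_trans; [apply Rabs_triang|]. lra. }
  assert (Ht0N : Rabs t0 <= Rabs t0 + 1) by lra.
  assert (HW : forall y s, lo < y < hi -> Rabs (s - t0) < r -> 0 < flow lam s y t0 < 1).
  { intros y s Hy Hs. pose proof (Hsp y s t0 (Hnear s Hs) Ht0N) as H.
    assert (M * Rabs (s - t0) < M * r) by (apply Rmult_lt_compat_l; assumption).
    apply Rabs_le_between in H. lra. }
  set (eta x t := flow lam t0 x t).
  assert (Heta : forall x t, x = x0 \/ x = x1 -> Rabs (t - t0) < r -> lo < eta x t < hi).
  { intros x t Hx Ht. pose proof (Hsp x t0 t Ht0N (Hnear t Ht)) as H. fold (eta x t) in H.
    rewrite (Rabs_minus_sym t0) in H.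
    assert (M * Rabs (t - t0) < M * r) by (apply Rmult_lt_compat_l; assumption).
    apply Rabs_le_between in H. destruct Hx; subst x; lra. }
  (* Jacobian of the flow from time t0 to time t, as given by [flow_derive_x]. *)
  set (J t y := exp (RInt (fun u => mu (flow lam u y t0) u) t0 t)).
  assert (HmuW : forall p : (R * R) * R, continuous (fun q : (R * R) * R => mu (flow lam (snd q) (snd (fst q)) t0) (snd q)) p).
  { intros p. cts. apply flow_cont; auto; cts. }
  assert (HJ : cont2 J).
  { intros p. unfold J. apply continuous_Rexp.
    apply (cont2_RInt (fun t y u => mu (flow lam u y t0) u) (fun _ _ => t0) (fun t _ => t)); [exact HmuW| |];
      intros q; cts. }
  set (Phi t y := v (flow lam t y t0) t * J t y).
  assert (HPhi : cont2 Phi).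
  { intros p. unfold Phi. cts. apply flow_cont; auto; cts. }
  set (Psi t y := (f (flow lam t y t0) t + mu (flow lam t y t0) t * v (flow lam t y t0) t) * J t y).
  assert (HPsi : cont2 Psi).
  { intros p. unfold Psi. cts; apply flow_cont; auto; cts. }
  assert (HPhi0 : forall y, Phi t0 y = v y t0).
  { intros y. unfold Phi, J. rewrite flow_init, RInt_Rpoint, exp_0 by assumption. ring. }
  assert (HPsi0 : forall y, Psi t0 y = f y t0 + mu y t0 * v y t0).
  { intros y. unfold Psi, J. rewrite flow_init, RInt_Rpoint, exp_0 by assumption. ring. }
  assert (HfW : forall y s, continuous (fun s => f (flow lam s y t0) s) s).
  { intros y s. apply (cont2_comp f); auto; [now apply flow_time_cont|cts]. }
  assert (HPhid : forall y t, lo < y < hi -> Rabs (t - t0) < r -> is_derive (fun t => Phi t y) t (Psi t y)).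
  { intros y t Hy Ht.
    assert (H1 : is_derive (fun t => v (flow lam t y t0) t) t (f (flow lam t y t0) t)).
    { apply (is_derive_ext_loc (fun t => v y t0 + RInt (fun s => f (flow lam s y t0) s) t0 t)).
      - assert (Hr' : 0 < r - Rabs (t - t0)) by lra.
        exists (mkposreal _ Hr'). intros s Hs.
        change (Rabs (s - t) < r - Rabs (t - t0)) in Hs.
        assert (Hs' : Rabs (s - t0) < r).
        { replace (s - t0) with ((s - t) + (t - t0)) by ring.
          eapply Rle_lt_trans; [apply Rabs_triang|]. lra. }
        pose proof (Rabs_def2 _ _ Hs') as Hs2.
        assert (Hin : forall u, Rmin t0 s <= u <= Rmax t0 s -> 0 <= flow lam u y t0 <= 1).
        { intros u Hu. assert (0 < flow lam u y t0 < 1); [|lra]. apply HW; [assumption|].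
          revert Hu. unfold Rmin, Rmax. destruct (Rle_dec t0 s); intros; apply Rabs_def1; lra. }
        enough (H1 : v y t0 + RInt (fun s => f (flow lam s y t0) s) t0 s = v (flow lam s y t0) s)
          by exact H1.
        destruct (Rle_dec t0 s) as [Hts|Hts].
        + rewrite Rmin_left, Rmax_right in Hin by lra.
          pose proof (HB y t0 t0 s ltac:(lra) Hts Hin) as HBs.
          rewrite flow_init in HBs by assumption. lra.
        + rewrite Rmin_right, Rmax_left in Hin by lra.
          pose proof (HB y t0 s t0 ltac:(lra) ltac:(lra) Hin) as HBs.
          rewrite flow_init in HBs by assumption.
          pose proof (RInt_Rchasles (fun s => f (flow lam s y t0) s) t0 s t0 (HfW y)) as Hch.
          rewrite RInt_Rpoint in Hch. lra.
      - der.
        + apply (is_derive_RInt_upper (fun s => f (flow lam s y t0) s)). apply HfW.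
        + ring. }
    assert (H2 : is_derive (fun t => J t y) t (mu (flow lam t y t0) t * J t y)).
    { unfold J. der.
      - apply (is_derive_RInt_upper (fun u => mu (flow lam u y t0) u)).
        intros s. apply (cont2_comp mu); auto; [now apply flow_time_cont|cts].
      - ring. }
    unfold Phi, Psi. der. ring. }
  (* Change of variables by the flow; the new end points are the positions at time t0 of the curves
     through (x0, t) and (x1, t). *)
  assert (HI : forall t, Rabs (t - t0) < r ->
            RInt (fun y => v y t) x0 x1 = RInt (fun y => Phi t y) (eta x0 t) (eta x1 t)).
  { intros t Ht.
    assert (Hx : forall x, flow lam t (eta x t) t0 = x).
    { intros x. unfold eta. rewrite flow_flow by assumption. now apply flow_init. }
    rewrite <- (Hx x0) at 1. rewrite <- (Hx x1) at 1.
    rewrite <- (RInt_comp (V := R_CompleteNormedModule) (fun y => v y t) (fun y => flow lam t y t0) (fun y => J t y)).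
    - apply RInt_ext. intros y _. unfold Phi. apply Rmult_comm.
    - intros y _. now apply cont2_x.
    - intros y Hy. split; [|now apply (cont2_t J)].
      assert (Hy' : lo < y < hi).
      { pose proof (Heta x0 t (or_introl eq_refl) Ht). pose proof (Heta x1 t (or_intror eq_refl) Ht).
        revert Hy. unfold Rmin, Rmax. destruct (Rle_dec _ _); lra. }
      pose proof (Rabs_def2 _ _ Ht) as Ht'.
      apply (flow_derive_x y t0 t (Rmin (y - lo) (hi - y))).
      + apply Rmin_pos; lra.
      + assumption.
      + lra.
      + intros y' u Hy1 Hu. apply HW.
        * pose proof (Rmin_l (y - lo) (hi - y)). pose proof (Rmin_r (y - lo) (hi - y)).
          apply Rabs_def2 in Hy1. lra.
        * revert Hu. unfold Rmin, Rmax. destruct (Rle_dec t0 t); intros Hu; apply Rabs_def1; lra. }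
  (* Each contribution is written as t - t0 times means over [0, 1] that are continuous at t0:
     [shift] is the mean speed, [edge] comes from the displaced end points, [core] from the growth
     of [Phi] in time. *)
  set (shift x t := RInt (fun th => lam (flow lam (t + th * (t0 - t)) x t) (t + th * (t0 - t))) 0 1).
  assert (Hshift : forall x t, eta x t = x - (t - t0) * shift x t).
  { intros x t. unfold eta. rewrite flow_integral by assumption.
    rewrite RInt_mean by (intros; now apply flow_field_cont). unfold shift. ring. }
  set (edge x t := - shift x t * RInt (fun th => Phi t (x + th * (eta x t - x))) 0 1).
  set (core t := RInt (fun y => RInt (fun th => Psi (t0 + th * (t - t0)) y) 0 1) x0 x1).
  assert (HPhic : forall t y, continuous (fun y => Phi t y) y) by (intros; now apply cont2_t).
  set (K t := core t + edge x1 t - edge x0 t).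
  assert (Hmain : forall t, Rabs (t - t0) < r ->
     RInt (fun y => v y t) x0 x1 = RInt (fun y => v y t0) x0 x1 + (t - t0) * K t).
  { intros t Ht. rewrite HI by assumption.
    rewrite <- (RInt_Rchasles (fun y => Phi t y) (eta x0 t) x0 (eta x1 t)) by apply HPhic.
    rewrite <- (RInt_Rchasles (fun y => Phi t y) x0 x1 (eta x1 t)) by apply HPhic.
    pose proof (RInt_Rchasles (fun y => Phi t y) x0 (eta x0 t) x0 (HPhic t)) as Hch.
    rewrite RInt_Rpoint in Hch.
    assert (He : forall x, RInt (fun y => Phi t y) x (eta x t) = (t - t0) * edge x t).
    { intros x. rewrite RInt_mean by apply HPhic. unfold edge.
      set (Q := RInt (fun th => Phi t (x + th * (eta x t - x))) 0 1).
      rewrite Hshift. change ((x - (t - t0) * shift x t - x) * Q = (t - t0) * (- shift x t * Q)). ring. }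
    assert (Hcore : RInt (fun y => Phi t y) x0 x1 = RInt (fun y => v y t0) x0 x1 + (t - t0) * core t).
    { assert (HMc : forall y, continuous (fun y => RInt (fun th => Psi (t0 + th * (t - t0)) y) 0 1) y).
      { intros y. apply (continuous_RInt_param (fun y th => Psi (t0 + th * (t - t0)) y)); intros; cts. }
      unfold core. rewrite <- RInt_Rscal by apply HMc.
      rewrite <- RInt_Rplus.
      2:{ intros. now apply cont2_x. }
      2:{ intros y. apply (continuous_Rmult (fun _ => t - t0)); [cts|apply HMc]. }
      apply RInt_ext. intros y Hy.
      assert (Hy' : lo < y < hi).
      { revert Hy. unfold Rmin, Rmax. destruct (Rle_dec _ _); lra. }
      rewrite <- HPhi0. rewrite <- (RInt_mean (fun s => Psi s y) t0 t) by (intros; now apply cont2_x).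
      enough (is_RInt (fun s => Psi s y) t0 t (Phi t y - Phi t0 y)) as Hi.
      { apply (is_RInt_unique (V := R_CompleteNormedModule)) in Hi.
        change (Phi t y = Phi t0 y + RInt (fun s => Psi s y) t0 t). lra. }
      apply (is_RInt_derive (V := R_CompleteNormedModule) (fun s => Phi s y)).
      - intros s Hs. apply HPhid; [assumption|]. pose proof (Rabs_def2 _ _ Ht).
        revert Hs. unfold Rmin, Rmax. destruct (Rle_dec t0 t); intros; apply Rabs_def1; lra.
      - intros s _. now apply cont2_x. }
    pose proof (He x0) as E0. pose proof (He x1) as E1. unfold K. lra. }
  assert (HKc : continuous K t0).
  { assert (Hsh : forall x t, continuous (fun t => shift x t) t).
    { intros x t. unfold shift.
      apply (continuous_RInt_param (fun t th => lam (flow lam (t + th * (t0 - t)) x t) (t + th * (t0 - t)))); [|cts|cts].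
      intros q s. apply (cont2_comp lam); [apply Hl| |cts]. apply flow_cont; auto; cts. }
    assert (Hed : forall x t, continuous (fun t => edge x t) t).
    { intros x t. unfold edge. apply continuous_Rmult; [apply continuous_Ropp, Hsh|].
      apply (continuous_RInt_param (fun t th => Phi t (x + th * (eta x t - x)))); [|cts|cts].
      intros q s. cts. unfold eta. apply flow_cont; auto; cts. }
    unfold K. cts; [|exact (Hed x1 t0)|exact (Hed x0 t0)]. unfold core.
    apply (continuous_RInt_param (fun t y => RInt (fun th => Psi (t0 + th * (t - t0)) y) 0 1)); [|cts|cts].
    intros q s.
    apply (cont2_RInt (fun t y th => Psi (t0 + th * (t - t0)) y) (fun _ _ => 0) (fun _ _ => 1)); intros ?; cts. }
  pose proof (is_derive_factor (fun t => RInt (fun y => v y t) x0 x1) K t0 r Hr0 Hmain HKc) as Hres.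
  eapply is_derive_eq; [exact Hres|].
  assert (Hsh0 : forall x, shift x t0 = lam x t0).
  { intros x. unfold shift.
    rewrite (RInt_ext _ (fun _ => lam x t0)).
    - rewrite RInt_Rconst, Rminus_0_r. apply Rmult_1_l.
    - intros th _. replace (t0 + th * (t0 - t0)) with t0 by ring. now rewrite flow_init. }
  assert (Hed0 : forall x, edge x t0 = - lam x t0 * v x t0).
  { intros x. unfold edge. rewrite Hsh0. f_equal.
    rewrite (RInt_ext _ (fun _ => v x t0)).
    - rewrite RInt_Rconst, Rminus_0_r. apply Rmult_1_l.
    - intros th _. unfold eta. rewrite flow_init by assumption.
      replace (x + th * (x - x)) with x by ring. apply HPhi0. }
  assert (Hc0 : core t0 = RInt (fun y => f y t0 + mu y t0 * v y t0) x0 x1).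
  { unfold core. apply RInt_ext. intros y _. rewrite <- HPsi0.
    rewrite (RInt_ext _ (fun _ => Psi t0 y)).
    - rewrite RInt_Rconst, Rminus_0_r. apply Rmult_1_l.
    - intros th _. f_equal. ring. }
  unfold K. rewrite !Hed0, Hc0. ring.
Qed.

(** The base point is the middle of the strip because Green's formula is available between interior
    points only. *)
Definition potential (v : R -> R -> R) (x t : R) : R := RInt (fun y => v y t) (/ 2) x.

(** What Green's formula leaves apart from the flux at x: the flux at the base point and an
    integral, whose x-derivative contains [f] and [v] but no derivative of [v]. *)
Definition potential_rest (v f : R -> R -> R) (x t : R) : R :=
  lam (/ 2) t * v (/ 2) t + RInt (fun y => f y t + mu y t * v y t) (/ 2) x.

Lemma potential_rest_Cx (v f : R -> R -> R) :
  cont2 v -> cont2 f -> Cx T (potential_rest v f) (fun x t => f x t + mu x t * v x t).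
Proof.
  intros Hv Hf. pose proof (rf_cont Hl) as Hlc. split.
  - intros p. unfold potential_rest. cts.
    apply (cont2_RInt (fun x t y => f y t + mu y t * v y t) (fun _ _ => / 2) (fun x _ => x)); intros ?; cts.
  - intros p. cts.
  - intros x t _ _. unfold potential_rest. der.
    + apply (is_derive_RInt_upper (fun y => f y t + mu y t * v y t)). intros; cts.
    + ring.
Qed.

Lemma potential_C1s (v f : R -> R -> R) :
  cont2 v -> cont2 f -> Broad lam T v f ->
  C1s T (potential v) v (fun x t => - (lam x t * v x t) + potential_rest v f x t).
Proof.
  intros Hv Hf HB. pose proof (rf_cont Hl) as Hlc.
  pose proof (cx_f (potential_rest_Cx v f Hv Hf)) as Hrc. split; auto.
  - intros p. unfold potential.
    apply (cont2_RInt (fun x t y => v y t) (fun _ _ => / 2) (fun x _ => x)); intros ?; cts.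
  - intros p. cts.
  - intros x t _ _. unfold potential. apply (is_derive_RInt_upper (fun y => v y t)). intros; cts.
  - intros x t Hx Ht. unfold potential, potential_rest. eapply is_derive_eq.
    + apply (RInt_broad_derive v f (/ 2) x t Hv Hf HB Ht); [lra|exact Hx].
    + ring.
Qed.

End FlowDerivative.

(** * Transport from the inflow boundary *)

(* [e] is the end point of [0, 1] where the flow enters, [sg] the sign of [lam]; thus
   [sg * (x - e)] is the distance of [x] to the inflow side. *)
Record inflow (lam : R -> R -> R) (sg e : R) : Prop := {
  in_reg : regular_field lam;
  in_side : (sg = 1 /\ e = 0) \/ (sg = -1 /\ e = 1);
  in_pos : forall x t, 0 < sg * lam x t;
  in_past : exists c, 0 < c /\ forall x t, t <= 0 -> c <= sg * lam x t;
  in_exit : forall T, 0 <= T -> exists T1, T <= T1 /\ 1 <= sg * (flow lam T1 e T - e)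
}.
Arguments in_reg {lam sg e} _.
Arguments in_side {lam sg e} _.
Arguments in_pos {lam sg e} _.
Arguments in_past {lam sg e} _.
Arguments in_exit {lam sg e} _.

(* The time at which the curve through [(x, t)] crosses the inflow side of the strip
   extended to all times; it may be negative. *)
Definition foot (lam : R -> R -> R) (e x t : R) : R :=
  iota (fun s : R => flow lam s x t = e).

Definition clamp (x : R) : R := Rmax 0 (Rmin 1 x).

Lemma clamp_bounds (x : R) : 0 <= clamp x <= 1.
Proof. unfold clamp, Rmax, Rmin. repeat destruct (Rle_dec _ _); lra. Qed.

Lemma clamp_id (x : R) : 0 <= x <= 1 -> clamp x = x.
Proof. intros H. unfold clamp, Rmax, Rmin. repeat destruct (Rle_dec _ _); lra. Qed.

Lemma clamp_cont {U : UniformSpace} (a : U -> R) (p : U) :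
  continuous a p -> continuous (fun q => clamp (a q)) p.
Proof. intros H. unfold clamp. cts. Qed.

Lemma eq_at_boundary (f g : R -> R) (x : R) :
  0 <= x <= 1 -> continuous f x -> continuous g x ->
  (forall y, 0 < y < 1 -> f y = g y) -> f x = g x.
Proof.
  intros Hx Hf Hg H.
  apply cond_eq. intros eps He.
  pose proof (continuous_Rminus f g x Hf Hg) as Hc.
  destruct (continuous_Reps' _ _ Hc eps He) as [d Hd].
  set (k := Rmin d (/ 2) / 2).
  assert (Hk : 0 < k /\ k < d /\ k < / 2).
  { pose proof (cond_pos d). unfold k, Rmin. destruct (Rle_dec _ _); lra. }
  set (y := if Rle_dec x (/ 2) then x + k else x - k).
  assert (Hy : 0 < y < 1) by (unfold y; destruct (Rle_dec x (/ 2)); lra).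
  assert (Hyx : Rabs (y - x) < d).
  { unfold y. destruct (Rle_dec x (/ 2)); apply Rabs_def1; lra. }
  specialize (Hd y Hyx). cbv beta in Hd.
  rewrite (H y Hy), Rminus_diag, Rminus_0_l, Rabs_Ropp in Hd. exact Hd.
Qed.

(** On the sides x = 0 and x = 1 no derivative is given: both members are continuous in x, so the
    identity passes there from the interior. *)
Lemma C1s_time_integral (T : R) (f fx ft : R -> R -> R) (x t0 t1 : R) :
  C1s T f fx ft -> 0 <= x <= 1 -> T <= t0 -> t0 <= t1 ->
  f x t1 - f x t0 = RInt (fun s => ft x s) t0 t1.
Proof.
  intros [Hf _ Hft _ Hdt] Hx Ht0 Ht1.
  apply (eq_at_boundary (fun x => f x t1 - f x t0) (fun x => RInt (fun s => ft x s) t0 t1)).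
  - assumption.
  - cts.
  - apply (continuous_RInt_param (fun x s => ft x s)); intros; cts.
  - intros y Hy. apply (FTC_open (fun s => f y s)); auto.
    + intros. now apply cont2_t.
    + intros. now apply cont2_t.
    + intros s Hs. apply Hdt; lra.
Qed.

(** The x-derivative near the point, its continuity and the t-derivative at the point give
    differentiability in the plane, hence the chain rule along a curve. *)
Lemma C1s_chain (T : R) (f fx ft : R -> R -> R) (xi : R -> R) (s l : R) :
  C1s T f fx ft -> 0 < xi s < 1 -> T < s -> is_derive xi s l ->
  is_derive (fun s => f (xi s) s) s (ft (xi s) s + l * fx (xi s) s).
Proof.
  intros [Hf Hfx Hft Hdx Hdt] Hxi Hs Hl.
  assert (Hloc : locally (xi s, s) (fun u : R * R => is_derive (fun z => f z (snd u)) (fst u) (fx (fst u) (snd u)))).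
  { set (d := Rmin (Rmin (xi s) (1 - xi s)) (s - T)).
    assert (Hd : 0 < d /\ d <= xi s /\ d <= 1 - xi s /\ d <= s - T).
    { unfold d, Rmin. repeat destruct (Rle_dec _ _); lra. }
    exists (mkposreal d (proj1 Hd)). intros [y u] [Hy Hu].
    change (Rabs (y - xi s) < d) in Hy. change (Rabs (u - s) < d) in Hu.
    apply Rabs_def2 in Hy. apply Rabs_def2 in Hu. apply Hdx; cbn; lra. }
  pose proof (is_derive_filterdiff f (xi s) s fx (ft (xi s) s) Hloc (Hdt _ _ Hxi Hs) (Hfx (xi s, s))) as HF.
  apply (filterdiff_differentiable_pt_lim f (xi s) s (fx (xi s) s) (ft (xi s) s)) in HF.
  pose proof (derivable_pt_lim_comp_2d f xi (fun u => u) s _ _ l 1 HF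
                (proj1 (is_derive_Reals _ _ _) Hl) (derivable_pt_lim_id s)) as H.
  apply is_derive_Reals in H. eapply is_derive_eq; [exact H|ring].
Qed.

Section Foot.

Context {lam : R -> R -> R} {sg e : R} (Hin : inflow lam sg e).

Let Hl : regular_field lam := in_reg Hin.

Lemma side_range (x : R) : 0 <= sg * (x - e) <= 1 <-> 0 <= x <= 1.
Proof. destruct (in_side Hin) as [[-> ->]|[-> ->]]; lra. Qed.

Lemma side_range_open (x : R) : 0 < sg * (x - e) < 1 <-> 0 < x < 1.
Proof. destruct (in_side Hin) as [[-> ->]|[-> ->]]; lra. Qed.

Lemma inflow_range : 0 <= e <= 1.
Proof. destruct (in_side Hin) as [[-> ->]|[-> ->]]; lra. Qed.

Lemma inflow_nonzero (x t : R) : lam x t <> 0.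
Proof. intros H. pose proof (in_pos Hin x t). rewrite H in *. lra. Qed.

Lemma flow_strict (x t r s : R) :
  s < r -> sg * (flow lam s x t - e) < sg * (flow lam r x t - e).
Proof.
  intros Hsr.
  destruct (MVT_everywhere (fun u => sg * (flow lam u x t - e))
             (fun u => sg * lam (flow lam u x t) u) s r) as [c [_ Hc]].
  - intros u. pose proof (flow_derive Hl x t u). der. ring.
  - cbv beta in Hc. pose proof (in_pos Hin (flow lam c x t) c). nra.
Qed.

Lemma flow_interior (x t a b s : R) :
  a < s < b -> 0 <= flow lam a x t <= 1 -> 0 <= flow lam b x t <= 1 -> 0 < flow lam s x t < 1.
Proof.
  intros Hs Ha Hb. apply side_range in Ha. apply side_range in Hb. apply side_range_open.
  pose proof (flow_strict x t s a ltac:(lra)). pose proof (flow_strict x t b s ltac:(lra)). lra.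
Qed.

Lemma foot_eq (x t s : R) : flow lam s x t = e -> foot lam e x t = s.
Proof.
  intros H. apply (iota_unique (V := R_CompleteNormedModule)); [|exact H].
  intros y Hy. destruct (Rtotal_order y s) as [Hlt|[Heq|Hgt]]; [|exact Heq|].
  - pose proof (flow_strict x t s y Hlt). rewrite H, Hy in *. lra.
  - pose proof (flow_strict x t y s Hgt). rewrite H, Hy in *. lra.
Qed.

(** Below time 0 the speed is at least the constant of [in_past], so the curve followed backward
    gets beyond the inflow end and the intermediate value theorem applies. *)
Lemma foot_exists (x t : R) : 0 <= x <= 1 -> exists s, s <= t /\ flow lam s x t = e.
Proof.
  intros Hx. apply side_range in Hx.
  destruct (in_past Hin) as (c & Hc & Hpast).
  (* [r] lies so far before [m] that the way covered at speed [c] exceeds the distance from [e] at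
     time [m] by 1. *)
  set (m := Rmin 0 t). set (r := m - (Rabs (sg * (flow lam m x t - e)) + 1) / c).
  assert (Hk : 0 < (Rabs (sg * (flow lam m x t - e)) + 1) / c).
  { apply Rdiv_lt_0_compat; [|assumption]. pose proof (Rabs_pos (sg * (flow lam m x t - e))). lra. }
  assert (Hrm : r < m) by (unfold r; lra).
  assert (Hm0 : m <= 0) by apply Rmin_l. assert (Hmt : m <= t) by apply Rmin_r.
  assert (Hr : sg * (flow lam r x t - e) < 0).
  { destruct (MVT_everywhere (fun u => sg * (flow lam u x t - e))
               (fun u => sg * lam (flow lam u x t) u) r m) as [z [Hz Hc']].
    - intros u. pose proof (flow_derive Hl x t u). der. ring.
    - cbv beta in Hc'. rewrite Rmin_left, Rmax_right in Hz by lra.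
      pose proof (Hpast (flow lam z x t) z ltac:(lra)).
      assert (c * (m - r) <= sg * lam (flow lam z x t) z * (m - r)) by (apply Rmult_le_compat_r; lra).
      assert (c * (m - r) = Rabs (sg * (flow lam m x t - e)) + 1) by (unfold r; field; lra).
      pose proof (Rle_abs (sg * (flow lam m x t - e))). lra. }
  destruct (IVT_zero (fun u => sg * (flow lam u x t - e)) r t) as [s [Hs1 Hs2]].
  - intros u. cts. now apply flow_time_cont.
  - lra.
  - cbv beta. rewrite (flow_init Hl x t).
    rewrite Rmin_left, Rmax_right by lra. lra.
  - exists s. split; [lra|]. destruct (in_side Hin) as [[-> ->]|[-> ->]]; lra.
Qed.

Lemma foot_spec (x t : R) : 0 <= x <= 1 -> flow lam (foot lam e x t) x t = e /\ foot lam e x t <= t.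
Proof.
  intros Hx. destruct (foot_exists x t Hx) as (s & Hs & H). rewrite (foot_eq x t s H). auto.
Qed.

Lemma foot_flow (x t s : R) : 0 <= x <= 1 -> foot lam e (flow lam s x t) s = foot lam e x t.
Proof.
  intros Hx. apply foot_eq. rewrite flow_flow by assumption. now apply foot_spec.
Qed.

Lemma foot_inflow (t : R) : foot lam e e t = t.
Proof. apply foot_eq. now apply flow_init. Qed.

Lemma flow_after_foot (x t s : R) :
  0 <= x <= 1 -> foot lam e x t <= s <= t -> 0 <= flow lam s x t <= 1.
Proof.
  intros Hx Hs. destruct (foot_spec x t Hx) as [Hf _].
  assert (H1 : sg * (flow lam (foot lam e x t) x t - e) <= sg * (flow lam s x t - e)).
  { destruct (proj1 Hs) as [H| <-]; [|lra]. now apply Rlt_le, flow_strict. }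
  assert (H2 : sg * (flow lam s x t - e) <= sg * (flow lam t x t - e)).
  { destruct (proj2 Hs) as [H| ->]; [|lra]. now apply Rlt_le, flow_strict. }
  rewrite Hf in H1. rewrite (flow_init Hl x t) in H2. apply side_range in Hx. apply side_range. lra.
Qed.

Lemma flow_before_foot (x t s : R) :
  0 <= x <= 1 -> s < foot lam e x t -> ~ 0 <= flow lam s x t <= 1.
Proof.
  intros Hx Hs H. destruct (foot_spec x t Hx) as [Hf _].
  pose proof (flow_strict x t _ _ Hs) as Hlt. rewrite Hf in Hlt. apply side_range in H. lra.
Qed.

(** Monotone form of the implicit function theorem: at times s0 - eps and s0 + eps the base curve is
    strictly on opposite sides of [e], which persists for nearby curves and traps their crossing
    time. *)
Lemma foot_cont {U : UniformSpace} (a c : U -> R) (p : U) :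
  (forall q, 0 <= a q <= 1) -> continuous a p -> continuous c p ->
  continuous (fun q => foot lam e (a q) (c q)) p.
Proof.
  intros Hr Ha Hc. apply continuous_Reps. intros eps He.
  set (s0 := foot lam e (a p) (c p)).
  assert (Hcont : forall s, continuous (fun q => sg * (flow lam s (a q) (c q) - e)) p).
  { intros s. cts. apply flow_cont; auto; cts. }
  destruct (foot_spec (a p) (c p) (Hr p)) as [Hf _]. fold s0 in Hf.
  pose proof (flow_strict (a p) (c p) s0 (s0 - eps) ltac:(lra)) as H1.
  pose proof (flow_strict (a p) (c p) (s0 + eps) s0 ltac:(lra)) as H2.
  rewrite Hf in H1, H2.
  assert (H1' : 0 < - (sg * (flow lam (s0 - eps) (a p) (c p) - e))) by lra.
  assert (H2' : 0 < sg * (flow lam (s0 + eps) (a p) (c p) - e)) by lra.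
  generalize (filter_and _ _ (continuous_Reps' _ _ (Hcont (s0 - eps)) _ H1')
                (continuous_Reps' _ _ (Hcont (s0 + eps)) _ H2')).
  apply filter_imp. intros q [H3 H4]. apply Rabs_def2 in H3. apply Rabs_def2 in H4.
  destruct (foot_spec (a q) (c q) (Hr q)) as [Hfq _]. set (sq := foot lam e (a q) (c q)) in *.
  apply Rabs_def1.
  - apply Rnot_le_lt. intros Hle.
    assert (sg * (flow lam (s0 + eps) (a q) (c q) - e) <= sg * (flow lam sq (a q) (c q) - e)).
    { destruct (Rle_lt_or_eq_dec (s0 + eps) sq ltac:(lra)) as [H| ->]; [|lra].
      now apply Rlt_le, flow_strict. }
    rewrite Hfq in *. lra.
  - apply Rnot_le_lt. intros Hle.
    assert (sg * (flow lam sq (a q) (c q) - e) <= sg * (flow lam (s0 - eps) (a q) (c q) - e)).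
    { destruct (Rle_lt_or_eq_dec sq (s0 - eps) ltac:(lra)) as [H| ->]; [|lra].
      now apply Rlt_le, flow_strict. }
    rewrite Hfq in *. lra.
Qed.

(** Curves cannot cross: a change of order would produce, by the intermediate value theorem, a time
    at which they coincide. *)
Lemma flow_order (x y r s : R) :
  0 < sg * (y - x) -> 0 < sg * (flow lam r y s - flow lam r x s).
Proof.
  intros H. apply Rnot_le_lt. intros Hle.
  assert (H0 : exists u, sg * (flow lam u y s - flow lam u x s) = 0).
  { assert (Hc : forall u, continuous (fun u => sg * (flow lam u y s - flow lam u x s)) u).
    { intros u. cts; now apply flow_time_cont. }
    destruct (Rle_dec r s) as [Hrs|Hrs].
    - destruct (IVT_zero _ r s Hc Hrs) as [u [_ Hu]]; [|now exists u].
      cbv beta. rewrite !(flow_init Hl _ s), Rmin_left, Rmax_right by lra. lra.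
    - destruct (IVT_zero _ s r Hc ltac:(lra)) as [u [_ Hu]]; [|now exists u].
      cbv beta. rewrite !(flow_init Hl _ s), Rmin_right, Rmax_left by lra. lra. }
  destruct H0 as [u Hu].
  assert (flow lam u y s = flow lam u x s).
  { destruct (in_side Hin) as [[-> ->]|[-> ->]]; lra. }
  assert (y = x) by (eapply flow_injective; eauto). subst y. rewrite Rminus_diag in H. lra.
Qed.

(** Comparison with the curve that enters at time T and has crossed the strip by [T1]: a curve that
    entered before T runs strictly ahead of it, so it is outside the strip at every time from [T1]
    on. *)
Lemma foot_large (T : R) : 0 <= T ->
  exists T1, T <= T1 /\ forall x t, 0 <= x <= 1 -> T1 <= t -> T <= foot lam e x t.
Proof.
  intros HT. destruct (in_exit Hin T HT) as (T1 & HT1 & Hex).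
  exists T1. split; [assumption|]. intros x t Hx Ht.
  apply Rnot_lt_le. intros Hlt.
  destruct (foot_spec x t Hx) as [Hf _].
  pose proof (flow_strict x t _ _ Hlt) as H1. rewrite Hf, Rminus_diag, Rmult_0_r in H1.
  pose proof (flow_order e (flow lam T x t) t T H1) as H2.
  rewrite flow_flow, (flow_init Hl x t) in H2 by assumption.
  assert (H3 : sg * (flow lam T1 e T - e) <= sg * (flow lam t e T - e)).
  { destruct Ht as [Ht| ->]; [|lra]. now apply Rlt_le, flow_strict. }
  apply side_range in Hx. lra.
Qed.

(** Differential form of [Broad] along one curve; with its converse [broad_of_derive] it reduces the
    rules for products and exponentials to those of one real variable. *)
Lemma broad_derive (T : R) (v f : R -> R -> R) :
  cont2 f -> Broad lam T v f ->
  forall x t a b s, T <= a -> (forall s, a <= s <= b -> 0 <= flow lam s x t <= 1) -> a < s < b ->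
  is_derive (fun s => v (flow lam s x t) s) s (f (flow lam s x t) s).
Proof.
  intros Hf HB x t a b s Ha Hseg Hs.
  assert (Hfc : forall s, continuous (fun s => f (flow lam s x t) s) s).
  { intros u. apply (cont2_comp f); auto; [now apply flow_time_cont|cts]. }
  apply (is_derive_ext_loc (fun s => v (flow lam a x t) a + RInt (fun s => f (flow lam s x t) s) a s)).
  - assert (Hd : 0 < Rmin (s - a) (b - s)) by (apply Rmin_pos; lra).
    exists (mkposreal _ Hd). intros u Hu. change (Rabs (u - s) < Rmin (s - a) (b - s)) in Hu.
    pose proof (Rmin_l (s - a) (b - s)). pose proof (Rmin_r (s - a) (b - s)). apply Rabs_def2 in Hu.
    enough (H1 : v (flow lam a x t) a + RInt (fun s => f (flow lam s x t) s) a u = v (flow lam u x t) u) by exact H1.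
    rewrite <- (HB x t a u); [ring|assumption|lra|]. intros w Hw. apply Hseg; lra.
  - der; [now apply (is_derive_RInt_upper (fun s => f (flow lam s x t) s))|ring].
Qed.

Lemma broad_of_derive (T : R) (v f : R -> R -> R) :
  cont2 v -> cont2 f ->
  (forall x t a b s, T <= a -> (forall s, a <= s <= b -> 0 <= flow lam s x t <= 1) -> a < s < b ->
    is_derive (fun s => v (flow lam s x t) s) s (f (flow lam s x t) s)) ->
  Broad lam T v f.
Proof.
  intros Hv Hf H x t a b Ha Hab Hseg.
  apply (FTC_open (fun s => v (flow lam s x t) s)); auto.
  - intros s _. apply (cont2_comp v); auto; [now apply flow_time_cont|cts].
  - intros u. apply (cont2_comp f); auto; [now apply flow_time_cont|cts].
  - intros s Hs. now apply (H x t a b).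
Qed.

Lemma broad_C1s (T : R) (v vx vt : R -> R -> R) :
  C1s T v vx vt -> Broad lam T v (fun x t => vt x t + lam x t * vx x t).
Proof.
  intros HC. pose proof (rf_cont Hl) as Hlc. destruct (HC) as [Hv Hvx Hvt _ _].
  apply broad_of_derive; [assumption|intros p; cts|].
  intros x t a b s Ha Hseg Hs.
  apply (C1s_chain T v vx vt (fun s => flow lam s x t) s); auto.
  - apply (flow_interior x t a b); auto; apply Hseg; lra.
  - lra.
  - now apply flow_derive.
Qed.

(** Between two times at which it is in the closed strip a curve is strictly inside, because its
    distance to the inflow side increases; so right-hand sides matter only in the open strip. *)
Lemma broad_ext (T : R) (v f v' f' : R -> R -> R) :
  (forall x t, 0 <= x <= 1 -> T <= t -> v x t = v' x t) ->
  (forall x t, 0 < x < 1 -> T < t -> f x t = f' x t) ->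
  Broad lam T v f -> Broad lam T v' f'.
Proof.
  intros Hv Hf HB x t a b Ha Hab Hseg.
  rewrite <- !Hv; try (apply Hseg; lra); try lra.
  rewrite (HB x t a b) by assumption.
  apply RInt_Rext; [assumption|]. intros s Hs. apply Hf; [|lra].
  apply (flow_interior x t a b); auto; apply Hseg; lra.
Qed.

Lemma broad_later (T T' : R) (v f : R -> R -> R) : T <= T' -> Broad lam T v f -> Broad lam T' v f.
Proof. intros HT HB x t a b Ha. apply HB. lra. Qed.

Lemma broad_plus (T : R) (v f v' f' : R -> R -> R) :
  cont2 f -> cont2 f' -> Broad lam T v f -> Broad lam T v' f' ->
  Broad lam T (fun x t => v x t + v' x t) (fun x t => f x t + f' x t).
Proof.
  intros Hf Hf' HB HB' x t a b Ha Hab Hseg.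
  assert (Hc : forall h, cont2 h -> forall s, continuous (fun s => h (flow lam s x t) s) s).
  { intros h Hh s. apply (cont2_comp h); auto; [now apply flow_time_cont|cts]. }
  rewrite RInt_Rplus by auto. rewrite <- HB, <- HB' by assumption. ring.
Qed.

Lemma broad_mult (T : R) (v f v' f' : R -> R -> R) :
  cont2 v -> cont2 v' -> cont2 f -> cont2 f' -> Broad lam T v f -> Broad lam T v' f' ->
  Broad lam T (fun x t => v x t * v' x t) (fun x t => f x t * v' x t + v x t * f' x t).
Proof.
  intros Hv Hv' Hf Hf' HB HB'.
  apply broad_of_derive; [intros p; cts|intros p; cts|].
  intros x t a b s Ha Hseg Hs.
  apply (is_derive_Rmult (fun s => v (flow lam s x t) s) (fun s => v' (flow lam s x t) s)).
  - now apply (broad_derive T v f Hf HB x t a b).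
  - now apply (broad_derive T v' f' Hf' HB' x t a b).
Qed.

Lemma broad_exp (T : R) (v f : R -> R -> R) :
  cont2 v -> cont2 f -> Broad lam T v f ->
  Broad lam T (fun x t => exp (v x t)) (fun x t => f x t * exp (v x t)).
Proof.
  intros Hv Hf HB.
  apply broad_of_derive; [intros p; cts|intros p; cts|].
  intros x t a b s Ha Hseg Hs.
  apply (is_derive_Rexp (fun s => v (flow lam s x t) s)).
  now apply (broad_derive T v f Hf HB x t a b).
Qed.

(** Method of characteristics. Curves are followed back to the inflow side, through negative times
    if necessary, so boundary values on the whole time axis replace initial values; clamping x makes
    the formula continuous on the plane. *)
Lemma transport_solution (f : R -> R -> R) (b : R -> R) :
  cont2 f -> (forall t, continuous b t) ->
  exists v, cont2 v /\ (forall t, v e t = b t) /\ forall T, Broad lam T v f.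
Proof.
  intros Hf Hb.
  set (S x t := foot lam e (clamp x) t).
  assert (HS : cont2 S).
  { intros p. apply (foot_cont (fun q : R * R => clamp (fst q)) snd).
    - intros q. apply clamp_bounds.
    - apply clamp_cont. cts.
    - cts. }
  assert (Hfl : forall p : (R * R) * R, continuous (fun q : (R * R) * R =>
             f (flow lam (snd q) (clamp (fst (fst q))) (snd (fst q))) (snd q)) p).
  { intros p. cts. apply flow_cont; [assumption|cts|apply clamp_cont; cts|cts]. }
  exists (fun x t => b (S x t) + RInt (fun s => f (flow lam s (clamp x) t) s) (S x t) t).
  split; [|split].
  - intros p. apply continuous_Rplus.
    + apply (continuous_comp (fun q : R * R => S (fst q) (snd q)) b); [cts|apply Hb].
    + apply (cont2_RInt (fun x t s => f (flow lam s (clamp x) t) s) S (fun _ t => t)); auto.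
      intros q. cts.
  - intros t. unfold S. rewrite (clamp_id e inflow_range), foot_inflow, RInt_Rpoint. ring.
  - intros T x t a c Ha Hac Hseg.
    set (F s := f (flow lam s x t) s).
    assert (HF : forall s, continuous F s).
    { intros s. apply (cont2_comp f); auto; [now apply flow_time_cont|cts]. }
    assert (Hfoot : foot lam e (flow lam c x t) c = foot lam e (flow lam a x t) a).
    { rewrite <- (foot_flow (flow lam a x t) a c) by (apply Hseg; lra). now rewrite flow_flow. }
    unfold S. rewrite !clamp_id by (apply Hseg; lra). rewrite Hfoot.
    set (s0 := foot lam e (flow lam a x t) a).
    assert (Heq : forall r, RInt (fun s => f (flow lam s (flow lam r x t) r) s) s0 r = RInt F s0 r).
    { intros r. apply RInt_ext. intros s _. unfold F. now rewrite flow_flow. }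
    rewrite !Heq. pose proof (RInt_Rchasles F s0 a c HF). fold F. lra.
Qed.

(** Integrating factor exp([th]), with [th] transported by - [beta] and zero on the inflow side, so
    that boundary values are unchanged. *)
Lemma linear_transport_solution (beta f : R -> R -> R) (b : R -> R) :
  cont2 beta -> cont2 f -> (forall t, continuous b t) ->
  exists v, cont2 v /\ (forall t, v e t = b t) /\
    forall T, Broad lam T v (fun x t => - (beta x t * v x t) + f x t).
Proof.
  intros Hbeta Hf Hb.
  destruct (transport_solution (fun x t => - beta x t) (fun _ => 0)) as (th & Hth & Hth0 & HBth).
  { intros p. cts. } { intros; cts. }
  destruct (transport_solution (fun x t => f x t * exp (- th x t)) b) as (w & Hw & Hw0 & HBw); [intros p; cts|assumption|].
  exists (fun x t => w x t * exp (th x t)). split; [|split].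
  - intros p. cts.
  - intros t. rewrite Hw0, Hth0, exp_0. ring.
  - intros T.
    assert (Hnb : cont2 (fun x t => - beta x t)) by (intros p; cts).
    assert (Hw' : cont2 (fun x t => f x t * exp (- th x t))) by (intros p; cts).
    assert (He : cont2 (fun x t => exp (th x t))) by (intros p; cts).
    assert (He' : cont2 (fun x t => - beta x t * exp (th x t))) by (intros p; cts).
    apply (broad_ext T _ _ _ _ (fun _ _ _ _ => eq_refl)) with
      (2 := broad_mult T w _ _ _ Hw He Hw' He' (HBw T) (broad_exp T th _ Hth Hnb (HBth T))).
    intros x t _ _. cbv beta. rewrite exp_Ropp. field. apply Rgt_not_eq, exp_pos.
Qed.

End Foot.

(** The x-derivative [p] is constructed first: differentiating D V = f in x gives D p = - mu p + fx,
    which is solved by characteristics. [V] is then an antiderivative of [p] in x, corrected by a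
    function of t alone. *)
Lemma transport_C1 {lam mu : R -> R -> R} {sg e : R} (Hin : inflow lam sg e) (T : R)
    (f fx : R -> R -> R) (b b' : R -> R) :
  Cx T lam mu -> Cx T f fx ->
  (forall t, continuous b t) -> (forall t, continuous b' t) ->
  (forall t, T < t -> is_derive b t (b' t)) ->
  exists V Vx Vt, C1s T V Vx Vt /\ Broad lam T V f /\ forall t, T <= t -> V e t = b t.
Proof.
  intros [Hlc Hmu Hd] [Hf Hfx Hfd] Hb Hb' Hbd.
  pose proof (in_reg Hin) as Hl.
  pose proof (inflow_nonzero Hin) as Hnz.
  pose proof (inflow_range Hin) as He.
  (* On the inflow side V_t has to be b', so the equation V_t + lam V_x = f dictates the boundary
     value of [p]. *)
  destruct (linear_transport_solution Hin mu fx (fun t => (f e t - b' t) / lam e t) Hmu Hfx)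
    as (p & Hp & Hp0 & HBp).
  { intros t. specialize (Hb' t). cts. apply Hnz. }
  set (q x t := - (mu x t * p x t) + fx x t).
  assert (Hq : cont2 q) by (intros z; unfold q; cts).
  pose proof (potential_C1s Hl Hmu T Hd p q Hp Hq (HBp T)) as [HP _ HPt HPdx HPdt].
  (* The time derivative of [potential p] is f - lam p + c(t), where [c] stems from the base point.
     Subtracting the integral of [c] restores the equation, and the last constant in [V] fixes V = b
     at (e, T). *)
  set (c t := lam (/ 2) t * p (/ 2) t - f (/ 2) t).
  assert (Hc : forall t, continuous c t) by (intros t; unfold c; cts).
  set (V x t := potential p x t - RInt c T t + (b T - potential p e T)).
  assert (HV : C1s T V p (fun x t => - (lam x t * p x t) + f x t)).
  { split.
    - intros z. unfold V. cts.
      apply (continuous_comp (fun q : R * R => snd q) (fun t => RInt c T t)); [cts|].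
      now apply continuous_RInt_upper.
    - assumption.
    - intros z. cts.
    - intros x t Hx Ht. unfold V. pose proof (HPdx x t Hx Ht). der. ring.
    - intros x t Hx Ht. unfold V.
      pose proof (HPdt x t Hx Ht). pose proof (is_derive_RInt_upper c T t Hc).
      der. unfold potential_rest, c.
      assert (Hint : RInt (fun y => q y t + mu y t * p y t) (/ 2) x = f x t - f (/ 2) t).
      { rewrite (RInt_Req _ (fun y => fx y t)) by (intros y; unfold q; ring).
        apply (is_RInt_unique (V := R_CompleteNormedModule)).
        apply (is_RInt_derive (V := R_CompleteNormedModule) (fun y => f y t)).
        - intros y Hy. apply Hfd; [|assumption]. revert Hy. unfold Rmin, Rmax. destruct (Rle_dec _ _); lra.
        - intros y _. now apply cont2_x. }
      rewrite Hint. ring. }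
  exists V, p, (fun x t => - (lam x t * p x t) + f x t). split; [assumption|split].
  - eapply (broad_ext Hin); [reflexivity| |apply (broad_C1s Hin T _ _ _ HV)].
    intros x t _ _. cbv beta. ring.
  - assert (HVT : V e T = b T) by (unfold V; rewrite RInt_Rpoint; ring).
    intros t Ht.
    pose proof (C1s_time_integral T _ _ _ e T t HV He (Rle_refl T) Ht) as HI. cbv beta in HI.
    assert (Hbi : b t - b T = RInt b' T t).
    { apply FTC_open; auto. intros s Hs. apply Hbd; lra. }
    assert (Heq : RInt (fun s => - (lam e s * p e s) + f e s) T t = RInt b' T t).
    { apply RInt_Req. intros s. rewrite Hp0. field. apply Hnz. }
    lra.
Qed.

(** The given function and the one from [transport_C1] have the same transport right-hand side and
    agree on the inflow side; from [T1] on every foot lies at time T or later, so integrating from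
    the foot identifies them. *)
Lemma transport_regularity {lam mu : R -> R -> R} {sg e : R} (Hin : inflow lam sg e) (T T1 : R)
    (v f fx : R -> R -> R) (b b' : R -> R) :
  Cx T lam mu -> Cx T f fx ->
  (forall t, continuous b t) -> (forall t, continuous b' t) ->
  (forall t, T < t -> is_derive b t (b' t)) ->
  Broad lam T v f -> (forall t, T <= t -> v e t = b t) ->
  T <= T1 -> (forall x t, 0 <= x <= 1 -> T1 <= t -> T <= foot lam e x t) ->
  exists V Vx Vt, C1s T1 V Vx Vt /\ forall x t, 0 <= x <= 1 -> T1 <= t -> v x t = V x t.
Proof.
  intros Hlam Hf Hb Hb' Hbd HB Hve HT1 Hfoot.
  destruct (transport_C1 Hin T f fx b b' Hlam Hf Hb Hb' Hbd) as (V & Vx & Vt & HV & HBV & HVe).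
  exists V, Vx, Vt. split.
  - destruct HV as [H1 H2 H3 H4 H5]. split; auto; intros; [apply H4|apply H5]; auto; lra.
  - intros x t Hx Ht. pose proof (Hfoot x t Hx Ht) as Hs.
    destruct (foot_spec Hin x t Hx) as [Hfx Hft].
    pose proof (fun s => flow_after_foot Hin x t s Hx) as Hseg.
    pose proof (HB x t _ t Hs Hft Hseg) as H1.
    pose proof (HBV x t _ t Hs Hft Hseg) as H2.
    rewrite Hfx, (flow_init (in_reg Hin) x t) in H1, H2.
    rewrite (Hve _ Hs) in H1. rewrite (HVe _ Hs) in H2. lra.
Qed.

(** * One derivative for the system *)

Definition sum1 (n : nat) (f : nat -> R) : R := sum_n_m f 1 n.

Lemma sum1_0 (f : nat -> R) : sum1 0 f = 0.
Proof. apply (sum_n_m_zero (G := R_AbelianGroup)). lia. Qed.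

Lemma sum1_S (n : nat) (f : nat -> R) : sum1 (S n) f = sum1 n f + f (S n).
Proof. apply (sum_n_Sm (G := R_AbelianGroup)). lia. Qed.

Lemma sum1_ext (n : nat) (f f' : nat -> R) :
  (forall j, (1 <= j <= n)%nat -> f j = f' j) -> sum1 n f = sum1 n f'.
Proof.
  intros H. induction n as [|n IH]; [now rewrite !sum1_0|].
  rewrite !sum1_S, IH, H; auto; [lia|]. intros j Hj. apply H. lia.
Qed.

Lemma sum1_split (n i : nat) (f : nat -> R) : (1 <= i <= n)%nat ->
  sum1 n f = f i + sum1 n (fun j => if Nat.eqb j i then 0 else f j).
Proof.
  induction n as [|n IH]; intros Hi; [lia|].
  rewrite !sum1_S. destruct (Nat.eqb_spec (S n) i) as [<-|Hne].
  - rewrite (sum1_ext n (fun j => if Nat.eqb j (S n) then 0 else f j) f); [ring|].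
    intros j Hj. destruct (Nat.eqb_spec j (S n)); [lia|reflexivity].
  - rewrite IH by lia. ring.
Qed.

Lemma sum1_plus (n : nat) (f f' : nat -> R) :
  sum1 n (fun j => f j + f' j) = sum1 n f + sum1 n f'.
Proof.
  induction n as [|n IH]; [rewrite !sum1_0; ring|]. rewrite !sum1_S, IH. ring.
Qed.

Lemma continuous_sum1 {U : UniformSpace} (n : nat) (f : nat -> U -> R) (p : U) :
  (forall j, (1 <= j <= n)%nat -> continuous (f j) p) ->
  continuous (fun q => sum1 n (fun j => f j q)) p.
Proof.
  intros H. induction n as [|n IH].
  - apply (continuous_ext (fun _ => 0)); [intros; now rewrite sum1_0|cts].
  - apply (continuous_ext (fun q => sum1 n (fun j => f j q) + f (S n) q)).
    + intros q. now rewrite sum1_S.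
    + apply continuous_Rplus; [apply IH|apply H; lia]. intros j Hj. apply H. lia.
Qed.

Lemma is_derive_sum1 (n : nat) (f : nat -> R -> R) (df : nat -> R) (x : R) :
  (forall j, (1 <= j <= n)%nat -> is_derive (f j) x (df j)) ->
  is_derive (fun y => sum1 n (fun j => f j y)) x (sum1 n df).
Proof.
  intros H. induction n as [|n IH].
  - rewrite sum1_0. apply (is_derive_ext (fun _ => 0)); [intros; now rewrite sum1_0|].
    apply is_derive_Rconst.
  - rewrite sum1_S. apply (is_derive_ext (fun y => sum1 n (fun j => f j y) + f (S n) y)).
    + intros y. now rewrite sum1_S.
    + apply is_derive_Rplus; [apply IH|apply H; lia]. intros j Hj. apply H. lia.
Qed.

Lemma uniform_time (n : nat) (T : R) (P : nat -> R -> Prop) :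
  (forall i T1 T2, P i T1 -> T1 <= T2 -> P i T2) ->
  (forall i, (1 <= i <= n)%nat -> exists T1, T <= T1 /\ P i T1) ->
  exists T1, T <= T1 /\ forall i, (1 <= i <= n)%nat -> P i T1.
Proof.
  intros Hmono. induction n as [|n IH]; intros H.
  - exists T. split; [lra|]. intros i Hi. lia.
  - destruct IH as (T1 & HT1 & H1); [intros i Hi; apply H; lia|].
    destruct (H (S n)) as (T2 & HT2 & H2); [lia|].
    exists (Rmax T1 T2). split; [pose proof (Rmax_l T1 T2); lra|].
    intros i Hi. destruct (Nat.eq_dec i (S n)) as [->|Hne].
    + apply (Hmono _ T2); [assumption|apply Rmax_r].
    + apply (Hmono _ T1); [apply H1; lia|apply Rmax_l].
Qed.

(** * Calculus of differentiable functions on the open half strip *)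

Lemma C1s_later (T T' : R) (f fx ft : R -> R -> R) : T <= T' -> C1s T f fx ft -> C1s T' f fx ft.
Proof. intros HT [H1 H2 H3 H4 H5]. split; auto; intros; [apply H4|apply H5]; auto; lra. Qed.

Lemma C1s_Cx (T : R) (f fx ft : R -> R -> R) : C1s T f fx ft -> Cx T f fx.
Proof. intros [H1 H2 H3 H4 H5]. split; auto. Qed.

Lemma C1s_const (T c : R) : C1s T (fun _ _ => c) (fun _ _ => 0) (fun _ _ => 0).
Proof. split; try solve [intros p; cts]; intros; apply is_derive_Rconst. Qed.

Lemma C1s_plus (T : R) (f fx ft g gx gt : R -> R -> R) :
  C1s T f fx ft -> C1s T g gx gt ->
  C1s T (fun x t => f x t + g x t) (fun x t => fx x t + gx x t) (fun x t => ft x t + gt x t).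
Proof.
  intros [? ? ? Hfx Hft] [? ? ? Hgx Hgt].
  split; try solve [intros p; cts]; intros x t Hx Ht; apply is_derive_Rplus; auto.
Qed.

Lemma C1s_minus (T : R) (f fx ft g gx gt : R -> R -> R) :
  C1s T f fx ft -> C1s T g gx gt ->
  C1s T (fun x t => f x t - g x t) (fun x t => fx x t - gx x t) (fun x t => ft x t - gt x t).
Proof.
  intros [? ? ? Hfx Hft] [? ? ? Hgx Hgt].
  split; try solve [intros p; cts]; intros x t Hx Ht; apply is_derive_Rminus; auto.
Qed.

Lemma C1s_opp (T : R) (f fx ft : R -> R -> R) :
  C1s T f fx ft -> C1s T (fun x t => - f x t) (fun x t => - fx x t) (fun x t => - ft x t).
Proof.
  intros [? ? ? Hfx Hft].
  split; try solve [intros p; cts]; intros x t Hx Ht; apply is_derive_Ropp; auto.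
Qed.

Lemma C1s_mult (T : R) (f fx ft g gx gt : R -> R -> R) :
  C1s T f fx ft -> C1s T g gx gt ->
  C1s T (fun x t => f x t * g x t) (fun x t => fx x t * g x t + f x t * gx x t)
    (fun x t => ft x t * g x t + f x t * gt x t).
Proof.
  intros [? ? ? Hfx Hft] [? ? ? Hgx Hgt].
  split; try solve [intros p; cts]; intros x t Hx Ht.
  - apply (is_derive_Rmult (fun y => f y t) (fun y => g y t)); auto.
  - apply (is_derive_Rmult (fun s => f x s) (fun s => g x s)); auto.
Qed.

Lemma C1s_div (T : R) (f fx ft g gx gt : R -> R -> R) :
  C1s T f fx ft -> C1s T g gx gt -> (forall x t, g x t <> 0) ->
  C1s T (fun x t => f x t / g x t)
    (fun x t => (fx x t * g x t - f x t * gx x t) / (g x t * g x t))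
    (fun x t => (ft x t * g x t - f x t * gt x t) / (g x t * g x t)).
Proof.
  intros [? ? ? Hfx Hft] [? ? ? Hgx Hgt] H0.
  assert (H00 : forall x t, g x t * g x t <> 0) by (intros; apply Rmult_integral_contrapositive; auto).
  split; try solve [intros p; cts; auto]; intros x t Hx Ht.
  - apply (is_derive_Rdiv (fun y => f y t) (fun y => g y t)); auto.
  - apply (is_derive_Rdiv (fun s => f x s) (fun s => g x s)); auto.
Qed.

Lemma C1s_exp (T : R) (f fx ft : R -> R -> R) :
  C1s T f fx ft ->
  C1s T (fun x t => exp (f x t)) (fun x t => fx x t * exp (f x t)) (fun x t => ft x t * exp (f x t)).
Proof.
  intros [? ? ? Hfx Hft].
  split; try solve [intros p; cts]; intros x t Hx Ht.
  - apply (is_derive_Rexp (fun y => f y t)); auto.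
  - apply (is_derive_Rexp (fun s => f x s)); auto.
Qed.

Lemma C1s_sum1 (T : R) (n : nat) (f fx ft : nat -> R -> R -> R) :
  (forall j, (1 <= j <= n)%nat -> C1s T (f j) (fx j) (ft j)) ->
  C1s T (fun x t => sum1 n (fun j => f j x t)) (fun x t => sum1 n (fun j => fx j x t))
    (fun x t => sum1 n (fun j => ft j x t)).
Proof.
  intros H. split.
  - intros p. apply (continuous_sum1 n (fun j q => f j (fst q) (snd q))).
    intros j Hj. apply (c1_f (H j Hj)).
  - intros p. apply (continuous_sum1 n (fun j q => fx j (fst q) (snd q))).
    intros j Hj. apply (c1_fx (H j Hj)).
  - intros p. apply (continuous_sum1 n (fun j q => ft j (fst q) (snd q))).
    intros j Hj. apply (c1_ft (H j Hj)).
  - intros x t Hx Ht. apply (is_derive_sum1 n (fun j y => f j y t)).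
    intros j Hj. now apply (c1_dx (H j Hj)).
  - intros x t Hx Ht. apply (is_derive_sum1 n (fun j s => f j x s)).
    intros j Hj. now apply (c1_dt (H j Hj)).
Qed.

Lemma Cx_plus (T : R) (f fx g gx : R -> R -> R) :
  Cx T f fx -> Cx T g gx -> Cx T (fun x t => f x t + g x t) (fun x t => fx x t + gx x t).
Proof.
  intros [? ? Hfx] [? ? Hgx].
  split; try solve [intros p; cts]; intros x t Hx Ht; apply is_derive_Rplus; auto.
Qed.

Lemma Cx_mult (T : R) (f fx g gx : R -> R -> R) :
  Cx T f fx -> Cx T g gx ->
  Cx T (fun x t => f x t * g x t) (fun x t => fx x t * g x t + f x t * gx x t).
Proof.
  intros [? ? Hfx] [? ? Hgx].
  split; try solve [intros p; cts]; intros x t Hx Ht.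
  apply (is_derive_Rmult (fun y => f y t) (fun y => g y t)); auto.
Qed.

(** The integral formula in time holds on the closed strip, and differentiating it gives a time
    derivative on the sides too, where boundary identities are to be differentiated. *)
Lemma C1s_boundary_derive (T : R) (f fx ft : R -> R -> R) (x t : R) :
  C1s T f fx ft -> 0 <= x <= 1 -> T < t -> is_derive (fun s => f x s) t (ft x t).
Proof.
  intros HC Hx Ht. pose proof (c1_ft HC) as Hft.
  apply (is_derive_ext_loc (fun s => f x T + RInt (fun s => ft x s) T s)).
  - assert (Hd : 0 < t - T) by lra.
    exists (mkposreal _ Hd). intros s Hs. change (Rabs (s - t) < t - T) in Hs. apply Rabs_def2 in Hs.
    pose proof (C1s_time_integral T f fx ft x T s HC Hx ltac:(lra) ltac:(lra)) as H.
    enough (H1 : f x T + RInt (fun s => ft x s) T s = f x s) by exact H1. lra.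
  - der; [apply (is_derive_RInt_upper (fun s => ft x s)); intros; cts|ring].
Qed.

(** * The coupled system and its potentials *)

Definition forcing (n : nat) (a : nat -> nat -> R -> R -> R) (g u : nat -> R -> R -> R)
    (i : nat) (x t : R) : R :=
  g i x t - sum1 n (fun j => a i j x t * u j x t).

(** Only one derivative of coefficients and boundary data is recorded, since each order of
    smoothness builds new instances; [u] enters merely as a continuous solution in the integrated
    sense. *)
Record system (n : nat) (T : R) (lam lamx lamt : nat -> R -> R -> R) (sg e : nat -> R)
    (a ax at' : nat -> nat -> R -> R -> R) (g gx gt u : nat -> R -> R -> R)
    (b b' : nat -> R -> R) : Prop := {
  sy_T : 0 <= T;
  sy_in : forall i, (1 <= i <= n)%nat -> inflow (lam i) (sg i) (e i);
  sy_lam : forall i, (1 <= i <= n)%nat -> C1s T (lam i) (lamx i) (lamt i);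
  sy_ne : forall i j, (1 <= i <= n)%nat -> (1 <= j <= n)%nat -> i <> j ->
            forall x t, lam i x t <> lam j x t;
  sy_a : forall i j, (1 <= i <= n)%nat -> (1 <= j <= n)%nat -> C1s T (a i j) (ax i j) (at' i j);
  sy_g : forall i, (1 <= i <= n)%nat -> C1s T (g i) (gx i) (gt i);
  sy_u : forall i, (1 <= i <= n)%nat -> cont2 (u i);
  sy_broad : forall i, (1 <= i <= n)%nat -> Broad (lam i) T (u i) (forcing n a g u i);
  sy_b : forall i, (1 <= i <= n)%nat -> forall t, continuous (b i) t;
  sy_b' : forall i, (1 <= i <= n)%nat -> forall t, continuous (b' i) t;
  sy_db : forall i, (1 <= i <= n)%nat -> forall t, T < t -> is_derive (b i) t (b' i t);
  sy_bc : forall i, (1 <= i <= n)%nat -> forall t, T <= t -> u i (e i) t = b i t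
}.
Arguments sy_in {n T lam lamx lamt sg e a ax at' g gx gt u b b'} _.
Arguments sy_lam {n T lam lamx lamt sg e a ax at' g gx gt u b b'} _.
Arguments sy_a {n T lam lamx lamt sg e a ax at' g gx gt u b b'} _.
Arguments sy_g {n T lam lamx lamt sg e a ax at' g gx gt u b b'} _.
Arguments sy_u {n T lam lamx lamt sg e a ax at' g gx gt u b b'} _.
Arguments sy_broad {n T lam lamx lamt sg e a ax at' g gx gt u b b'} _.

Section System.

Context {n : nat} {T : R} {lam lamx lamt : nat -> R -> R -> R} {sg e : nat -> R}
  {a ax at' : nat -> nat -> R -> R -> R} {g gx gt u : nat -> R -> R -> R} {b b' : nat -> R -> R}
  (HS : system n T lam lamx lamt sg e a ax at' g gx gt u b b').

Lemma forcing_cont (i : nat) : (1 <= i <= n)%nat -> cont2 (forcing n a g u i).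
Proof.
  intros Hi p. unfold forcing. apply continuous_Rminus.
  - apply (c1_f (sy_g HS i Hi)).
  - apply (continuous_sum1 n (fun j q => a i j (fst q) (snd q) * u j (fst q) (snd q))).
    intros j Hj. apply continuous_Rmult.
    + apply (c1_f (sy_a HS i j Hi Hj)).
    + apply (sy_u HS j Hj).
Qed.

(* With [G = a_ij / (lam_i - lam_j)], the x-antiderivative of [G u_j] is C^1, and its
   derivative along the i-th characteristics is [a_ij u_j] up to a term with a
   continuous x-derivative. *)
Lemma coupling_potential (i j : nat) : (1 <= i <= n)%nat -> (1 <= j <= n)%nat -> j <> i ->
  exists U Ux Ut H Hx, C1s T U Ux Ut /\ Cx T H Hx /\
    Broad (lam i) T U (fun x t => a i j x t * u j x t + H x t).
Proof.
  intros Hi Hj Hne. destruct HS as [HT Hin Hlam Hlne Ha Hg Hu HB _ _ _ _].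
  pose proof (Hlam i Hi) as Hli. pose proof (Hlam j Hj) as Hlj.
  assert (Hd : forall x t, lam i x t - lam j x t <> 0).
  { intros x t H. apply (Hlne i j Hi Hj (not_eq_sym Hne) x t). lra. }
  pose proof (C1s_div _ _ _ _ _ _ _ (Ha i j Hi Hj) (C1s_minus _ _ _ _ _ _ _ Hli Hlj) Hd) as HG.
  set (G x t := a i j x t / (lam i x t - lam j x t)) in HG.
  match type of HG with C1s _ _ ?p ?q => set (Gx := p) in HG; set (Gt := q) in HG end.
  (* Along the j-th curves [G] has a classical derivative and [u j] an integrated one; the product
     rule then gives the transport equation of [v]. *)
  pose proof (broad_C1s (Hin j Hj) T G Gx Gt HG) as HBG.
  pose proof (forcing_cont j Hj) as HF. pose proof (Hu j Hj) as Huj.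
  destruct (HG) as [HGc HGxc HGtc _ _]. destruct (Hlj) as [Hljc Hljx _ Hljd _].
  destruct (Hli) as [Hlic _ _ _ _].
  assert (HDG : cont2 (fun x t => Gt x t + lam j x t * Gx x t)) by (intros p; cts).
  pose proof (broad_mult (Hin j Hj) T G _ (u j) _ HGc Huj HDG HF HBG (HB j Hj)) as HBv.
  set (v x t := G x t * u j x t) in HBv.
  match type of HBv with Broad _ _ _ ?p => set (f := p) in HBv end.
  assert (Hv : cont2 v) by (intros p; unfold v; cts).
  assert (Hf : cont2 f) by (intros p; unfold f; cts).
  pose proof (potential_C1s (in_reg (Hin j Hj)) Hljx T Hljd v f Hv Hf HBv) as HU.
  pose proof (potential_rest_Cx (in_reg (Hin j Hj)) Hljx T v f Hv Hf) as HR.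
  eexists _, _, _, _, _. split; [exact HU|]. split; [exact HR|].
  (* U_t + lam_i U_x contains (lam_i - lam_j) G u_j, and this factor cancels the denominator of
     [G]. *)
  eapply (broad_ext (Hin i Hi)); [reflexivity| |apply (broad_C1s (Hin i Hi) T _ _ _ HU)].
  intros x t _ _. cbv beta. unfold v at 1 3. unfold G. field. apply Hd.
Qed.

(** The number of summed components is separate from n so that the induction keeps the full system;
    the index j = i, where the denominator would vanish, contributes zero. *)
Lemma coupling_potentials (i m : nat) : (1 <= i <= n)%nat -> (m <= n)%nat ->
  exists U Ux Ut H Hx, C1s T U Ux Ut /\ Cx T H Hx /\
    Broad (lam i) T U (fun x t =>
      sum1 m (fun j => if Nat.eqb j i then 0 else a i j x t * u j x t) + H x t).
Proof.
  intros Hi. pose proof (sy_in HS i Hi) as Hin.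
  pose proof (sy_u HS) as Hu.
  pose proof (fun j Hj => c1_f (sy_a HS i j Hi Hj)) as Ha.
  induction m as [|m IH]; intros Hm.
  - exists (fun _ _ => 0), (fun _ _ => 0), (fun _ _ => 0), (fun _ _ => 0), (fun _ _ => 0).
    split; [apply C1s_const|]. split; [exact (C1s_Cx _ _ _ _ (C1s_const T 0))|].
    eapply (broad_ext Hin); [reflexivity| |apply (broad_C1s Hin T _ _ _ (C1s_const T 0))].
    intros x t _ _. cbv beta. rewrite sum1_0. ring.
  - destruct IH as (U & Ux & Ut & H & Hx & HU & HH & HB); [lia|].
    destruct (Nat.eq_dec (S m) i) as [Heq|Hne].
    + exists U, Ux, Ut, H, Hx. split; [assumption|]. split; [assumption|].
      eapply (broad_ext Hin); [reflexivity| |exact HB].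
      intros x t _ _. cbv beta. rewrite sum1_S, (proj2 (Nat.eqb_eq _ _) Heq). ring.
    + assert (Hm1 : (1 <= S m <= n)%nat) by lia.
      destruct (coupling_potential i (S m) Hi Hm1 Hne) as (V & Vx & Vt & K & Kx & HV & HK & HBV).
      pose proof (C1s_plus _ _ _ _ _ _ _ HU HV) as HUV.
      pose proof (Cx_plus _ _ _ _ _ HH HK) as HHK.
      eexists _, _, _, _, _. split; [exact HUV|]. split; [exact HHK|].
      pose proof (Hu (S m) Hm1) as Hum. pose proof (Ha (S m) Hm1) as Ham.
      pose proof (cx_f HH) as HHc. pose proof (cx_f HK) as HKc.
      eapply (broad_ext Hin); [reflexivity| |apply (broad_plus Hin T U _ V _) with (3 := HB) (4 := HBV)].
      * intros x t _ _. cbv beta. rewrite sum1_S, (proj2 (Nat.eqb_neq _ _) Hne). ring.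
      * intros p. cts.
        apply (continuous_sum1 m (fun j q => if Nat.eqb j i then 0 else a i j (fst q) (snd q) * u j (fst q) (snd q))).
        intros j Hj. destruct (Nat.eqb j i); [cts|].
        pose proof (Ha j ltac:(lia)). pose proof (Hu j ltac:(lia)). cts.
      * intros p. cts.
Qed.

(** Once the potentials are added, the zero-order term with a_ii is removed by an integrating factor
    exp([th]). It must itself be C^1 for the new right-hand side to keep a continuous x-derivative,
    so [th] is taken from [transport_C1]. *)
Lemma component_C1 (i : nat) : (1 <= i <= n)%nat ->
  exists T1, T <= T1 /\ exists V Vx Vt, C1s T1 V Vx Vt /\
    forall x t, 0 <= x <= 1 -> T1 <= t -> u i x t = V x t.
Proof.
  intros Hi. destruct (coupling_potentials i n Hi (le_n n)) as (U & Ux & Ut & H & Hx & HU & HH & HB).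
  pose proof (forcing_cont i Hi) as HF.
  destruct HS as [HT Hins Hlam _ Ha Hg Hu HBu Hb Hb' Hdb Hbc].
  pose proof (Hins i Hi) as Hin. pose proof (Hu i Hi) as Hui.
  pose proof (Ha i i Hi Hi) as Haii. pose proof (C1s_Cx _ _ _ _ (Hlam i Hi)) as HlamC.
  pose proof (inflow_range Hin) as He.
  destruct (foot_large Hin T HT) as (T1 & HT1 & Hfoot).
  exists T1. split; [assumption|].
  destruct (transport_C1 Hin T (a i i) (ax i i) (fun _ => 0) (fun _ => 0) HlamC (C1s_Cx _ _ _ _ Haii))
    as (th & thx & tht & Hth & HBth & Hth0).
  { intros; cts. } { intros; cts. } { intros; apply is_derive_Rconst. }
  (* The summand a_ii U compensates for writing the zero-order term with u_i + U in place of u_i. *)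
  set (k x t := g i x t + H x t + a i i x t * U x t).
  assert (Hk : exists kx, Cx T k kx).
  { eexists. apply Cx_plus; [apply Cx_plus; [exact (C1s_Cx _ _ _ _ (Hg i Hi))|exact HH]|].
    apply Cx_mult; [exact (C1s_Cx _ _ _ _ Haii)|exact (C1s_Cx _ _ _ _ HU)]. }
  destruct Hk as [kx Hk].
  set (y x t := exp (th x t) * (u i x t + U x t)).
  pose proof (cx_f Hk) as Hkc. pose proof (cx_f HH) as HHc.
  pose proof (c1_f Hth) as Hthc. pose proof (c1_f HU) as HUc.
  pose proof (c1_ft HU) as HUtc.
  pose proof (c1_f Haii) as Haiic. pose proof (c1_f (Hg i Hi)) as Hgc.
  assert (HBz : Broad (lam i) T (fun x t => u i x t + U x t)
                  (fun x t => - (a i i x t * (u i x t + U x t)) + k x t)).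
  { eapply (broad_ext Hin); [reflexivity| |apply (broad_plus Hin T (u i) _ U _) with (3 := HBu i Hi) (4 := HB)].
    - intros x t _ _. cbv beta. unfold forcing, k. rewrite (sum1_split n i (fun j => a i j x t * u j x t) Hi). ring.
    - assumption.
    - intros p. cts.
      apply (continuous_sum1 n (fun j q => if Nat.eqb j i then 0 else a i j (fst q) (snd q) * u j (fst q) (snd q))).
      intros j Hj. destruct (Nat.eqb j i); [cts|].
      pose proof (c1_f (Ha i j Hi Hj)). pose proof (Hu j Hj). cts. }
  assert (HBy : Broad (lam i) T y (fun x t => exp (th x t) * k x t)).
  { assert (H1 : cont2 (fun x t => exp (th x t))) by (intros p; cts).
    assert (H2 : cont2 (fun x t => u i x t + U x t)) by (intros p; cts).
    assert (H3 : cont2 (fun x t => a i i x t * exp (th x t))) by (intros p; cts).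
    assert (H4 : cont2 (fun x t => - (a i i x t * (u i x t + U x t)) + k x t)) by (intros p; cts).
    apply (broad_ext Hin T _ _ _ _ (fun _ _ _ _ => eq_refl)) with
      (2 := broad_mult Hin T _ _ _ _ H1 H2 H3 H4 (broad_exp Hin T th _ Hthc Haiic HBth) HBz).
    intros x t _ _. cbv beta. ring. }
  destruct (transport_regularity (mu := lamx i) Hin T T1 y (fun x t => exp (th x t) * k x t)
     (fun x t => (thx x t * exp (th x t)) * k x t + exp (th x t) * kx x t)
     (fun t => b i t + U (e i) t) (fun t => b' i t + Ut (e i) t)) as (V & Vx & Vt & HV & HyV); auto.
  - apply Cx_mult; [exact (C1s_Cx _ _ _ _ (C1s_exp _ _ _ _ Hth))|exact Hk].
  - intros t. pose proof (Hb i Hi t). cts.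
  - intros t. pose proof (Hb' i Hi t). cts.
  - intros t Ht. apply is_derive_Rplus; [now apply Hdb|].
    now apply (C1s_boundary_derive T U Ux Ut).
  - intros t Ht. unfold y. rewrite Hth0, exp_0, (Hbc i Hi t Ht) by assumption. ring.
  - pose proof (C1s_minus _ _ _ _ _ _ _
      (C1s_mult _ _ _ _ _ _ _ (C1s_exp _ _ _ _ (C1s_opp _ _ _ _ (C1s_later T T1 _ _ _ HT1 Hth))) HV)
      (C1s_later T T1 _ _ _ HT1 HU)) as HW.
    eexists _, _, _. split; [exact HW|].
    intros x t Hx0 Ht. cbv beta. rewrite <- HyV by assumption. unfold y.
    rewrite exp_Ropp. field. apply Rgt_not_eq, exp_pos.
Qed.

Lemma system_C1 : exists T1, T <= T1 /\ forall i, (1 <= i <= n)%nat ->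
  exists V Vx Vt, C1s T1 V Vx Vt /\ forall x t, 0 <= x <= 1 -> T1 <= t -> u i x t = V x t.
Proof.
  apply (uniform_time n T (fun i T1 => exists V Vx Vt, C1s T1 V Vx Vt /\
           forall x t, 0 <= x <= 1 -> T1 <= t -> u i x t = V x t)).
  - intros i T1 T2 (V & Vx & Vt & HV & H) HT. exists V, Vx, Vt.
    split; [now apply (C1s_later T1)|]. intros; apply H; [assumption|lra].
  - exact component_C1.
Qed.

End System.

(** * The system satisfied by the time derivative *)

Lemma eq_at_start (f g : R -> R) (T : R) :
  continuous f T -> continuous g T -> (forall t, T < t -> f t = g t) -> f T = g T.
Proof.
  intros Hf Hg H. apply cond_eq. intros eps He.
  destruct (continuous_Reps' _ _ (continuous_Rminus f g T Hf Hg) eps He) as [d Hd].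
  pose proof (cond_pos d) as Hd0.
  specialize (Hd (T + d / 2)). cbv beta in Hd.
  rewrite (H (T + d / 2)), Rminus_diag, Rminus_0_l, Rabs_Ropp in Hd by lra.
  apply Hd. change (Rabs (T + d / 2 - T) < d). apply Rabs_def1; lra.
Qed.

Lemma eq_on_closure (T : R) (f g : R -> R -> R) :
  cont2 f -> cont2 g -> (forall x t, 0 < x < 1 -> T < t -> f x t = g x t) ->
  forall x t, 0 <= x <= 1 -> T <= t -> f x t = g x t.
Proof.
  intros Hf Hg H.
  assert (H1 : forall x t, 0 <= x <= 1 -> T < t -> f x t = g x t).
  { intros x t Hx Ht. apply (eq_at_boundary (fun x => f x t) (fun x => g x t)); auto;
      now apply cont2_x. }
  intros x t Hx [Ht| <-]; [now apply H1|].
  apply (eq_at_start (fun t => f x t) (fun t => g x t)); auto; now apply cont2_t.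
Qed.

Lemma C1s_shift (T h : R) (f fx ft : R -> R -> R) : 0 <= h -> C1s T f fx ft ->
  C1s T (fun x t => f x (t + h)) (fun x t => fx x (t + h)) (fun x t => ft x (t + h)).
Proof.
  intros Hh [? ? ? Hfx Hft].
  split; try solve [intros p; cts]; intros x t Hx Ht.
  - apply Hfx; [assumption|lra].
  - eapply is_derive_eq.
    + apply (is_derive_Rcomp (fun s => f x s) (fun s => s + h)); [apply Hft; [assumption|lra]|der; reflexivity].
    + ring.
Qed.

(** Difference quotient in time of a primitive of [f], in the mean-value form that remains
    meaningful at h = 0. *)
Definition time_mean (f : R -> R -> R) (h x t : R) : R := RInt (fun th => f x (t + th * h)) 0 1.

Lemma time_mean_cont {U : UniformSpace} (f : R -> R -> R) (a b c : U -> R) (p : U) :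
  cont2 f -> (forall q, continuous a q) -> (forall q, continuous b q) -> (forall q, continuous c q) ->
  continuous (fun q => time_mean f (a q) (b q) (c q)) p.
Proof.
  intros Hf Ha Hb Hc. unfold time_mean.
  apply (continuous_RInt_param (fun q th => f (b q) (c q + th * a q))); [|cts|cts].
  intros q s. cts.
  - now apply (continuous_comp fst b); [cts|].
  - now apply (continuous_comp fst c); [cts|].
  - now apply (continuous_comp fst a); [cts|].
Qed.

Lemma time_mean_0 (f : R -> R -> R) (x t : R) : time_mean f 0 x t = f x t.
Proof.
  unfold time_mean. rewrite (RInt_Req _ (fun _ => f x t)).
  - rewrite RInt_Rconst, Rminus_0_r. apply Rmult_1_l.
  - intros s. now rewrite Rmult_0_r, Rplus_0_r.
Qed.

Lemma time_mean_spec (T : R) (f fx ft : R -> R -> R) (h x t : R) :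
  C1s T f fx ft -> 0 <= x <= 1 -> T <= t -> 0 <= h ->
  f x (t + h) - f x t = h * time_mean ft h x t.
Proof.
  intros HC Hx Ht Hh.
  rewrite (C1s_time_integral T f fx ft x t (t + h)) by (auto; lra).
  rewrite RInt_mean by (intros; apply cont2_t, HC).
  unfold time_mean. now replace (t + h - t) with h by ring.
Qed.

Section TimeDerivative.

Context {lam lamx lamt : R -> R -> R} {sg e : R} (Hin : inflow lam sg e) {T : R}
  (Hlam : C1s T lam lamx lamt)
  {v vx vt F Fx Ft : R -> R -> R} (Hv : C1s T v vx vt) (HF : C1s T F Fx Ft) (HB : Broad lam T v F).

(** In the interior, [v] along a curve is differentiated in two ways, by the chain rule and by
    [Broad]; uniqueness of the derivative gives the equation, and continuity extends it to the
    closed strip. *)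
Lemma transport_equation (x t : R) : 0 <= x <= 1 -> T <= t -> vt x t + lam x t * vx x t = F x t.
Proof.
  pose proof (in_reg Hin) as Hl.
  destruct Hlam as [Hlc _ _ _ _]. destruct (Hv) as [_ Hvx Hvt _ _]. destruct HF as [HFc _ _ _ _].
  apply (eq_on_closure T (fun x t => vt x t + lam x t * vx x t)); [intros p; cts|assumption|].
  clear x t. intros x t Hx Ht.
  assert (Hnb : exists d : posreal, forall s, Rabs (s - t) < d -> 0 < flow lam s x t < 1).
  { assert (Hm : 0 < Rmin x (1 - x)) by (apply Rmin_pos; lra).
    destruct (continuous_Reps' _ _ (flow_time_cont Hl x t t) _ Hm) as [d Hd].
    exists d. intros s Hs. specialize (Hd s Hs). cbv beta in Hd.
    rewrite (flow_init Hl x t) in Hd. apply Rabs_def2 in Hd.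
    pose proof (Rmin_l x (1 - x)). pose proof (Rmin_r x (1 - x)). lra. }
  destruct Hnb as [d Hd]. pose proof (cond_pos d) as Hd0.
  set (k := Rmin d (t - T) / 2).
  assert (Hk : 0 < k /\ k < d /\ k < t - T).
  { unfold k, Rmin. destruct (Rle_dec _ _); lra. }
  pose proof (broad_derive Hin T v F HFc HB x t (t - k) (t + k) t ltac:(lra)) as H1.
  pose proof (C1s_chain T v vx vt (fun s => flow lam s x t) t (lam (flow lam t x t) t) Hv) as H2.
  cbv beta in H2. rewrite (flow_init Hl x t) in H1, H2.
  pose proof (flow_derive Hl x t t) as H3. rewrite (flow_init Hl x t) in H3.
  pose proof (is_derive_unique _ _ _ (H2 Hx Ht H3)) as E2.
  rewrite <- E2. apply is_derive_unique, H1; [|lra].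
  intros s Hs. assert (0 < flow lam s x t < 1); [|lra]. apply Hd, Rabs_def1; lra.
Qed.

(* The equation for the time derivative is obtained from that of the difference
   quotient in time, written with [time_mean] so that it extends to [h = 0]. *)
Lemma time_derivative_broad : Broad lam T vt (fun x t => Ft x t - lamt x t * vx x t).
Proof.
  pose proof (in_reg Hin) as Hl.
  destruct (Hlam) as [Hlc _ Hltc _ _]. destruct (Hv) as [Hvc Hvxc Hvtc _ _].
  destruct (HF) as [HFc _ HFtc _ _].
  intros x t a b Ha Hab Hseg.
  set (xi s := flow lam s x t).
  assert (Hxi : forall s, continuous xi s) by (intros; now apply flow_time_cont).
  set (rhs h s := time_mean Ft h (xi s) s - time_mean lamt h (xi s) s * vx (xi s) (s + h)).
  assert (Hrhs : forall q : R * R, continuous (fun q => rhs (fst q) (snd q)) q).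
  { assert (Hx : forall q : R * R, continuous (fun q : R * R => xi (snd q)) q).
    { intros q. apply (continuous_comp (fun q : R * R => snd q) xi); [cts|apply Hxi]. }
    intros q. specialize (Hx q) as Hq. unfold rhs. cts.
    - apply (time_mean_cont Ft fst (fun q : R * R => xi (snd q)) snd); auto; intros; cts.
    - apply (time_mean_cont lamt fst (fun q : R * R => xi (snd q)) snd); auto; intros; cts. }
  assert (Hrhs' : forall h s, continuous (rhs h) s) by (intros h s; exact (cont2_t rhs h s Hrhs)).
  (* The identity is proved for h > 0 and passed to the limit: both sides are continuous in h at 0,
     where [time_mean] is the function itself. *)
  pose proof (eq_at_start (fun h => time_mean vt h (xi b) b - time_mean vt h (xi a) a)
                (fun h => RInt (rhs h) a b) 0) as H.
  cbv beta in H. rewrite !time_mean_0 in H.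
  change (vt (xi b) b - vt (xi a) a = RInt (fun s => Ft (xi s) s - lamt (xi s) s * vx (xi s) s) a b).
  rewrite H.
  - apply RInt_Req. intros s. unfold rhs. now rewrite !time_mean_0, Rplus_0_r.
  - apply continuous_Rminus; apply time_mean_cont; auto; intros; cts.
  - apply (continuous_RInt_param rhs); [|cts|cts]. intros h s. apply Hrhs.
  - intros h Hh.
    assert (HD : (v (xi b) (b + h) - v (xi b) b) - (v (xi a) (a + h) - v (xi a) a)
                 = RInt (fun s => h * rhs h s) a b).
    { apply (FTC_open (fun s => v (xi s) (s + h) - v (xi s) s)); auto.
      - intros s _. specialize (Hxi s). cts.
      - intros s. apply (continuous_Rmult (fun _ => h)); [cts|apply Hrhs'].
      - intros s Hs.
        assert (Hxs : 0 < xi s < 1) by (apply (flow_interior Hin x t a b); auto; apply Hseg; lra).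
        pose proof (C1s_chain T _ _ _ xi s (lam (xi s) s) (C1s_shift T h _ _ _ (Rlt_le _ _ Hh) Hv)
                      Hxs ltac:(lra) (flow_derive Hl x t s)) as H1.
        pose proof (broad_derive Hin T v F HFc HB x t a b s Ha Hseg Hs) as H2.
        eapply is_derive_eq; [apply is_derive_Rminus; [exact H1|exact H2]|].
        cbv beta. fold (xi s). unfold rhs.
        (* The shifted function is followed at the speed of time s, while its equation holds with
           the speed of time s + h; the difference of the two speeds produces the term with
           [lamt]. *)
        pose proof (time_mean_spec T F Fx Ft h (xi s) s HF ltac:(lra) ltac:(lra) ltac:(lra)) as EF.
        pose proof (time_mean_spec T lam lamx lamt h (xi s) s Hlam ltac:(lra) ltac:(lra) ltac:(lra)) as El.
        pose proof (transport_equation (xi s) (s + h) ltac:(lra) ltac:(lra)) as EE.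
        replace (h * (time_mean Ft h (xi s) s - time_mean lamt h (xi s) s * vx (xi s) (s + h))) with
          (h * time_mean Ft h (xi s) s - (h * time_mean lamt h (xi s) s) * vx (xi s) (s + h)) by ring.
        rewrite <- EF, <- El, <- EE. ring. }
    rewrite (time_mean_spec T v vx vt h (xi b) b Hv) in HD by (try apply Hseg; lra).
    rewrite (time_mean_spec T v vx vt h (xi a) a Hv) in HD by (try apply Hseg; lra).
    rewrite RInt_Rscal in HD by apply Hrhs'.
    apply (Rmult_eq_reg_l h); [|lra]. lra.
Qed.

End TimeDerivative.

Section DerivedSystem.

Context {n : nat} {T : R} {lam lamx lamt : nat -> R -> R -> R} {sg e : nat -> R}
  {a ax at' : nat -> nat -> R -> R -> R} {g gx gt u : nat -> R -> R -> R} {b b' : nat -> R -> R}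
  (HS : system n T lam lamx lamt sg e a ax at' g gx gt u b b')
  {ux ut : nat -> R -> R -> R}
  (Hu : forall i, (1 <= i <= n)%nat -> C1s T (u i) (ux i) (ut i)).

Lemma forcing_C1s (i : nat) : (1 <= i <= n)%nat ->
  exists Fx, C1s T (forcing n a g u i) Fx
    (fun x t => gt i x t - sum1 n (fun j => at' i j x t * u j x t + a i j x t * ut j x t)).
Proof.
  intros Hi. destruct HS as [_ _ _ _ Ha Hg _ _ _ _ _ _]. eexists.
  eapply C1s_minus; [apply (Hg i Hi)|].
  apply (C1s_sum1 T n (fun j x t => a i j x t * u j x t)
    (fun j x t => ax i j x t * u j x t + a i j x t * ux j x t)
    (fun j x t => at' i j x t * u j x t + a i j x t * ut j x t)).
  intros j Hj. apply C1s_mult; auto.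
Qed.

Lemma system_equation (i : nat) (x t : R) : (1 <= i <= n)%nat -> 0 <= x <= 1 -> T <= t ->
  ux i x t = (forcing n a g u i x t - ut i x t) / lam i x t.
Proof.
  intros Hi Hx Ht. destruct (forcing_C1s i Hi) as [Fx HF].
  destruct HS as [_ Hin Hlam _ _ _ _ HB _ _ _ _].
  rewrite <- (transport_equation (Hin i Hi) (Hlam i Hi) (Hu i Hi) HF (HB i Hi) x t Hx Ht).
  field. apply (inflow_nonzero (Hin i Hi)).
Qed.

(** The term - lamt u_x is eliminated through u_x = (F - u_t) / lam: its part with u_t goes to the
    diagonal of the matrix and its part with F to the right-hand side, so no x-derivative is
    left. *)
Lemma derived_broad (i : nat) : (1 <= i <= n)%nat ->
  Broad (lam i) T (ut i)
    (forcing n (fun i j x t => a i j x t - (if Nat.eqb j i then lamt i x t / lam i x t else 0))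
       (fun i x t => gt i x t - sum1 n (fun j => at' i j x t * u j x t)
                     - lamt i x t / lam i x t * forcing n a g u i x t) ut i).
Proof.
  intros Hi. destruct (forcing_C1s i Hi) as [Fx HF].
  pose proof (sy_in HS i Hi) as Hin.
  pose proof (sy_lam HS i Hi) as Hlam.
  pose proof (sy_broad HS i Hi) as HB.
  apply (broad_ext Hin T _ _ _ _ (fun _ _ _ _ => eq_refl)) with
    (2 := time_derivative_broad Hin Hlam (Hu i Hi) HF HB).
  intros x t Hx Ht. rewrite (system_equation i x t Hi) by lra.
  unfold forcing.
  rewrite sum1_plus.
  rewrite (sum1_split n i (fun j => (a i j x t - _) * ut j x t) Hi).
  rewrite (sum1_split n i (fun j => a i j x t * ut j x t) Hi).
  rewrite (sum1_ext n
    (fun j => if Nat.eqb j i then 0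
              else (a i j x t - (if Nat.eqb j i then lamt i x t / lam i x t else 0)) * ut j x t)
    (fun j => if Nat.eqb j i then 0 else a i j x t * ut j x t)).
  - cbv beta. rewrite Nat.eqb_refl. field. apply (inflow_nonzero Hin).
  - intros j _. destruct (Nat.eqb j i); [reflexivity|]. ring.
Qed.

(** The boundary identity can be differentiated because the side is a line in time; the strict
    inequality leaves a two-sided neighbourhood of t in which it holds. *)
Lemma derived_boundary (i : nat) (t : R) : (1 <= i <= n)%nat -> T < t -> ut i (e i) t = b' i t.
Proof.
  intros Hi Ht. destruct HS as [_ Hin _ _ _ _ _ _ _ _ Hdb Hbc].
  pose proof (C1s_boundary_derive T _ _ _ (e i) t (Hu i Hi) (inflow_range (Hin i Hi)) Ht) as H.
  rewrite <- (is_derive_unique _ _ _ H). apply is_derive_unique.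
  apply (is_derive_ext_loc (b i)); [|now apply Hdb].
  assert (Hd : 0 < t - T) by lra.
  exists (mkposreal _ Hd). intros s Hs. change (Rabs (s - t) < t - T) in Hs. apply Rabs_def2 in Hs.
  symmetry. apply Hbc; [assumption|lra].
Qed.

End DerivedSystem.

(** * Induction on the order of smoothness *)

Lemma continuous_on_plus {U : UniformSpace} (D : U -> Prop) (f g : U -> R) :
  continuous_on D f -> continuous_on D g -> continuous_on D (fun p => f p + g p).
Proof.
  intros Hf Hg p Hp.
  apply (filterlim_comp_2 f g Rplus (Hf p Hp) (Hg p Hp)).
  apply (filterlim_plus (V := R_NormedModule)).
Qed.

Lemma continuous_on_mult {U : UniformSpace} (D : U -> Prop) (f g : U -> R) :
  continuous_on D f -> continuous_on D g -> continuous_on D (fun p => f p * g p).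
Proof.
  intros Hf Hg p Hp.
  apply (filterlim_comp_2 f g Rmult (Hf p Hp) (Hg p Hp)).
  apply (filterlim_mult (K := R_AbsRing)).
Qed.

Lemma continuous_on_comp {U : UniformSpace} (D : U -> Prop) (h : R -> R) (f : U -> R) :
  continuous_on D f -> (forall p, D p -> continuous h (f p)) -> continuous_on D (fun p => h (f p)).
Proof.
  intros Hf Hh p Hp. exact (filterlim_comp _ _ _ f h _ _ _ (Hf p Hp) (Hh p Hp)).
Qed.

Lemma Cm2_continuous (m : nat) (D : R * R -> Prop) (f : R -> R -> R) :
  Cm2 m D f -> continuous_on D (fun p => f (fst p) (snd p)).
Proof. destruct m; intros [H _]; exact H. Qed.

Lemma Cm2_le (m : nat) (D : R * R -> Prop) (f : R -> R -> R) : Cm2 (S m) D f -> Cm2 m D f.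
Proof.
  revert f. induction m as [|m IH]; intros f [Hc (fx & ft & Hx & Ht & Hd)].
  - now split.
  - split; [assumption|]. exists fx, ft. auto.
Qed.

Lemma Cm2_subset (m : nat) (D D' : R * R -> Prop) (f : R -> R -> R) :
  (forall p, D' p -> D p) -> Cm2 m D f -> Cm2 m D' f.
Proof.
  intros HD. revert f. induction m as [|m IH]; intros f [Hc H].
  - split; [|trivial]. exact (continuous_on_subset _ _ _ HD Hc).
  - destruct H as (fx & ft & Hx & Ht & Hd).
    split; [exact (continuous_on_subset _ _ _ HD Hc)|]. exists fx, ft.
    split; [now apply IH|]. split; [now apply IH|].
    intros x t Hl. apply Hd. revert Hl. apply filter_imp, HD.
Qed.

Lemma locally_sections (P : R * R -> Prop) (x t : R) :
  locally (x, t) P -> locally x (fun y => P (y, t)) /\ locally t (fun s => P (x, s)).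
Proof.
  intros [d Hd].
  split; exists d; intros y Hy; apply Hd.
  - exact (conj Hy (ball_center t d)).
  - exact (conj (ball_center x d) Hy).
Qed.

Lemma Cm2_ext (m : nat) (D : R * R -> Prop) (f g : R -> R -> R) :
  (forall x t, D (x, t) -> f x t = g x t) -> Cm2 m D f -> Cm2 m D g.
Proof.
  intros Hfg Hf.
  assert (Hcg : continuous_on D (fun p => g (fst p) (snd p))).
  { apply (continuous_on_ext D (fun p => f (fst p) (snd p))); [|exact (Cm2_continuous m D f Hf)].
    intros [x t] Hp. now apply Hfg. }
  destruct m as [|m]; split; auto.
  destruct Hf as [_ (fx & ft & Hx & Ht & Hd)]. exists fx, ft.
  split; [assumption|]. split; [assumption|]. intros x t H. destruct (Hd x t H) as [Hdx Hdt]. split.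
  - apply (is_derive_ext_loc (fun y => f y t)); [|exact Hdx].
    apply locally_sections in H. destruct H as [H _]. revert H. apply filter_imp.
    intros y Hy. now apply Hfg.
  - apply (is_derive_ext_loc (fun s => f x s)); [|exact Hdt].
    apply locally_sections in H. destruct H as [_ H]. revert H. apply filter_imp.
    intros s Hs. now apply Hfg.
Qed.

Lemma Cm2_const (m : nat) (D : R * R -> Prop) (c : R) : Cm2 m D (fun _ _ => c).
Proof.
  revert c. induction m as [|m IH]; intros c.
  - split; [|trivial]. apply continuous_on_forall. intros p _. apply continuous_const.
  - split; [apply continuous_on_forall; intros p _; apply continuous_const|].
    exists (fun _ _ => 0), (fun _ _ => 0). split; [apply IH|]. split; [apply IH|].
    intros x t _. split; apply is_derive_Rconst.
Qed.

Lemma Cm2_plus (m : nat) (D : R * R -> Prop) (f g : R -> R -> R) :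
  Cm2 m D f -> Cm2 m D g -> Cm2 m D (fun x t => f x t + g x t).
Proof.
  revert f g. induction m as [|m IH]; intros f g [Hf H] [Hg H'].
  - split; [|trivial]. now apply continuous_on_plus.
  - split; [now apply continuous_on_plus|].
    destruct H as (fx & ft & Hx & Ht & Hd). destruct H' as (gx & gt & Hx' & Ht' & Hd').
    exists (fun x t => fx x t + gx x t), (fun x t => ft x t + gt x t).
    split; [now apply IH|]. split; [now apply IH|].
    intros x t Hl. destruct (Hd x t Hl), (Hd' x t Hl). split; now apply is_derive_Rplus.
Qed.

Lemma Cm2_mult (m : nat) (D : R * R -> Prop) (f g : R -> R -> R) :
  Cm2 m D f -> Cm2 m D g -> Cm2 m D (fun x t => f x t * g x t).
Proof.
  revert f g. induction m as [|m IH]; intros f g Hf Hg.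
  - split; [|trivial]. apply continuous_on_mult; [apply Hf|apply Hg].
  - split; [apply continuous_on_mult; [apply Hf|apply Hg]|].
    pose proof (Cm2_le _ _ _ Hf) as Hf'. pose proof (Cm2_le _ _ _ Hg) as Hg'.
    destruct Hf as [_ (fx & ft & Hx & Ht & Hd)]. destruct Hg as [_ (gx & gt & Hx' & Ht' & Hd')].
    exists (fun x t => fx x t * g x t + f x t * gx x t), (fun x t => ft x t * g x t + f x t * gt x t).
    split; [now apply Cm2_plus; apply IH|]. split; [now apply Cm2_plus; apply IH|].
    intros x t Hl. destruct (Hd x t Hl), (Hd' x t Hl). split.
    + now apply (is_derive_Rmult (fun y => f y t) (fun y => g y t)).
    + now apply (is_derive_Rmult (fun s => f x s) (fun s => g x s)).
Qed.

Lemma Cm2_opp (m : nat) (D : R * R -> Prop) (f : R -> R -> R) :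
  Cm2 m D f -> Cm2 m D (fun x t => - f x t).
Proof.
  intros H. apply (Cm2_ext m D (fun x t => -1 * f x t)); [intros; ring|].
  apply Cm2_mult; [apply Cm2_const|assumption].
Qed.

Lemma Cm2_minus (m : nat) (D : R * R -> Prop) (f g : R -> R -> R) :
  Cm2 m D f -> Cm2 m D g -> Cm2 m D (fun x t => f x t - g x t).
Proof. intros Hf Hg. apply Cm2_plus; [assumption|now apply Cm2_opp]. Qed.

Lemma Cm2_inv (m : nat) (D : R * R -> Prop) (f : R -> R -> R) :
  (forall x t, D (x, t) -> f x t <> 0) -> Cm2 m D f -> Cm2 m D (fun x t => / f x t).
Proof.
  intros H0.
  assert (Hc : continuous_on D (fun p => f (fst p) (snd p)) -> continuous_on D (fun p => / f (fst p) (snd p))).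
  { intros H. apply (continuous_on_comp D Rinv _ H). intros [x t] Hp. apply continuous_Rinv.
    now apply H0. }
  induction m as [|m IH]; intros Hf.
  - split; [|trivial]. apply Hc, Hf.
  - split; [apply Hc, Hf|].
    pose proof (IH (Cm2_le _ _ _ Hf)) as Hi.
    destruct Hf as [_ (fx & ft & Hx & Ht & Hd)].
    exists (fun x t => - (fx x t * (/ f x t * / f x t))), (fun x t => - (ft x t * (/ f x t * / f x t))).
    split; [now apply Cm2_opp, Cm2_mult, Cm2_mult|]. split; [now apply Cm2_opp, Cm2_mult, Cm2_mult|].
    intros x t Hl. destruct (Hd x t Hl) as [H1 H2].
    pose proof (H0 x t (locally_singleton _ _ Hl)) as Hne. split.
    + eapply is_derive_eq; [apply (is_derive_inv (fun y => f y t)); eassumption|]. field. assumption.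
    + eapply is_derive_eq; [apply (is_derive_inv (fun s => f x s)); eassumption|]. field. assumption.
Qed.

Lemma Cm2_div (m : nat) (D : R * R -> Prop) (f g : R -> R -> R) :
  (forall x t, D (x, t) -> g x t <> 0) -> Cm2 m D f -> Cm2 m D g -> Cm2 m D (fun x t => f x t / g x t).
Proof. intros H0 Hf Hg. apply Cm2_mult; [assumption|now apply Cm2_inv]. Qed.

Lemma Cm2_sum1 (m n : nat) (D : R * R -> Prop) (f : nat -> R -> R -> R) :
  (forall j, (1 <= j <= n)%nat -> Cm2 m D (f j)) -> Cm2 m D (fun x t => sum1 n (fun j => f j x t)).
Proof.
  intros H. induction n as [|n IH].
  - apply (Cm2_ext m D (fun _ _ => 0)); [intros; now rewrite sum1_0|]. apply Cm2_const.
  - apply (Cm2_ext m D (fun x t => sum1 n (fun j => f j x t) + f (S n) x t)).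
    + intros. now rewrite sum1_S.
    + apply Cm2_plus; [apply IH|apply H; lia]. intros j Hj. apply H. lia.
Qed.

Lemma Cm2_forcing (m n : nat) (D : R * R -> Prop) (a : nat -> nat -> R -> R -> R)
    (g u : nat -> R -> R -> R) (i : nat) :
  (forall j, (1 <= j <= n)%nat -> Cm2 m D (a i j)) -> Cm2 m D (g i) ->
  (forall j, (1 <= j <= n)%nat -> Cm2 m D (u j)) -> Cm2 m D (forcing n a g u i).
Proof.
  intros Ha Hg Hu. apply Cm2_minus; [assumption|].
  apply (Cm2_sum1 m n D (fun j x t => a i j x t * u j x t)). intros j Hj. apply Cm2_mult; auto.
Qed.

Lemma Cm1_continuous (m : nat) (D : R -> Prop) (f : R -> R) : Cm1 m D f -> continuous_on D f.
Proof. destruct m; intros [H _]; exact H. Qed.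

Lemma Cm1_le (m : nat) (D : R -> Prop) (f : R -> R) : Cm1 (S m) D f -> Cm1 m D f.
Proof.
  revert f. induction m as [|m IH]; intros f [Hc (f' & H' & Hd)].
  - now split.
  - split; [assumption|]. exists f'. auto.
Qed.

Lemma Cm1_subset (m : nat) (D D' : R -> Prop) (f : R -> R) :
  (forall p, D' p -> D p) -> Cm1 m D f -> Cm1 m D' f.
Proof.
  intros HD. revert f. induction m as [|m IH]; intros f [Hc H].
  - split; [|trivial]. exact (continuous_on_subset _ _ _ HD Hc).
  - destruct H as (f' & H' & Hd).
    split; [exact (continuous_on_subset _ _ _ HD Hc)|]. exists f'. split; auto.
    intros t Ht. apply Hd. revert Ht. apply filter_imp, HD.
Qed.

(** * Half strips and extension to the plane *)

(** Convertible with the set that appears in [smoothing]. *)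
Definition half_strip (T : R) (p : R * R) : Prop := Pibar p /\ T <= snd p.

Lemma half_strip_iff (T x t : R) : 0 <= T -> half_strip T (x, t) <-> 0 <= x <= 1 /\ T <= t.
Proof. intros HT. unfold half_strip, Pibar. cbn. lra. Qed.

Lemma half_strip_interior (T x t : R) : 0 <= T ->
  locally (x, t) (half_strip T) <-> 0 < x < 1 /\ T < t.
Proof.
  intros HT. split.
  - intros H. apply locally_sections in H. destruct H as [[d Hd] [d' Hd']].
    pose proof (cond_pos d). pose proof (cond_pos d').
    assert (H1 : half_strip T (x - d / 2, t)).
    { apply Hd. change (Rabs (x - d / 2 - x) < d). apply Rabs_def1; lra. }
    assert (H2 : half_strip T (x + d / 2, t)).
    { apply Hd. change (Rabs (x + d / 2 - x) < d). apply Rabs_def1; lra. }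
    assert (H3 : half_strip T (x, t - d' / 2)).
    { apply Hd'. change (Rabs (t - d' / 2 - t) < d'). apply Rabs_def1; lra. }
    apply half_strip_iff in H1, H2, H3; lra.
  - intros [Hx Ht].
    set (d := Rmin (Rmin x (1 - x)) (t - T)).
    assert (Hd : 0 < d /\ d <= x /\ d <= 1 - x /\ d <= t - T).
    { unfold d, Rmin. repeat destruct (Rle_dec _ _); lra. }
    exists (mkposreal d (proj1 Hd)). intros [y s] [Hy Hs].
    change (Rabs (y - x) < d) in Hy. change (Rabs (s - t) < d) in Hs.
    apply Rabs_def2 in Hy. apply Rabs_def2 in Hs. apply half_strip_iff; lra.
Qed.

(** Composition with the retraction of the plane onto the closed half strip that moves each
    coordinate to the nearest admissible value. *)
Definition ext (T : R) (f : R -> R -> R) (x t : R) : R := f (clamp x) (Rmax T t).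

Lemma ext_eq (T : R) (f : R -> R -> R) (x t : R) : 0 <= x <= 1 -> T <= t -> ext T f x t = f x t.
Proof. intros Hx Ht. unfold ext. now rewrite clamp_id, Rmax_right. Qed.

Lemma ext_cont (T : R) (f : R -> R -> R) : 0 <= T ->
  continuous_on (half_strip T) (fun p => f (fst p) (snd p)) -> cont2 (ext T f).
Proof.
  intros HT Hf p. unfold ext.
  set (c q := (clamp (fst q), Rmax T (snd q)) : R * R).
  assert (Hc : continuous c p).
  { unfold c. intros P [d Hd].
    assert (H1 : continuous (fun q : R * R => clamp (fst q)) p) by (apply clamp_cont; cts).
    assert (H2 : continuous (fun q : R * R => Rmax T (snd q)) p) by cts.
    change (locally p (fun q => P (clamp (fst q), Rmax T (snd q)))).
    generalize (filter_and _ _ (continuous_Reps' _ _ H1 d (cond_pos d)) (continuous_Reps' _ _ H2 d (cond_pos d))).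
    apply filter_imp. intros q [Hq1 Hq2]. apply Hd. split; assumption. }
  assert (Hin : forall q, half_strip T (c q)).
  { intros q. apply half_strip_iff; [assumption|]. split; [apply clamp_bounds|apply Rmax_l]. }
  apply (filterlim_comp _ _ _ c (fun p => f (fst p) (snd p)) _ (within (half_strip T) (locally (c p))) _).
  - intros P HP. specialize (Hc _ HP).
    change (locally p (fun q => half_strip T (c q) -> P (c q))) in Hc.
    change (locally p (fun q => P (c q))). revert Hc. apply filter_imp. auto.
  - exact (Hf (c p) (Hin p)).
Qed.

(** The extension [f'] is left free because the speeds are extended from time 0, to keep one flow
    throughout, while the other data are extended from the current T. *)
Lemma ext_C1s (T : R) (f fx ft f' : R -> R -> R) : 0 <= T ->
  cont2 f' -> (forall x t, 0 <= x <= 1 -> T <= t -> f x t = f' x t) ->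
  continuous_on (half_strip T) (fun p => fx (fst p) (snd p)) ->
  continuous_on (half_strip T) (fun p => ft (fst p) (snd p)) ->
  (forall x t, locally (x, t) (half_strip T) ->
     is_derive (fun y => f y t) x (fx x t) /\ is_derive (fun s => f x s) t (ft x t)) ->
  C1s T f' (ext T fx) (ext T ft).
Proof.
  intros HT Hf' Heq Hfx Hft Hd.
  split; [assumption|now apply ext_cont|now apply ext_cont| |]; intros x t Hx Ht.
  - assert (Hl : locally (x, t) (half_strip T)) by now apply half_strip_interior.
    rewrite ext_eq by lra. apply (is_derive_ext_loc (fun y => f y t)); [|now apply Hd].
    apply locally_sections in Hl. destruct Hl as [Hl _]. revert Hl. apply filter_imp.
    intros y Hy. apply half_strip_iff in Hy; [|assumption]. now apply Heq.
  - assert (Hl : locally (x, t) (half_strip T)) by now apply half_strip_interior.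
    rewrite ext_eq by lra. apply (is_derive_ext_loc (fun s => f x s)); [|now apply Hd].
    apply locally_sections in Hl. destruct Hl as [_ Hl]. revert Hl. apply filter_imp.
    intros s Hs. apply half_strip_iff in Hs; [|assumption]. now apply Heq.
Qed.

Lemma index_choice {A : Type} (d : A) (n : nat) (P : nat -> A -> Prop) :
  (forall i, (1 <= i <= n)%nat -> exists x, P i x) ->
  exists f : nat -> A, forall i, (1 <= i <= n)%nat -> P i (f i).
Proof.
  intros H. exists (fun i => epsilon (inhabits d) (P i)).
  intros i Hi. apply epsilon_spec. now apply H.
Qed.

Lemma forcing_ext (n i : nat) (a a' : nat -> nat -> R -> R -> R) (g g' u u' : nat -> R -> R -> R) (x t : R) :
  (forall j, (1 <= j <= n)%nat -> a i j x t = a' i j x t) -> g i x t = g' i x t ->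
  (forall j, (1 <= j <= n)%nat -> u j x t = u' j x t) ->
  forcing n a g u i x t = forcing n a' g' u' i x t.
Proof.
  intros Ha Hg Hu. unfold forcing. f_equal; [assumption|].
  apply sum1_ext. intros j Hj. now rewrite Ha, Hu.
Qed.

Lemma continuous_Rmax_T (T : R) (f : R -> R) (t : R) :
  continuous_on (fun t => T <= t) f -> continuous (fun t => f (Rmax T t)) t.
Proof.
  intros Hf.
  apply (filterlim_comp _ _ _ (fun t => Rmax T t) f _ (within (fun t => T <= t) (locally (Rmax T t))) _).
  - intros P HP.
    assert (Hc : continuous (fun t => Rmax T t) t) by cts. specialize (Hc _ HP).
    change (locally t (fun q => T <= Rmax T q -> P (Rmax T q))) in Hc.
    change (locally t (fun q => P (Rmax T q))). revert Hc. apply filter_imp.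
    intros q Hq. apply Hq, Rmax_l.
  - exact (Hf (Rmax T t) (Rmax_l T t)).
Qed.

(** * Passage from order m to order m + 1 *)

Section Regularity.

Context {n : nat} {lam : nat -> R -> R -> R} {sg e : nat -> R}
  (Hlam : forall i, (1 <= i <= n)%nat -> smooth2 Pibar (lam i))
  (Hin : forall i, (1 <= i <= n)%nat -> inflow (ext 0 (lam i)) (sg i) (e i))
  (Hne : forall i j, (1 <= i <= n)%nat -> (1 <= j <= n)%nat -> i <> j ->
           forall x t, ext 0 (lam i) x t <> ext 0 (lam j) x t).

Lemma lam_nonzero (i : nat) (x t : R) : (1 <= i <= n)%nat -> 0 <= x <= 1 -> 0 <= t -> lam i x t <> 0.
Proof.
  intros Hi Hx Ht. rewrite <- (ext_eq 0 (lam i) x t Hx Ht). apply (inflow_nonzero (Hin i Hi)).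
Qed.

Lemma lam_half_strip (i m : nat) (T : R) : (1 <= i <= n)%nat -> 0 <= T -> Cm2 m (half_strip T) (lam i).
Proof. intros Hi HT. apply (Cm2_subset m Pibar); [|now apply Hlam]. intros p [Hp _]. exact Hp. Qed.

(** Coefficients, data and solution are quantified inside the induction, since u_t solves a system
    with other coefficients; the speeds, and so the flow, never change. *)
Lemma solution_Cm (m : nat) : forall (T : R) (a : nat -> nat -> R -> R -> R) (g u : nat -> R -> R -> R) (b : nat -> R -> R),
  0 <= T ->
  (forall i j, (1 <= i <= n)%nat -> (1 <= j <= n)%nat -> Cm2 m (half_strip T) (a i j)) ->
  (forall i, (1 <= i <= n)%nat -> Cm2 m (half_strip T) (g i)) ->
  (forall i, (1 <= i <= n)%nat -> Cm1 m (fun t => T <= t) (b i)) ->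
  (forall i, (1 <= i <= n)%nat -> continuous_on (half_strip T) (fun p => u i (fst p) (snd p))) ->
  (forall i, (1 <= i <= n)%nat -> Broad (ext 0 (lam i)) T (u i) (forcing n a g u i)) ->
  (forall i, (1 <= i <= n)%nat -> forall t, T <= t -> u i (e i) t = b i t) ->
  exists T', T <= T' /\ forall i, (1 <= i <= n)%nat -> Cm2 m (half_strip T') (u i).
Proof.
  induction m as [|m IH]; intros T a g u b HT Ha Hg Hb Hu HB Hbc.
  { exists T. split; [lra|]. intros i Hi. split; [now apply Hu|trivial]. }
  (* First use of the induction hypothesis, on [u] itself: [u] occurs in the right-hand side of the
     system for u_t, which has to be C^m. *)
  destruct (IH T a g u b) as (T2 & HT2 & Hum); auto.
  { intros i j Hi Hj. now apply Cm2_le, Ha. }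
  { intros i Hi. now apply Cm2_le, Hg. }
  { intros i Hi. now apply Cm1_le, Hb. }
  assert (Hlm : forall i, (1 <= i <= n)%nat -> Cm2 (S m) (half_strip T) (lam i)).
  { intros i Hi. now apply lam_half_strip. }
  destruct (index_choice (fun _ _ => 0) n _ (fun i Hi => proj2 (Hlm i Hi))) as [lamx Hlx].
  destruct (index_choice (fun _ _ => 0) n _ Hlx) as [lamt Hlt]. clear Hlx.
  destruct (index_choice (fun _ _ => 0) n _ (fun i Hi => proj2 (Hg i Hi))) as [gx Hgx].
  destruct (index_choice (fun _ _ => 0) n _ Hgx) as [gt Hgt]. clear Hgx.
  destruct (index_choice (fun _ => 0) n _ (fun i Hi => proj2 (Hb i Hi))) as [b' Hb'].
  assert (Hax : exists ax at' : nat -> nat -> R -> R -> R, forall i, (1 <= i <= n)%nat ->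
    forall j, (1 <= j <= n)%nat -> Cm2 m (half_strip T) (ax i j) /\ Cm2 m (half_strip T) (at' i j) /\
      forall x t, locally (x, t) (half_strip T) ->
        is_derive (fun y => a i j y t) x (ax i j x t) /\ is_derive (fun s => a i j x s) t (at' i j x t)).
  { assert (H : forall i, (1 <= i <= n)%nat -> exists ax at' : nat -> R -> R -> R,
      forall j, (1 <= j <= n)%nat -> Cm2 m (half_strip T) (ax j) /\ Cm2 m (half_strip T) (at' j) /\
      forall x t, locally (x, t) (half_strip T) ->
        is_derive (fun y => a i j y t) x (ax j x t) /\ is_derive (fun s => a i j x s) t (at' j x t)).
    { intros i Hi. destruct (index_choice (fun _ _ => 0) n _ (fun j Hj => proj2 (Ha i j Hi Hj))) as [ax Hax].
      destruct (index_choice (fun _ _ => 0) n _ Hax) as [at' Hat]. now exists ax, at'. }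
    destruct (index_choice (fun _ _ _ => 0) n _ H) as [ax Hax].
    destruct (index_choice (fun _ _ _ => 0) n _ Hax) as [at' Hat]. now exists ax, at'. }
  destruct Hax as (ax & at' & Hat).
  assert (HS : system n T (fun i => ext 0 (lam i)) (fun i => ext T (lamx i)) (fun i => ext T (lamt i)) sg e
    (fun i j => ext T (a i j)) (fun i j => ext T (ax i j)) (fun i j => ext T (at' i j))
    (fun i => ext T (g i)) (fun i => ext T (gx i)) (fun i => ext T (gt i)) (fun i => ext T (u i))
    (fun i t => b i (Rmax T t)) (fun i t => b' i (Rmax T t))).
  { split; auto.
    - intros i Hi. destruct (Hlt i Hi) as (H1 & H2 & H3).
      apply (ext_C1s T (lam i)); auto.
      + apply (in_reg (Hin i Hi)).
      + intros x t Hx Ht. symmetry. apply ext_eq; lra.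
      + now apply (Cm2_continuous m).
      + now apply (Cm2_continuous m).
    - intros i j Hi Hj. destruct (Hat i Hi j Hj) as (H1 & H2 & H3).
      apply (ext_C1s T (a i j)); auto.
      + apply ext_cont; auto. now apply (Cm2_continuous (S m)), Ha.
      + intros x t Hx Ht. symmetry. now apply ext_eq.
      + now apply (Cm2_continuous m).
      + now apply (Cm2_continuous m).
    - intros i Hi. destruct (Hgt i Hi) as (H1 & H2 & H3).
      apply (ext_C1s T (g i)); auto.
      + apply ext_cont; auto. now apply (Cm2_continuous (S m)), Hg.
      + intros x t Hx Ht. symmetry. now apply ext_eq.
      + now apply (Cm2_continuous m).
      + now apply (Cm2_continuous m).
    - intros i Hi. apply ext_cont; auto.
    - intros i Hi. apply (broad_ext (Hin i Hi) T (u i) (forcing n a g u i)); auto.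
      + intros x t Hx Ht. symmetry. now apply ext_eq.
      + intros x t Hx Ht. apply forcing_ext; intros; symmetry; apply ext_eq; lra.
    - intros i Hi t. apply continuous_Rmax_T. now apply (Cm1_continuous (S m)), Hb.
    - intros i Hi t. apply continuous_Rmax_T. apply (Cm1_continuous m). now apply Hb'.
    - intros i Hi t Ht. rewrite Rmax_right by lra.
      assert (Hl : locally t (fun s => T <= s)).
      { assert (Hd : 0 < t - T) by lra. exists (mkposreal _ Hd). intros s Hs.
        change (Rabs (s - t) < t - T) in Hs. apply Rabs_def2 in Hs. lra. }
      apply (is_derive_ext_loc (b i)); [|now apply Hb'].
      revert Hl. apply filter_imp. intros s Hs. now rewrite Rmax_right.
    - intros i Hi t Ht. rewrite Rmax_right by assumption.
      rewrite ext_eq; auto. apply (inflow_range (Hin i Hi)). }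
  destruct (system_C1 HS) as (T1 & HT1 & HV).
  destruct (index_choice (fun _ _ => 0) n _ HV) as [V HV']. clear HV.
  destruct (index_choice (fun _ _ => 0) n _ HV') as [Vx HV]. clear HV'.
  destruct (index_choice (fun _ _ => 0) n _ HV) as [Vt HV']. clear HV. rename HV' into HV.
  assert (HVu : forall i x t, (1 <= i <= n)%nat -> 0 <= x <= 1 -> T1 <= t -> u i x t = V i x t).
  { intros i x t Hi Hx Ht. rewrite <- (proj2 (HV i Hi)) by assumption. symmetry. apply ext_eq; lra. }
  pose proof (fun i Hi => proj1 (HV i Hi)) as HV1.
  (* [V] agrees with [u] from [T1] on in the closed strip and has the continuity on the whole plane
     that [C1s] demands, so the derived system is formed for [V]. *)
  assert (HS1 : system n T1 (fun i => ext 0 (lam i)) (fun i => ext T (lamx i)) (fun i => ext T (lamt i)) sg e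
    (fun i j => ext T (a i j)) (fun i j => ext T (ax i j)) (fun i j => ext T (at' i j))
    (fun i => ext T (g i)) (fun i => ext T (gx i)) (fun i => ext T (gt i)) V
    (fun i t => b i (Rmax T t)) (fun i t => b' i (Rmax T t))).
  { destruct HS as [_ _ S2 _ S4 S5 _ S7 S8 S9 S10 S11]. split; auto.
    - lra.
    - intros i Hi. apply (C1s_later T); auto.
    - intros i j Hi Hj. apply (C1s_later T); auto.
    - intros i Hi. apply (C1s_later T); auto.
    - intros i Hi. apply (c1_f (HV1 i Hi)).
    - intros i Hi. apply (broad_ext (Hin i Hi) T1 (ext T (u i))
        (forcing n (fun i j => ext T (a i j)) (fun i => ext T (g i)) (fun i => ext T (u i)) i)).
      + intros x t Hx Ht. rewrite ext_eq by lra. now apply HVu.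
      + intros x t Hx Ht. apply forcing_ext; auto. intros j Hj. rewrite ext_eq by lra. apply HVu; auto; lra.
      + apply (broad_later T); auto.
    - intros i Hi t Ht. apply S10; auto. lra.
    - intros i Hi t Ht. rewrite <- S11 by (auto; lra). pose proof (inflow_range (Hin i Hi)).
      rewrite ext_eq by lra. symmetry. now apply HVu. }
  (* The margin 1 gives T1 < t for all t >= [T3], as [derived_boundary] requires; from [T2] on [u]
     is C^m. *)
  set (T3 := Rmax (T1 + 1) T2).
  assert (HT3 : T1 + 1 <= T3 /\ T2 <= T3) by (split; [apply Rmax_l|apply Rmax_r]).
  assert (Hsub : forall T', T <= T' -> forall p, half_strip T' p -> half_strip T p).
  { intros T' HT' p [Hp Hp']. split; [assumption|lra]. }
  set (A i j x t := a i j x t - (if Nat.eqb j i then lamt i x t / lam i x t else 0)).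
  set (G i x t := gt i x t - sum1 n (fun j => at' i j x t * u j x t)
                  - lamt i x t / lam i x t * forcing n a g u i x t).
  assert (Hdiv : forall i, (1 <= i <= n)%nat -> Cm2 m (half_strip T3) (fun x t => lamt i x t / lam i x t)).
  { intros i Hi. apply Cm2_div.
    - intros x t Hp. apply half_strip_iff in Hp; [|lra]. apply lam_nonzero; auto; lra.
    - apply (Cm2_subset m (half_strip T)); [apply Hsub; lra|]. now apply Hlt.
    - apply lam_half_strip; auto; lra. }
  assert (Hum3 : forall i, (1 <= i <= n)%nat -> Cm2 m (half_strip T3) (u i)).
  { intros i Hi. apply (Cm2_subset m (half_strip T2)); [|now apply Hum].
    intros p [Hp Hp']. split; [assumption|lra]. }
  assert (Ha3 : forall i j, (1 <= i <= n)%nat -> (1 <= j <= n)%nat -> Cm2 m (half_strip T3) (a i j)).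
  { intros i j Hi Hj. apply (Cm2_subset m (half_strip T)); [apply Hsub; lra|]. now apply Cm2_le, Ha. }
  assert (HF3 : forall i, (1 <= i <= n)%nat -> Cm2 m (half_strip T3) (forcing n a g u i)).
  { intros i Hi. apply Cm2_forcing; auto.
    apply (Cm2_subset m (half_strip T)); [apply Hsub; lra|]. now apply Cm2_le, Hg. }
  (* Second use of the induction hypothesis: [Vt] solves the derived system, so it is C^m from some
     later time on. *)
  destruct (IH T3 A G Vt b') as (T4 & HT4 & Hw).
  - lra.
  - intros i j Hi Hj. apply Cm2_minus; [now apply Ha3|].
    destruct (Nat.eqb j i); [now apply Hdiv|apply Cm2_const].
  - intros i Hi. apply Cm2_minus; [apply Cm2_minus|apply Cm2_mult; auto].
    + apply (Cm2_subset m (half_strip T)); [apply Hsub; lra|]. now apply Hgt.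
    + apply (Cm2_sum1 m n _ (fun j x t => at' i j x t * u j x t)). intros j Hj.
      apply Cm2_mult; auto.
      apply (Cm2_subset m (half_strip T)); [apply Hsub; lra|]. now apply Hat.
  - intros i Hi. apply (Cm1_subset m (fun t => T <= t)); [intros t Ht; cbv beta in *; lra|]. now apply Hb'.
  - intros i Hi. apply continuous_on_forall. intros p _. apply (c1_ft (HV1 i Hi)).
  - intros i Hi. apply (broad_ext (Hin i Hi) T3 _ _ _ _ (fun _ _ _ _ => eq_refl)) with
      (2 := broad_later T1 T3 _ _ ltac:(lra) (derived_broad HS1 HV1 i Hi)).
    intros x t Hx Ht.
    assert (Hx' : 0 <= x <= 1) by lra. assert (HTt : T <= t) by lra. assert (H0t : 0 <= t) by lra.
    apply forcing_ext; auto.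
    + intros j Hj. unfold A. rewrite !ext_eq by assumption. reflexivity.
    + unfold G. rewrite !ext_eq by assumption. f_equal; [f_equal|f_equal].
      * apply sum1_ext. intros j Hj. rewrite ext_eq by assumption. f_equal. symmetry. apply HVu; auto; lra.
      * apply forcing_ext; intros; try (apply ext_eq; assumption). symmetry. apply HVu; auto; lra.
  - intros i Hi t Ht. rewrite (derived_boundary HS1 HV1 i t Hi) by lra. now rewrite Rmax_right by lra.
  - exists T4. split; [lra|]. intros i Hi.
    assert (Hsub4 : forall p, half_strip T4 p -> half_strip T3 p).
    { intros p [Hp Hp']. split; [assumption|lra]. }
    split.
    { apply (continuous_on_subset (half_strip T)); [apply Hsub; lra|now apply Hu]. }
    (* The x-derivative is given by the equation rather than as [Vx], because in this form its C^m
       regularity follows from that of u and u_t. *)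
    exists (fun x t => (forcing n a g u i x t - Vt i x t) / lam i x t), (Vt i).
    split; [|split; [now apply Hw|]].
    + apply Cm2_div.
      * intros x t Hp. apply half_strip_iff in Hp; [|lra]. apply lam_nonzero; auto; lra.
      * apply Cm2_minus; [|now apply Hw]. apply (Cm2_subset m (half_strip T3)); auto.
      * apply lam_half_strip; auto; lra.
    + intros x t Hl. pose proof (proj1 (half_strip_interior T4 x t ltac:(lra)) Hl) as [Hx Ht].
      apply locally_sections in Hl. destruct Hl as [Hlx' Hlt'].
      assert (Hx' : 0 <= x <= 1) by lra. assert (HTt : T <= t) by lra. assert (H0t : 0 <= t) by lra.
      split.
      * apply (is_derive_ext_loc (fun y => V i y t)).
        { revert Hlx'. apply filter_imp. intros y Hy. apply half_strip_iff in Hy; [|lra].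
          symmetry. apply HVu; auto; lra. }
        eapply is_derive_eq; [apply (c1_dx (HV1 i Hi)); auto; lra|].
        rewrite (system_equation HS1 HV1 i x t Hi Hx') by lra. rewrite !ext_eq by assumption.
        f_equal. f_equal.
        apply forcing_ext; intros; try (apply ext_eq; assumption). symmetry. apply HVu; auto; lra.
      * apply (is_derive_ext_loc (fun s => V i x s)).
        { revert Hlt'. apply filter_imp. intros s Hs. apply half_strip_iff in Hs; [|lra].
          symmetry. apply HVu; auto; lra. }
        apply (c1_dt (HV1 i Hi)); auto; lra.
Qed.

End Regularity.

(** * Characteristics and the integral equation in terms of the flow *)

(** Local bounds |f(z)| + 1 and a finite subcover of the rectangle; points are coded as nested pairs
    [Tn 2 R] to match the compactness theorem, whose conclusion is doubly negated. *)
Lemma rectangle_bound (f : R -> R -> R) (N : R) : cont2 f ->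
  exists M, 0 < M /\ forall x t, 0 <= x <= 1 -> Rabs t <= N -> Rabs (f x t) <= M.
Proof.
  intros Hf.
  assert (H : forall z : Tn 2 R, exists d : posreal, forall x t,
    Rabs (x - fst z) < d -> Rabs (t - fst (snd z)) < d ->
    Rabs (f x t) <= Rabs (f (fst z) (fst (snd z))) + 1).
  { intros z. destruct (continuous_Reps' _ _ (Hf (fst z, fst (snd z))) 1 Rlt_0_1) as [d Hd].
    exists d. intros x t Hx Ht. specialize (Hd (x, t) (conj Hx Ht)). cbn [fst snd] in Hd.
    replace (f x t) with (f (fst z) (fst (snd z)) + (f x t - f (fst z) (fst (snd z)))) by ring.
    eapply Rle_trans; [apply Rabs_triang|]. lra. }
  pose (delta z := proj1_sig (constructive_indefinite_description _ (H z))).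
  pose proof (fun z => proj2_sig (constructive_indefinite_description _ (H z))) as Hd.
  fold delta in Hd. cbv beta in Hd.
  apply NNPP. intros Hn.
  apply (compactness_list 2 (0, (- N, tt)) (1, (N, tt)) delta).
  intros [l Hl]. apply Hn. clear Hn.
  assert (Hmax : exists M, 0 < M /\ forall z, List.In z l -> Rabs (f (fst z) (fst (snd z))) + 1 <= M).
  { clear Hl. induction l as [|z l IH].
    - exists 1. split; [lra|]. intros z [].
    - destruct IH as (M & HM & IH). exists (Rmax M (Rabs (f (fst z) (fst (snd z))) + 1)).
      split; [eapply Rlt_le_trans; [exact HM|apply Rmax_l]|].
      intros w [<-|Hw]; [apply Rmax_r|]. eapply Rle_trans; [now apply IH|apply Rmax_l]. }
  destruct Hmax as (M & HM & Hmax). exists M. split; [assumption|].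
  intros x t Hx Ht. apply Rabs_le_between in Ht.
  destruct (Hl (x, (t, tt))) as (z & Hz & _ & Hc).
  - cbn. auto.
  - destruct z as [z1 [z2 []]]. cbn in Hc. destruct Hc as (Hc1 & Hc2 & _).
    apply Rle_trans with (Rabs (f z1 z2) + 1).
    + apply (Hd (z1, (z2, tt))); assumption.
    + exact (Hmax _ Hz).
Qed.

Lemma C1s_space_integral (T : R) (f fx ft : R -> R -> R) (x0 x1 t : R) :
  C1s T f fx ft -> 0 <= x0 -> x0 <= x1 -> x1 <= 1 -> T <= t ->
  f x1 t - f x0 t = RInt (fun y => fx y t) x0 x1.
Proof.
  intros [Hf Hfx _ Hdx _] H0 H01 H1.
  assert (H : forall t, T < t -> f x1 t - f x0 t = RInt (fun y => fx y t) x0 x1).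
  { intros s Hs. apply (FTC_open (fun y => f y s)); auto; try (intros; now apply cont2_x).
    intros y Hy. apply Hdx; lra. }
  intros [Ht| <-]; [now apply H|].
  apply (eq_at_start (fun t => f x1 t - f x0 t) (fun t => RInt (fun y => fx y t) x0 x1)); auto; [cts|].
  apply (continuous_RInt_param (fun t y => fx y t)); intros; cts.
Qed.

Lemma clamp_lipschitz (x y : R) : Rabs (clamp x - clamp y) <= Rabs (x - y).
Proof.
  unfold clamp, Rmax, Rmin, Rabs.
  repeat destruct (Rle_dec _ _); repeat destruct (Rcase_abs _); lra.
Qed.

(** A bound for the x-derivative on a compact part of the strip is a Lipschitz constant there, and
    clamping, being 1-Lipschitz, spreads it to all positions; times below 0 are read at 0. *)
Lemma ext_regular (l : R -> R -> R) : Cm2 1 Pibar l -> regular_field (ext 0 l).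
Proof.
  intros H.
  assert (H' : Cm2 1 (half_strip 0) l) by (apply (Cm2_subset 1 Pibar); [now intros p []|assumption]).
  clear H. pose proof (Cm2_continuous _ _ _ H') as Hc.
  destruct H' as [_ (lx & lt & Hx & Ht & Hd)].
  pose proof (ext_cont 0 l (Rle_refl 0) Hc) as Hcl.
  assert (HC : C1s 0 (ext 0 l) (ext 0 lx) (ext 0 lt)).
  { apply (ext_C1s 0 l); auto; try lra.
    - intros x t Hx0 Ht0. symmetry. now apply ext_eq.
    - apply Hx.
    - apply Ht. }
  assert (Hcc : forall f x t, ext 0 f x t = ext 0 f (clamp x) (Rmax 0 t)).
  { intros f x t. unfold ext. rewrite (clamp_id (clamp x)) by apply clamp_bounds.
    now rewrite (Rmax_right 0 (Rmax 0 t)) by apply Rmax_l. }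
  assert (HN : forall N t, Rabs t <= N -> Rabs (Rmax 0 t) <= N).
  { intros N t. unfold Rmax, Rabs. destruct (Rle_dec 0 t); repeat destruct (Rcase_abs _); lra. }
  split; [assumption| |].
  - intros N. destruct (rectangle_bound (ext 0 lx) N (c1_fx HC)) as (L & HL & Hb).
    exists L. split; [assumption|].
    assert (Hle : forall x y t, 0 <= x -> x <= y -> y <= 1 -> 0 <= t -> Rabs t <= N ->
                    Rabs (ext 0 l x t - ext 0 l y t) <= L * Rabs (x - y)).
    { intros x y t Hx0 Hxy Hy1 Ht0 HtN. rewrite (Rabs_minus_sym (ext 0 l x t)), (Rabs_minus_sym x).
      rewrite (C1s_space_integral 0 _ _ _ x y t HC) by assumption.
      apply RInt_bound; [intros; apply cont2_x, HC|].
      intros s Hs. rewrite Rmin_left, Rmax_right in Hs by assumption. apply Hb; [lra|assumption]. }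
    intros x y t HtN. rewrite (Hcc l x t), (Hcc l y t).
    apply Rle_trans with (L * Rabs (clamp x - clamp y)).
    2:{ apply Rmult_le_compat_l; [lra|apply clamp_lipschitz]. }
    pose proof (clamp_bounds x). pose proof (clamp_bounds y).
    destruct (Rle_dec (clamp x) (clamp y)).
    + apply Hle; auto; try lra. apply Rmax_l.
    + rewrite (Rabs_minus_sym (ext _ _ _ _)), (Rabs_minus_sym (clamp x)).
      apply Hle; auto; try lra. apply Rmax_l.
  - intros N. destruct (rectangle_bound (ext 0 l) N Hcl) as (M & HM & Hb).
    exists M. split; [assumption|]. intros x t HtN. rewrite Hcc.
    apply Hb; [apply clamp_bounds|auto].
Qed.

(** * Characteristics as arcs of the flow *)

Section Characteristics.

Context {l : R -> R -> R} (Hl : regular_field (ext 0 l)).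

(** A solution that stays in the closed strip also solves the equation with the extended speed, so
    uniqueness identifies it with an arc of the flow. *)
Lemma on_char_flow (x t y tau : R) : on_char l x t y tau ->
  y = flow (ext 0 l) tau x t /\
  forall s, Rmin t tau <= s <= Rmax t tau -> 0 <= s /\ 0 <= flow (ext 0 l) s x t <= 1.
Proof.
  intros (xi & (Hp & Hc & Hd) & <- & <-).
  set (lo := Rmin t tau) in *. set (hi := Rmax t tau) in *.
  assert (Hlohi : lo <= hi) by (unfold lo, hi, Rmin, Rmax; destruct (Rle_dec t tau); lra).
  (* [xi] is continuous only relative to its segment; freezing it beyond the ends gives the
     two-sided continuity that [flow_unique] asks for. *)
  set (z s := xi (Rmax lo (Rmin hi s))).
  assert (Hz : forall s, lo <= s <= hi -> z s = xi s).
  { intros s Hs. unfold z. now rewrite (Rmin_right hi s), Rmax_right by lra. }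
  assert (Heq : forall r, lo <= r <= hi -> xi r = flow (ext 0 l) r (xi t) t).
  { assert (Ht : lo <= t <= hi) by (split; [apply Rmin_l|apply Rmax_l]).
    intros r Hr. rewrite <- (Hz r Hr), <- (Hz t Ht).
    apply (flow_unique Hl z lo hi); auto.
    - intros u _.
      assert (Hcl : continuous (fun s => Rmax lo (Rmin hi s)) u) by cts.
      assert (Hin : forall s, lo <= Rmax lo (Rmin hi s) <= hi).
      { intros s. unfold Rmax, Rmin. repeat destruct (Rle_dec _ _); lra. }
      apply (filterlim_comp _ _ _ (fun s => Rmax lo (Rmin hi s)) xi _
               (within (fun s => lo <= s <= hi) (locally (Rmax lo (Rmin hi u)))) _).
      + intros P HP. specialize (Hcl _ HP).
        change (locally u (fun s => lo <= Rmax lo (Rmin hi s) <= hi -> P (Rmax lo (Rmin hi s)))) in Hcl.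
        change (locally u (fun s => P (Rmax lo (Rmin hi s)))). revert Hcl. apply filter_imp.
        intros s Hs. apply Hs, Hin.
      + exact (Hc _ (Hin u)).
    - intros u Hu. rewrite Hz by lra.
      destruct (Hp u) as [Hp1 Hp2]; [lra|]. cbn in Hp1, Hp2. rewrite ext_eq by assumption.
      apply (is_derive_ext_loc xi); [|now apply Hd].
      assert (Hk : 0 < Rmin (u - lo) (hi - u)) by (apply Rmin_pos; lra).
      exists (mkposreal _ Hk). intros s Hs. change (Rabs (s - u) < Rmin (u - lo) (hi - u)) in Hs.
      pose proof (Rmin_l (u - lo) (hi - u)). pose proof (Rmin_r (u - lo) (hi - u)).
      apply Rabs_def2 in Hs. symmetry. apply Hz. lra. }
  split.
  - apply Heq. split; [apply Rmin_r|apply Rmax_r].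
  - intros s Hs. destruct (Hp s Hs) as [H1 H2]. cbn in H1, H2. rewrite <- Heq by assumption. now split.
Qed.

Lemma flow_on_char (x t tau : R) :
  (forall s, Rmin t tau <= s <= Rmax t tau -> 0 <= s /\ 0 <= flow (ext 0 l) s x t <= 1) ->
  on_char l x t (flow (ext 0 l) tau x t) tau.
Proof.
  intros H. exists (fun s => flow (ext 0 l) s x t). split; [|split].
  - split; [|split].
    + intros s Hs. destruct (H s Hs). now split.
    + apply continuous_on_forall. intros s _. now apply flow_time_cont.
    + intros s Hs. destruct (H s ltac:(lra)) as [H1 H2].
      rewrite <- (ext_eq 0 l) by assumption. now apply flow_derive.
  - now apply flow_init.
  - reflexivity.
Qed.

(** Uniqueness makes [iota] return the flow as long as the arc between the two times stays in the
    closed strip; otherwise no point satisfies [on_char]. *)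
Lemma omega_flow (x t tau : R) :
  (forall s, Rmin t tau <= s <= Rmax t tau -> 0 <= s /\ 0 <= flow (ext 0 l) s x t <= 1) ->
  omega l tau x t = flow (ext 0 l) tau x t.
Proof.
  intros H. apply (iota_unique (V := R_CompleteNormedModule)).
  - intros y Hy. now apply on_char_flow.
  - now apply flow_on_char.
Qed.

Context {sg e : R} (Hin : inflow (ext 0 l) sg e).

(** Time 0 replaces a foot in the past, since the curve then enters [Pibar] through the initial
    segment. *)
Definition entry_time (x t : R) : R := Rmax 0 (foot (ext 0 l) e x t).

Lemma entry_segment (x t s : R) : 0 <= x <= 1 -> entry_time x t <= s <= t ->
  forall r, Rmin t s <= r <= Rmax t s -> 0 <= r /\ 0 <= flow (ext 0 l) r x t <= 1.
Proof.
  intros Hx Hs r Hr. rewrite Rmin_right, Rmax_left in Hr by lra.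
  pose proof (Rmax_l 0 (foot (ext 0 l) e x t)). pose proof (Rmax_r 0 (foot (ext 0 l) e x t)).
  unfold entry_time in Hs. split; [lra|]. apply (flow_after_foot Hin); [assumption|lra].
Qed.

Lemma entry_le (x t : R) : 0 <= x <= 1 -> 0 <= t -> entry_time x t <= t.
Proof. intros Hx Ht. apply Rmax_lub; [assumption|]. now apply (foot_spec Hin). Qed.

(** At the entry time the curve is on the initial segment or at the inflow end; an arc reaching
    further back would pass below time 0 or, by monotonicity, leave the strip. *)
Lemma t_hit_entry (x t : R) : 0 <= x <= 1 -> 0 <= t -> t_hit l x t = entry_time x t.
Proof.
  intros Hx Ht.
  assert (Hm : meets_boundary l x t (entry_time x t)).
  { pose proof (entry_le x t Hx Ht) as Hle.
    pose proof (entry_segment x t (entry_time x t) Hx (conj (Rle_refl _) Hle)) as Hseg.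
    split; [apply Rmax_l|]. exists (flow (ext 0 l) (entry_time x t) x t).
    split; [now apply flow_on_char|].
    destruct (Hseg (entry_time x t)) as [H1 H2]; [split; [apply Rmin_r|apply Rmax_r]|].
    split; [now split|]. intros [H3 H4]. cbn in H3, H4.
    destruct (Rle_dec (foot (ext 0 l) e x t) 0) as [Hf|Hf].
    - unfold entry_time in H4. rewrite Rmax_left in H4 by assumption. lra.
    - unfold entry_time in H3. rewrite Rmax_right in H3 by lra.
      rewrite (proj1 (foot_spec Hin x t Hx)) in H3.
      destruct (in_side Hin) as [[_ He]|[_ He]]; rewrite He in H3; lra. }
  assert (Hmin : forall s, meets_boundary l x t s -> entry_time x t <= s).
  { intros s (Hs & y & Hy & _). apply on_char_flow in Hy. destruct Hy as [_ Hy].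
    apply Rmax_lub; [assumption|]. apply Rnot_lt_le. intros Hlt.
    apply (flow_before_foot Hin x t s Hx Hlt). apply Hy. split; [apply Rmin_r|apply Rmax_r]. }
  apply (iota_unique (V := R_CompleteNormedModule)).
  - intros s [Hs1 Hs2]. apply Rle_antisym; auto.
  - now split.
Qed.

Lemma entry_flow (x t s : R) : 0 <= x <= 1 -> entry_time (flow (ext 0 l) s x t) s = entry_time x t.
Proof. intros Hx. unfold entry_time. now rewrite (foot_flow Hin). Qed.

End Characteristics.

(** * From the integral equation to transport along the flow *)

Section Unfold.

Context {n : nat} {lam : nat -> R -> R -> R} {a : nat -> nat -> R -> R -> R}
  {g : nat -> R -> R -> R} {h phi : nat -> R -> R} {u : nat -> R -> R -> R}
  (Hsol : continuous_solution n lam a g h phi u)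
  (Ha : forall i j, (1 <= i <= n)%nat -> (1 <= j <= n)%nat -> smooth2 Pibar (a i j))
  (Hg : forall i, (1 <= i <= n)%nat -> smooth2 Pibar (g i))
  {sg e : nat -> R}
  (Hin : forall i, (1 <= i <= n)%nat -> inflow (ext 0 (lam i)) (sg i) (e i)).

Let fl (i : nat) := flow (ext 0 (lam i)).

Let coupling (i : nat) (x t : R) : R :=
  - sum1 n (fun j => if Nat.eqb j i then 0 else ext 0 (a i j) x t * ext 0 (u j) x t) + ext 0 (g i) x t.

Lemma ext0_cont (f : R -> R -> R) : continuous_on Pibar (fun p => f (fst p) (snd p)) -> cont2 (ext 0 f).
Proof.
  intros H. apply ext_cont; [lra|]. apply (continuous_on_subset Pibar); [now intros p []|assumption].
Qed.

Lemma coupling_cont (i : nat) : (1 <= i <= n)%nat -> cont2 (coupling i).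
Proof.
  intros Hi p. unfold coupling. cts.
  - apply (continuous_sum1 n (fun j q => if Nat.eqb j i then 0 else ext 0 (a i j) (fst q) (snd q) * ext 0 (u j) (fst q) (snd q))).
    intros j Hj. destruct (Nat.eqb j i); [cts|].
    pose proof (ext0_cont _ (Cm2_continuous 0 _ _ (Ha i j Hi Hj 0%nat))).
    pose proof (ext0_cont _ (proj1 Hsol j Hj)). cts.
  - exact (ext0_cont _ (Cm2_continuous 0 _ _ (Hg i Hi 0%nat)) p).
Qed.

Lemma E_flow (i : nat) (x t tau : R) : (1 <= i <= n)%nat -> 0 <= x <= 1 ->
  entry_time (l := lam i) (e := e i) x t <= tau <= t ->
  E lam a i tau x t = exp (RInt (fun s => ext 0 (a i i) (fl i s x t) s) t tau).
Proof.
  intros Hi Hx Htau. unfold E. f_equal. apply RInt_ext.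
  rewrite Rmin_right, Rmax_left by lra. intros s Hs.
  assert (Hs' : entry_time (l := lam i) (e := e i) x t <= s <= t) by lra.
  pose proof (entry_segment (Hin i Hi) x t s Hx Hs') as Hseg.
  rewrite (omega_flow (in_reg (Hin i Hi)) x t s Hseg).
  destruct (Hseg s) as [H1 H2]; [split; [apply Rmin_r|apply Rmax_r]|].
  symmetry. now apply ext_eq.
Qed.

Lemma solution_along_flow (i : nat) (x t : R) : (1 <= i <= n)%nat -> 0 <= x <= 1 -> 0 <= t ->
  let t0 := entry_time (l := lam i) (e := e i) x t in
  let A tau := RInt (fun s => ext 0 (a i i) (fl i s x t) s) t tau in
  u i x t = exp (A t0) * B lam h phi i x t + RInt (fun tau => exp (A tau) * coupling i (fl i tau x t) tau) t0 t.
Proof.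
  intros Hi Hx Ht t0 A.
  rewrite (proj2 Hsol i Hi x t) by (split; cbn; assumption).
  pose proof (entry_le (Hin i Hi) x t Hx Ht) as Hle.
  rewrite (t_hit_entry (in_reg (Hin i Hi)) (Hin i Hi) x t Hx Ht). fold t0 in Hle |- *.
  rewrite E_flow by (auto; fold t0; lra).
  f_equal. apply RInt_Rext; [assumption|]. intros tau Htau. cbv zeta.
  rewrite E_flow by (auto; fold t0; lra). fold (A tau). f_equal.
  assert (Hs' : entry_time (l := lam i) (e := e i) x t <= tau <= t) by (fold t0; lra).
  pose proof (entry_segment (Hin i Hi) x t tau Hx Hs') as Hseg.
  rewrite (omega_flow (in_reg (Hin i Hi)) x t tau Hseg).
  destruct (Hseg tau) as [H1 H2]; [split; [apply Rmin_r|apply Rmax_r]|].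
  unfold coupling. rewrite (ext_eq 0 (g i)) by assumption. f_equal. f_equal.
  apply (sum1_ext n). intros j Hj. destruct (Nat.eqb j i); [reflexivity|].
  now rewrite !ext_eq.
Qed.

(** Entry time and entry point belong to the curve, not to the point chosen on it. *)
Lemma B_flow (i : nat) (x t s : R) : (1 <= i <= n)%nat -> 0 <= x <= 1 -> 0 <= t ->
  0 <= fl i s x t <= 1 -> 0 <= s ->
  B lam h phi i (fl i s x t) s = B lam h phi i x t.
Proof.
  intros Hi Hx Ht Hx' Hs. pose proof (in_reg (Hin i Hi)) as Hl. unfold B.
  rewrite !(t_hit_entry Hl (Hin i Hi)) by assumption.
  unfold fl. rewrite (entry_flow (Hin i Hi)) by assumption.
  destruct (Req_EM_T _ 0) as [H0|_]; [|reflexivity]. f_equal.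
  rewrite !(omega_flow Hl).
  - now apply flow_flow.
  - apply (entry_segment (Hin i Hi)); [assumption|]. rewrite H0. lra.
  - apply (entry_segment (Hin i Hi)); [assumption|]. rewrite (entry_flow (Hin i Hi)), H0 by assumption. lra.
Qed.

(** On a fixed curve the entry time and the boundary value are common to all points, so the integral
    equation becomes the variation-of-constants formula [psi] of a scalar linear equation, which can
    be differentiated. *)
Lemma solution_broad (i : nat) (T : R) : (1 <= i <= n)%nat -> 0 <= T ->
  Broad (ext 0 (lam i)) T (u i) (forcing n a g u i).
Proof.
  intros Hi HT y t a0 b0 Ha0 Hab Hseg.
  pose proof (in_reg (Hin i Hi)) as Hl.
  set (x := flow (ext 0 (lam i)) a0 y t).
  assert (Hfl : forall s, flow (ext 0 (lam i)) s y t = fl i s x a0).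
  { intros s. unfold x, fl. now rewrite flow_flow. }
  assert (Hx : 0 <= x <= 1) by (apply Hseg; lra).
  set (z s := fl i s x a0).
  assert (Hz : forall s, continuous z s) by (intros; now apply flow_time_cont).
  assert (Hza : z a0 = x) by now apply flow_init.
  set (al s := ext 0 (a i i) (z s) s).
  pose proof (ext0_cont _ (Cm2_continuous 0 _ _ (Ha i i Hi Hi 0%nat))) as Haii.
  assert (Hal : forall s, continuous al s) by (intros s; apply (cont2_comp _ z (fun s => s) s Haii); [auto|cts]).
  set (ga s := coupling i (z s) s).
  assert (Hga : forall s, continuous ga s).
  { intros s. apply (cont2_comp _ z (fun s => s) s (coupling_cont i Hi)); [auto|cts]. }
  (* Basing all integrals at the common entry time factors the weight from s to r as exp(A r) exp(-
     A s), so the dependence on s separates. *)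
  set (t0 := entry_time (l := lam i) (e := e i) x a0).
  set (A s := RInt al t0 s).
  assert (HA : forall s, continuous A s) by (intros; now apply continuous_RInt_upper).
  set (W s := RInt (fun r => exp (A r) * ga r) t0 s).
  assert (HW : forall s, continuous (fun r => exp (A r) * ga r) s).
  { intros s. specialize (HA s). specialize (Hga s). cts. }
  set (psi s := exp (- A s) * (B lam h phi i x a0 + W s)).
  assert (Hpsi : forall s, is_derive psi s (- (al s * psi s) + ga s)).
  { intros s. unfold psi.
    pose proof (is_derive_RInt_upper al t0 s Hal : is_derive A s (al s)).
    pose proof (is_derive_RInt_upper _ t0 s HW : is_derive W s (exp (A s) * ga s)).
    der. rewrite exp_Ropp. field. apply Rgt_not_eq, exp_pos. }
  assert (Hu : forall s, a0 <= s <= b0 -> u i (z s) s = psi s).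
  { intros s Hs.
    assert (Hzs : 0 <= z s <= 1) by (unfold z; rewrite <- Hfl; apply Hseg; lra).
    rewrite (solution_along_flow i (z s) s Hi Hzs) by lra.
    assert (Hent : entry_time (l := lam i) (e := e i) (z s) s = t0)
      by exact (entry_flow (Hin i Hi) x a0 s Hx).
    assert (HBz : B lam h phi i (z s) s = B lam h phi i x a0) by (apply B_flow; auto; lra).
    rewrite Hent, HBz.
    assert (HAs : forall r, RInt (fun w => ext 0 (a i i) (fl i w (z s) s) w) s r = A r - A s).
    { intros r. pose proof (RInt_Rchasles al t0 s r Hal).
      rewrite (RInt_Req _ al); [unfold A; lra|].
      intros w. unfold al, z, fl. now rewrite flow_flow. }
    rewrite HAs.
    rewrite (RInt_Req _ (fun r => exp (- A s) * (exp (A r) * ga r))).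
    - rewrite RInt_Rscal by exact HW. fold (W s). unfold psi.
      replace (A t0 - A s) with (- A s) by (unfold A; rewrite RInt_Rpoint; ring). ring.
    - intros r. fold (z s). rewrite HAs. unfold ga, z, fl. rewrite flow_flow by assumption.
      replace (A r - A s) with (- A s + A r) by ring. rewrite exp_plus. ring. }
  assert (Hua : u i x a0 = psi a0) by (rewrite <- Hu by lra; now rewrite Hza).
  rewrite Hfl. fold (z b0). rewrite Hu, Hua by lra.
  rewrite (FTC_open psi (fun s => - (al s * psi s) + ga s) a0 b0); auto.
  - apply RInt_Rext; [assumption|]. intros s Hs. rewrite Hfl. fold (z s). rewrite <- Hu by lra.
    assert (Hzs : 0 <= z s <= 1) by (unfold z; rewrite <- Hfl; apply Hseg; lra).
    assert (Hs0 : 0 <= s) by lra.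
    unfold forcing, ga, al, coupling. rewrite (sum1_split n i (fun j => a i j (z s) s * u j (z s) s) Hi).
    rewrite (ext_eq 0 (a i i)), (ext_eq 0 (g i)) by assumption.
    rewrite (sum1_ext n _ (fun j => if Nat.eqb j i then 0 else a i j (z s) s * u j (z s) s)); [ring|].
    intros j Hj. destruct (Nat.eqb j i); [reflexivity|]. now rewrite !ext_eq.
  - intros s _. eapply continuous_is_derive, Hpsi.
  - intros s. pose proof (continuous_is_derive _ _ _ (Hpsi s)). specialize (Hal s). specialize (Hga s). cts.
Qed.

(** A point of the inflow side is its own foot, so the integrals vanish; t > 0 selects the branch of
    [B] with [h]. *)
Lemma solution_boundary (i : nat) (t : R) : (1 <= i <= n)%nat -> 0 < t -> u i (e i) t = h i t.
Proof.
  intros Hi Ht. pose proof (inflow_range (Hin i Hi)) as He.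
  rewrite (solution_along_flow i (e i) t Hi He) by lra.
  assert (Hent : entry_time (l := lam i) (e := e i) (e i) t = t).
  { unfold entry_time. rewrite (foot_inflow (Hin i Hi)). apply Rmax_right. lra. }
  rewrite Hent, !RInt_Rpoint, exp_0. unfold B.
  rewrite (t_hit_entry (in_reg (Hin i Hi)) (Hin i Hi) (e i) t He) by lra. rewrite Hent.
  destruct (Req_EM_T t 0); [lra|ring].
Qed.

End Unfold.

(** Before time 0 the extended speed is that of time 0, which has a positive minimum up to sign on
    the compact segment. A curve that entered and never reached the other side would stay in the
    strip for all later times, against the boundedness of its characteristic. *)
Lemma inflow_of_sign (l : R -> R -> R) (sg e : R) :
  smooth2 Pibar l -> (sg = 1 /\ e = 0) \/ (sg = -1 /\ e = 1) ->
  (forall x t, Pibar (x, t) -> 0 < sg * l x t) ->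
  (forall x t, Pibar (x, t) -> bounded_char l x t) ->
  inflow (ext 0 l) sg e.
Proof.
  intros Hs Hside Hpos Hbd. pose proof (ext_regular l (Hs 1%nat)) as Hl.
  pose proof (rf_cont Hl) as Hlc.
  assert (Hp : forall x t, 0 < sg * ext 0 l x t).
  { intros x t. apply Hpos. split; [apply clamp_bounds|apply Rmax_l]. }
  assert (He : 0 <= e <= 1) by (destruct Hside as [[_ ->]|[_ ->]]; lra).
  split; auto.
  - destruct (continuity_ab_min (fun x => sg * ext 0 l x 0) 0 1) as (m & Hm & Hm1).
    + lra.
    + intros c _. apply continuity_pt_filterlim.
      change (continuous (fun x => sg * ext 0 l x 0) c). cts.
    + exists (sg * ext 0 l m 0). split; [apply Hp|]. intros x t Ht.
      replace (ext 0 l x t) with (ext 0 l (clamp x) 0); [apply Hm, clamp_bounds|].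
      unfold ext. rewrite (clamp_id (clamp x)) by apply clamp_bounds.
      now rewrite !Rmax_left by lra.
  - intros T HT. apply NNPP. intros Hn.
    assert (Hlt : forall s, T <= s -> sg * (flow (ext 0 l) s e T - e) < 1).
    { intros s Hs'. apply Rnot_le_lt. intros Hle. apply Hn. now exists s. }
    assert (Hge : forall s, T <= s -> 0 <= sg * (flow (ext 0 l) s e T - e)).
    { intros s Hs'.
      destruct (MVT_everywhere (fun u => sg * (flow (ext 0 l) u e T - e))
         (fun u => sg * ext 0 l (flow (ext 0 l) u e T) u) T s) as (c & _ & Hc).
      - intros u. pose proof (flow_derive Hl e T u). der. ring.
      - cbv beta in Hc. rewrite (flow_init Hl e T), Rminus_diag, Rmult_0_r in Hc.
        pose proof (Hp (flow (ext 0 l) c e T) c). nra. }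
    destruct (Hbd e T) as [M HM]; [split; cbn; assumption|].
    (* A time beyond the bound [M]: the curve is still in the strip there, hence on the
       characteristic, which contradicts the bound on times. *)
    set (s := Rmax T (M + 1)).
    assert (HsT : T <= s) by apply Rmax_l. assert (HsM : M + 1 <= s) by apply Rmax_r.
    destruct (HM (flow (ext 0 l) s e T) s) as [_ Hc].
    + apply (flow_on_char Hl). rewrite Rmin_left, Rmax_right by assumption. intros r Hr.
      split; [lra|]. pose proof (Hlt r ltac:(lra)). pose proof (Hge r ltac:(lra)).
      destruct Hside as [[-> ->]|[-> ->]]; lra.
    + pose proof (Rle_abs s). lra.
Qed.

Theorem theorem15 (n k : nat)
    (lam : nat -> R -> R -> R) (a : nat -> nat -> R -> R -> R)
    (g : nat -> R -> R -> R) (h : nat -> R -> R)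
    (Hn : (1 <= n)%nat) (Hk : (0 <= k <= n)%nat)
    (Hlam : forall i : nat, (1 <= i <= n)%nat -> smooth2 Pibar (lam i))
    (Ha : forall i j : nat, (1 <= i <= n)%nat -> (1 <= j <= n)%nat ->
            smooth2 Pibar (a i j))
    (Hg : forall i : nat, (1 <= i <= n)%nat -> smooth2 Pibar (g i))
    (Hh : forall i : nat, (1 <= i <= n)%nat ->
            smooth1 (fun t : R => 0 <= t) (h i))
    (Hord : forall x t : R, Pibar (x, t) ->
              (forall i j : nat, (1 <= i)%nat -> (i < j)%nat -> (j <= n)%nat ->
                 lam i x t < lam j x t) /\
              (forall i : nat, (1 <= i <= k)%nat -> lam i x t < 0) /\
              (forall i : nat, (k + 1 <= i <= n)%nat -> 0 < lam i x t))
    (Hbounded : forall i : nat, (1 <= i <= n)%nat ->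
                forall x t : R, Pibar (x, t) -> bounded_char (lam i) x t) :
  forall phi : nat -> R -> R,
    (forall i : nat, (1 <= i <= n)%nat ->
       continuous_on (fun x : R => 0 <= x <= 1) (phi i)) ->
    (forall i : nat, (k + 1 <= i <= n)%nat -> phi i 0 = h i 0) ->
    (forall i : nat, (1 <= i <= k)%nat -> phi i 1 = h i 0) ->
  forall u : nat -> R -> R -> R,
    continuous_solution n lam a g h phi u -> smoothing n u.
Proof.
  intros phi _ _ _ u Hsol m.
  set (sg i := if Nat.leb i k then -1 else 1). set (e i := if Nat.leb i k then 1 else 0).
  assert (Hin : forall i, (1 <= i <= n)%nat -> inflow (ext 0 (lam i)) (sg i) (e i)).
  { intros i Hi. apply inflow_of_sign; auto; unfold sg, e; destruct (Nat.leb_spec i k); auto.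
    - intros x t Hp. destruct (Hord x t Hp) as (_ & H1 & _). specialize (H1 i ltac:(lia)). lra.
    - intros x t Hp. destruct (Hord x t Hp) as (_ & _ & H1). specialize (H1 i ltac:(lia)). lra. }
  assert (Hne : forall i j, (1 <= i <= n)%nat -> (1 <= j <= n)%nat -> i <> j ->
           forall x t, ext 0 (lam i) x t <> ext 0 (lam j) x t).
  { intros i j Hi Hj Hij x t.
    destruct (Hord (clamp x) (Rmax 0 t)) as [H1 _]; [split; [apply clamp_bounds|apply Rmax_l]|].
    unfold ext. destruct (Nat.lt_ge_cases i j).
    - apply Rlt_not_eq, H1; lia.
    - apply Rgt_not_eq, H1; lia. }
  assert (Hsub : forall p, half_strip 1 p -> Pibar p) by now intros p [].
  (* The start must be a positive time, 1 being one choice: [solution_boundary] needs t > 0, as at t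
     = 0 the value [B] is read from [phi]. It also makes the final T positive. *)
  destruct (solution_Cm Hlam Hin Hne m 1 a g u h) as (T & HT & HCm).
  - lra.
  - intros i j Hi Hj. apply (Cm2_subset m Pibar); [assumption|now apply Ha].
  - intros i Hi. apply (Cm2_subset m Pibar); [assumption|now apply Hg].
  - intros i Hi. apply (Cm1_subset m (fun t => 0 <= t)); [intros t Ht; cbv beta in *; lra|now apply Hh].
  - intros i Hi. apply (continuous_on_subset Pibar); [assumption|now apply Hsol].
  - intros i Hi. apply (solution_broad Hsol Ha Hg Hin i 1 Hi). lra.
  - intros i Hi t Ht. apply (solution_boundary Hsol Hin); [assumption|lra].
  - exists T. split; [lra|exact HCm].
Qed.
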